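(* Let $\Lambda$ be a G-semisimple algebra, let $n\geq 2$, and let $G$ be an indecomposable non-projective Gorenstein projective $\Lambda$-module. Let $P^1$ be a projective cover of $\Omega_\Lambda(G)$. Then: (1) The almost split sequence in $\mathcal{S}_n(\mathrm{Gprj}\text{-}\Lambda)$ ending at $[n,n,\Omega^{-1}_\Lambda(G)]$ is of the form $$0\to[1,n,G]\to[1,n-1,G]\to[n,n,\Omega_\Lambda^{-1}(G)]\to 0.$$ (2) The almost split sequence in $\mathcal{S}_n(\mathrm{Gprj}\text{-}\Lambda)$ ending at $[1,n,G]$ is of the form $$0\to[1,1,\Omega_\Lambda(G)]\to[0,0,P^1]\oplus[2,n,G]\to[1,n,G]\to 0.$$ (3) Let $1\leq i<n$. The almost split sequence in $\mathcal{S}_n(\mathrm{Gprj}\text{-}\Lambda)$ ending at $[i,i,\Omega_\Lambda(G)]$ is of the form $$0\to[i+1,i+1,\Omega_\Lambda(G)]\to[i,i,P^1]\oplus[i,i+1,\Omega_\Lambda(G)]\to[i,i,\Omega_\Lambda(G)]\to 0.$$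
   Context: Modules are finitely generated right modules. An object of an abelian category with enough projectives is Gorenstein projective if it is a syzygy of an acyclic complex $\mathbf{P}^\bullet$ of projective objects such that $\mathrm{Hom}(\mathbf{P}^\bullet,Q)$ is acyclic for every projective object $Q$. $\mathrm{Gprj}\text{-}\Lambda$ is the category of Gorenstein projective $\Lambda$-modules and $\underline{\mathrm{Gprj}}\text{-}\Lambda$ its stable category modulo projectives. $\Omega_\Lambda(M)$ is the kernel of a projective cover of $M$; $\Omega_\Lambda^{-1}(G)$ is the cokernel of a minimal left approximation of $G\in\mathrm{Gprj}\text{-}\Lambda$ by projectives (so $\Omega_\Lambda\Omega_\Lambda^{-1}(G)\simeq G$ for $G$ indecomposable non-projective). For an additive category $\mathcal{X}$, $\mathrm{mod}\text{-}\mathcal{X}$ denotes the category of finitely presented contravariant additive functors from $\mathcal{X}$ to abelian groups. An Artin algebra $\Lambda$ (with $\mathrm{Gprj}\text{-}\Lambda$ contravariantly finite in $\mathrm{mod}\text{-}\Lambda$) is G-semisimple if $\mathrm{mod}\text{-}(\underline{\mathrm{Gprj}}\text{-}\Lambda)$ is a semisimple abelian category, i.e. all its objects are projective. $A_n=v_1\to\cdots\to v_n$ is the linear quiver, and $\mathcal{S}_n(\mathrm{Gprj}\text{-}\Lambda)=\mathrm{Gprj}(A_n,\Lambda)$ is the category of Gorenstein projective objects in the category $\mathrm{rep}(A_n,\Lambda)$ of representations $X_1\to\cdots\to X_n$ of $A_n$ by finitely generated $\Lambda$-modules, with the inherited exact structure. A short exact sequence $0\to A\xrightarrow{f}B\xrightarrow{g}C\to0$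 in an exact category is almost split if $f$ is left almost split and $g$ is right almost split in that category. For $H\in\mathrm{Gprj}\text{-}\Lambda$ and $1\le i\le j\le n$, with projective cover $P\to H$, $$[i,j,H]=(0\to\cdots\to0\to\Omega_\Lambda(H)\xrightarrow{1}\cdots\xrightarrow{1}\Omega_\Lambda(H)\xrightarrow{l}P\xrightarrow{1}\cdots\xrightarrow{1}P),$$ with $\Omega_\Lambda(H)$ at vertices $i,\dots,j$, $P$ at vertices $j+1,\dots,n$, zero at vertices $<i$, and $l$ the inclusion $\Omega_\Lambda(H)\hookrightarrow P$. For a projective module $P$, $[0,0,P]=(P\xrightarrow{1}\cdots\xrightarrow{1}P)$; in particular, $[i,i,P]$ with $i\ge1$ has $P$ at the vertices $i+1,\dots,n$ with identity maps, and zero elsewhere. *)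

(* Defs.v *)
From HB Require Import structures.
From mathcomp Require Import all_boot all_algebra.
From mathcomp Require Import boolp.

Set Implicit Arguments.
Unset Strict Implicit.
Unset Printing Implicit Defensive.

Import GRing.Theory.
Local Open Scope ring_scope.
Local Open Scope quotient_scope.

Record precat := PreCat {
  obj :> Type;
  mor : obj -> obj -> zmodType;
  idmor : forall X, mor X X;
  cmp : forall X Y Z, mor Y Z -> mor X Y -> mor X Z;
  compA : forall W X Y Z (h : mor Y Z) (g : mor X Y) (f : mor W X),
    cmp h (cmp g f) = cmp (cmp h g) f;
  comp1m : forall X Y (f : mor X Y), cmp (idmor Y) f = f;
  compm1 : forall X Y (f : mor X Y), cmp f (idmor X) = f;
  compDl : forall X Y Z (g h : mor Y Z) (f : mor X Y),
    cmp (g + h) f = cmp g f + cmp h f;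
  compDr : forall X Y Z (h : mor Y Z) (f g : mor X Y),
    cmp h (f + g) = cmp h f + cmp h g
}.

Arguments mor {p} _ _.
Arguments idmor {p} _.
Arguments cmp {p X Y Z} _ _.

Notation "g \c f" := (cmp g f) (at level 40, left associativity).

Record addcat := AddCat {
  base :> precat;
  zobj : base;
  zobjP : idmor zobj = 0;
  dsum : base -> base -> base;
  inj1 : forall X Y, mor X (dsum X Y);
  inj2 : forall X Y, mor Y (dsum X Y);
  prj1 : forall X Y, mor (dsum X Y) X;
  prj2 : forall X Y, mor (dsum X Y) Y;
  prj1inj1 : forall X Y, prj1 X Y \c inj1 X Y = idmor X;
  prj2inj2 : forall X Y, prj2 X Y \c inj2 X Y = idmor Y;
  prj1inj2 : forall X Y, prj1 X Y \c inj2 X Y = 0;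
  prj2inj1 : forall X Y, prj2 X Y \c inj1 X Y = 0;
  dsumE : forall X Y,
    inj1 X Y \c prj1 X Y + inj2 X Y \c prj2 X Y = idmor (dsum X Y)
}.

Arguments zobj {a}.
Arguments dsum {a} _ _.
Arguments inj1 {a} X Y.
Arguments inj2 {a} X Y.
Arguments prj1 {a} X Y.
Arguments prj2 {a} X Y.

Section CompTheory.
Context (C : precat).
Implicit Types X Y Z : C.

Lemma compm0 X Y Z (g : mor Y Z) : g \c (0 : mor X Y) = 0.
Proof. by apply: (addrI (g \c 0)); rewrite -compDr !addr0. Qed.

Lemma comp0m X Y Z (f : mor X Y) : (0 : mor Y Z) \c f = 0.
Proof. by apply: (addrI (0 \c f)); rewrite -compDl !addr0. Qed.

Lemma compmN X Y Z (g : mor Y Z) (f : mor X Y) : g \c (- f) = - (g \c f).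
Proof. by apply: (addrI (g \c f)); rewrite -compDr !subrr compm0. Qed.

Lemma compNm X Y Z (g : mor Y Z) (f : mor X Y) : (- g) \c f = - (g \c f).
Proof. by apply: (addrI (g \c f)); rewrite -compDl !subrr comp0m. Qed.

End CompTheory.

Section Notions.
Context (C : addcat).
Implicit Types A B X Y Z P Q : C.

Definition epi X Y (f : mor X Y) :=
  forall Z (g h : mor Y Z), g \c f = h \c f -> g = h.

Definition split_mono X Y (f : mor X Y) := exists r : mor Y X, r \c f = idmor X.

Definition split_epi X Y (f : mor X Y) := exists s : mor Y X, f \c s = idmor Y.

Definition is_iso X Y (f : mor X Y) :=
  exists g : mor Y X, g \c f = idmor X /\ f \c g = idmor Y.

Definition isomorphic X Y := exists f : mor X Y, is_iso f.

Definition is_zero X := idmor X = 0.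

Definition indecomposable X :=
  ~ is_zero X /\
  forall A B, isomorphic X (dsum A B) -> is_zero A \/ is_zero B.

Definition is_kernel X Y Z (k : mor X Y) (f : mor Y Z) :=
  f \c k = 0 /\
  forall W (h : mor W Y), f \c h = 0 -> exists! u : mor W X, k \c u = h.

Definition is_cokernel X Y Z (f : mor X Y) (c : mor Y Z) :=
  c \c f = 0 /\
  forall W (h : mor Y W), h \c f = 0 -> exists! u : mor Z W, u \c c = h.

(* In an abelian category, [X -> Y -> Z] is exact at [Y] when the map induced
   by [f] from [X] to the kernel of [g] is an epimorphism. *)
Definition exact_at X Y Z (f : mor X Y) (g : mor Y Z) :=
  exists (K : C) (k : mor K Y) (e : mor X K),
    [/\ is_kernel k g, epi e & k \c e = f].

Definition projective P :=
  forall X Y (p : mor X Y) (f : mor P Y), epi p ->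
    exists g : mor P X, p \c g = f.

Definition gorenstein_projective X :=
  exists (P : int -> C) (d : forall i, mor (P i) (P (i + 1))),
    [/\ forall i, projective (P i),
        forall i, exact_at (d i) (d (i + 1)),
        forall Q, projective Q ->
          forall i (f : mor (P (i + 1)) Q), f \c d i = 0 ->
          exists g : mor (P (i + 1 + 1)) Q, g \c d (i + 1) = f
      & exists i (k : mor X (P i)), is_kernel k (d i)].

Definition projective_cover P X (p : mor P X) :=
  [/\ projective P, epi p & forall Y (h : mor Y P), epi (p \c h) -> epi h].

Definition minimal_left_proj_approx X Q (a : mor X Q) :=
  [/\ projective Q,
      forall Q' (h : mor X Q'), projective Q' ->
        exists u : mor Q Q', u \c a = h
    & forall u : mor Q Q, u \c a = a -> is_iso u].

Record syzygy X := Syzygy {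
  pcover : C;
  pcover_map : mor pcover X;
  Omega : C;
  Omega_incl : mor Omega pcover;
  pcoverP : projective_cover pcover_map;
  OmegaP : is_kernel Omega_incl pcover_map
}.

Record cosyzygy X := Cosyzygy {
  approx : C;
  approx_map : mor X approx;
  Omega_inv : C;
  Omega_inv_proj : mor approx Omega_inv;
  approxP : minimal_left_proj_approx approx_map;
  Omega_invP : is_cokernel approx_map Omega_inv_proj
}.

Definition contravariantly_finite (E : C -> Prop) :=
  forall X, exists (A : C) (f : mor A X),
    E A /\ forall B (h : mor B X), E B -> exists u : mor B A, f \c u = h.

(* [E] is a full subcategory of [C]. *)
Definition left_almost_split (E : C -> Prop) X Y (f : mor X Y) :=
  ~ split_mono f /\
  forall Z (h : mor X Z), E Z -> ~ split_mono h ->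
    exists u : mor Y Z, u \c f = h.

Definition right_almost_split (E : C -> Prop) Y Z (g : mor Y Z) :=
  ~ split_epi g /\
  forall X (h : mor X Z), E X -> ~ split_epi h ->
    exists u : mor X Y, g \c u = h.

Definition short_exact_in (E : C -> Prop) X Y Z (f : mor X Y) (g : mor Y Z) :=
  [/\ E X, E Y & E Z] /\ (is_kernel f g /\ is_cokernel f g).

Definition almost_split (E : C -> Prop) X Y Z (f : mor X Y) (g : mor Y Z) :=
  [/\ short_exact_in E f g, left_almost_split E f & right_almost_split E g].

(* The almost split sequence of [E] ending at [Z] exists and has the form
   [0 -> X -> Y -> Z -> 0]. *)
Definition almost_split_form (E : C -> Prop) X Y Z :=
  (exists (f : mor X Y) (g : mor Y Z), almost_split E f g) /\
  forall X' Y' (f : mor X' Y') (g : mor Y' Z), almost_split E f g ->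
    isomorphic X' X /\ isomorphic Y' Y.

End Notions.

Section Stable.
Context (C : addcat) (E : C -> Prop).

Record subobj := SubObj { sub_obj :> C; sub_objP : E sub_obj }.

Definition through_proj (X Y : C) (f : mor X Y) :=
  exists (P : C) (g : mor P Y) (h : mor X P), projective P /\ g \c h = f.

Lemma projective_dsum (P Q : C) :
  projective P -> projective Q -> projective (dsum P Q).
Proof.
move=> hP hQ X Y p f ep.
have [u hu] := hP _ _ p (f \c inj1 P Q) ep.
have [v hv] := hQ _ _ p (f \c inj2 P Q) ep.
exists (u \c prj1 P Q + v \c prj2 P Q).
by rewrite compDr !compA hu hv -!compA -compDr dsumE compm1.
Qed.

Definition proj_maps (X Y : C) : {pred mor X Y} :=
  fun f => `[< through_proj f >].

Lemma proj_maps_closed (X Y : C) : zmod_closed (@proj_maps X Y).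
Proof.
split=> [|f g /asboolP[P [a [b [hP <-]]]] /asboolP[Q [c [d [hQ <-]]]]].
  apply/asboolP; exists zobj, 0, 0; split; last by rewrite compm0.
  move=> X' Y' p f _; exists 0.
  by rewrite -[f]compm1 zobjP !compm0.
apply/asboolP; exists (dsum P Q).
exists (a \c prj1 P Q - c \c prj2 P Q), (inj1 P Q \c b + inj2 P Q \c d).
split; first exact: projective_dsum.
rewrite compDl !compDr !compNm !compA -!(compA a) -!(compA c).
by rewrite prj1inj1 prj1inj2 prj2inj1 prj2inj2 !comp1m !comp0m !compm0 oppr0 addr0 add0r.
Qed.

HB.instance Definition _ (X Y : C) :=
  GRing.isZmodClosed.Build (mor X Y) (@proj_maps X Y) (@proj_maps_closed X Y).

Definition shom (X Y : C) : zmodType := Quotient.quot (@proj_maps X Y).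

Definition scls (X Y : C) (f : mor X Y) : shom X Y := \pi_(shom X Y) f.

Definition scomp (X Y Z : C) (g : shom Y Z) (f : shom X Y) : shom X Z :=
  scls (repr g \c repr f).

Lemma scls_eq (X Y : C) (f g : mor X Y) :
  through_proj (f - g) -> scls f = scls g.
Proof. by move=> h; apply/eqP; rewrite /scls -Quotient.idealrBE; apply/asboolP. Qed.

Lemma scls_repr (X Y : C) (f : mor X Y) : through_proj (repr (scls f) - f).
Proof.
apply/asboolP; rewrite -[X in is_true X]/(_ \in @proj_maps X Y).
by rewrite Quotient.idealrBE /scls reprK.
Qed.

Lemma sclsD (X Y : C) (f g : mor X Y) : scls (f + g) = scls f + scls g.
Proof. by rewrite /scls raddfD. Qed.

Lemma scompE (X Y Z : C) (g : mor Y Z) (f : mor X Y) :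
  scomp (scls g) (scls f) = scls (g \c f).
Proof.
have [P [a [b [hP ab]]]] := scls_repr g.
have [Q [c [d [hQ cd]]]] := scls_repr f.
transitivity (scls (g \c repr (scls f))); apply: scls_eq.
  exists P, a, (b \c repr (scls f)); split=> //.
  by rewrite compA ab compDl compNm.
exists Q, (g \c c), d; split=> //.
by rewrite -compA cd compDr compmN.
Qed.

Lemma sclsK (X Y : C) (f : shom X Y) : scls (repr f) = f.
Proof. by rewrite /scls reprK. Qed.

Definition stable : precat.
Proof.
refine (@PreCat subobj (fun X Y => shom X Y) (fun X => scls (idmor X))
  (fun X Y Z g f => scomp g f) _ _ _ _ _).
- move=> W X Y Z h g f.
  by rewrite -(sclsK h) -(sclsK g) -(sclsK f) !scompE compA.
- by move=> X Y f; rewrite -(sclsK f) scompE comp1m.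
- by move=> X Y f; rewrite -(sclsK f) scompE compm1.
- move=> X Y Z g h f; rewrite -(sclsK h) -(sclsK g) -(sclsK f).
  by rewrite -sclsD !scompE compDl sclsD.
- move=> X Y Z h f g; rewrite -(sclsK h) -(sclsK g) -(sclsK f).
  by rewrite -sclsD !scompE compDr sclsD.
Defined.

End Stable.

Section Functors.
Context (C : precat).

Record cfunctor := CFunctor {
  fobj :> C -> zmodType;
  fmap : forall X Y, mor X Y -> {additive fobj Y -> fobj X};
  fmap1 : forall X a, fmap (idmor X) a = a;
  fmapM : forall X Y Z (g : mor Y Z) (f : mor X Y) a,
    fmap (g \c f) a = fmap f (fmap g a);
  fmapD : forall X Y (f g : mor X Y) a, fmap (f + g) a = fmap f a + fmap g a
}.

Record nattrans (F G : cfunctor) := NatTrans {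
  ncomp :> forall X, {additive F X -> G X};
  ncompP : forall X Y (f : mor X Y) a, ncomp X (fmap F f a) = fmap G f (ncomp Y a)
}.

Lemma precomp_additive (X Y Z : C) (f : mor X Y) :
  zmod_morphism (fun g : mor Y Z => g \c f).
Proof. by move=> g h; rewrite compDl compNm. Qed.

Definition precomp (X Y Z : C) (f : mor X Y) (g : mor Y Z) := g \c f.

HB.instance Definition _ (X Y Z : C) (f : mor X Y) :=
  GRing.isZmodMorphism.Build (mor Y Z) (mor X Z) (precomp f)
    (@precomp_additive X Y Z f).

Definition yoneda (Z : C) : cfunctor.
Proof.
refine (@CFunctor (fun X => mor X Z)
  (fun X Y f => (precomp f : {additive mor Y Z -> mor X Z})) _ _ _).
- by move=> X a; apply: compm1.
- by move=> X Y W g f a; apply: compA.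
- by move=> X Y f g a; apply: compDr.
Defined.

(* Kernels and cokernels of functors are computed objectwise. *)
Definition finitely_presented (F : cfunctor) :=
  exists (X Y : C) (a : nattrans (yoneda X) (yoneda Y))
         (b : nattrans (yoneda Y) F),
    forall Z,
      (forall y, b Z y = 0 <-> exists x, a Z x = y) /\
      (forall z, exists y, b Z y = z).

Definition fp_epi (F G : cfunctor) (p : nattrans F G) :=
  forall (H : cfunctor) (a b : nattrans G H), finitely_presented H ->
    (forall X x, a X (p X x) = b X (p X x)) -> forall X y, a X y = b X y.

Definition fp_projective (F : cfunctor) :=
  forall (G H : cfunctor) (p : nattrans G H) (f : nattrans F H),
    finitely_presented G -> finitely_presented H -> fp_epi p ->
    exists g : nattrans F G, forall X x, p X (g X x) = f X x.

Definition mod_semisimple :=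
  forall F : cfunctor, finitely_presented F -> fp_projective F.

End Functors.

Section Modules.

Definition fingen (R : pzRingType) (M : lmodType R) :=
  exists s : seq M, forall x, exists c : 'I_(size s) -> R,
    x = \sum_i c i *: s`_i.

Definition artinian (k : comNzRingType) :=
  forall I : nat -> {pred k^o},
    (forall n, submod_closed (I n)) ->
    (forall n, {subset I n.+1 <= I n}) ->
    exists N, forall n, (N <= n)%N -> I n =i I N.

Definition artin_algebra (k : comNzRingType) (L : algType k) :=
  artinian k /\ fingen L.

Section LinearHom.
Context (R : pzRingType) (M N : lmodType R).

HB.instance Definition _ := gen_eqMixin {linear M -> N}.
HB.instance Definition _ := gen_choiceMixin {linear M -> N}.

Lemma linear_ext (f g : {linear M -> N}) : f =1 g -> f = g.
Proof.
case: f g => [f [[m1] [m2]]] [g [[m3] [m4]]] /= /funext fg; subst g.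
by rewrite (Prop_irrelevance m1 m3) (Prop_irrelevance m2 m4).
Qed.

Definition lin0 : {linear M -> N} := \0.
Definition linD (f g : {linear M -> N}) : {linear M -> N} := f \+ g.
Definition linN (f : {linear M -> N}) : {linear M -> N} := \- f.

Lemma linDA : associative linD.
Proof. by move=> f g h; apply: linear_ext => x /=; rewrite addrA. Qed.

Lemma linDC : commutative linD.
Proof. by move=> f g; apply: linear_ext => x /=; rewrite addrC. Qed.

Lemma lin0D : left_id lin0 linD.
Proof. by move=> f; apply: linear_ext => x /=; rewrite add0r. Qed.

Lemma linND : left_inverse lin0 linN linD.
Proof. by move=> f; apply: linear_ext => x /=; rewrite addNr. Qed.

HB.instance Definition _ :=
  GRing.isZmodule.Build {linear M -> N} linDA linDC lin0D linND.

End LinearHom.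

Record fgmod (R : pzRingType) := FgMod {
  fgmod_sort :> lmodType R;
  fgmodP : fingen fgmod_sort
}.

Section ModCat.
Context (R : pzRingType).

Definition lin_id (M : fgmod R) : {linear M -> M} := idfun.

Definition lin_comp (M N P : fgmod R) (g : {linear N -> P})
  (f : {linear M -> N}) : {linear M -> P} := g \o f.

Definition mod_precat : precat.
Proof.
refine (@PreCat (fgmod R) (fun M N => {linear M -> N} : zmodType)
  lin_id lin_comp _ _ _ _ _).
- by move=> *; apply: linear_ext.
- by move=> *; apply: linear_ext.
- by move=> *; apply: linear_ext.
- by move=> *; apply: linear_ext.
- by move=> X Y Z h f g; apply: linear_ext => x /=; rewrite linearD.
Defined.

Lemma fingen0 : fingen 'rV[R]_0.
Proof. by exists [::] => x; exists (fun=> 0); rewrite big_ord0 thinmx0. Qed.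

Lemma fingen_pair (M N : lmodType R) :
  fingen M -> fingen N -> fingen (M * N)%type.
Proof.
have natP (V : lmodType R) (s : seq V) (c : 'I_(size s) -> R) :
    exists c' : nat -> R,
      \sum_i c i *: s`_i = \sum_(0 <= i < size s) c' i *: s`_i.
  exists (fun n => if insub n is Some i then c i else 0).
  by rewrite big_mkord; apply: eq_bigr => i _; rewrite valK.
move=> [s hs] [t ht].
exists ([seq (u, 0) | u <- s] ++ [seq (0, v) | v <- t]) => -[x y].
have [c ->] := hs x; have [d ->] := ht y.
have [{}c ->] := natP _ _ c; have [{}d ->] := natP _ _ d.
pose e n := if (n < size s)%N then c n else d (n - size s)%N.
exists (fun i => e i).
rewrite -(big_mkord xpredT (fun i => e i *: (_ ++ _)`_i)).
rewrite size_cat !size_map.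
rewrite (@big_cat_nat _ _ _ (size s) 0 (size s + size t)) ?leq_addr //=.
have shift (F : nat -> (M * N)%type) :
    \sum_(size s <= i < size s + size t) F i
      = \sum_(0 <= i < size t) F (i + size s)%N.
  by rewrite -{1}[size s]add0n big_addn addKn.
rewrite {}shift !big_mkord.
under [X in _ = X + _]eq_bigr => i _.
  rewrite nth_cat size_map ltn_ord (nth_map 0) ?ltn_ord // /e ltn_ord.
  over.
under [X in _ = _ + X]eq_bigr => i _.
  rewrite nth_cat size_map ltnNge leq_addl /= addnK (nth_map 0) ?ltn_ord //.
  rewrite /e ltnNge leq_addl /= addnK.
  over.
have pairs m (F : 'I_m -> M) (G : 'I_m -> N) :
    \sum_i (F i, G i) = (\sum_i F i, \sum_i G i).
  by elim/big_rec3: _ => // i a b z _ ->.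
have scl (a : R) (u : M) (v : N) : a *: (u, v) = (a *: u, a *: v) by [].
under [X in _ = X + _]eq_bigr do rewrite scl scaler0.
under [X in _ = _ + X]eq_bigr do rewrite scl scaler0.
rewrite !pairs !big1_eq; congr pair; first by rewrite /= addr0.
by rewrite /= add0r.
Qed.

Definition mod0 : fgmod R := FgMod fingen0.

Definition mod_dsum (M N : fgmod R) : fgmod R :=
  FgMod (fingen_pair (fgmodP M) (fgmodP N)).

Section Dsum.
Context (M N : fgmod R).

Definition mod_inj1_fun (x : M) : (M * N)%type := (x, 0).
Definition mod_inj2_fun (y : N) : (M * N)%type := (0, y).

Lemma mod_inj1_linear : linear mod_inj1_fun.
Proof. by move=> a x y; apply/pair_equal_spec; rewrite /= scaler0 addr0. Qed.

Lemma mod_inj2_linear : linear mod_inj2_fun.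
Proof. by move=> a x y; apply/pair_equal_spec; rewrite /= scaler0 addr0. Qed.

HB.instance Definition _ :=
  GRing.isLinear.Build R M (M * N)%type *:%R mod_inj1_fun mod_inj1_linear.
HB.instance Definition _ :=
  GRing.isLinear.Build R N (M * N)%type *:%R mod_inj2_fun mod_inj2_linear.

Definition mod_inj1 : {linear M -> mod_dsum M N} := mod_inj1_fun.
Definition mod_inj2 : {linear N -> mod_dsum M N} := mod_inj2_fun.
Definition mod_prj1 : {linear mod_dsum M N -> M} := @fst M N.
Definition mod_prj2 : {linear mod_dsum M N -> N} := @snd M N.

End Dsum.

Definition modcat : addcat.
Proof.
refine (@AddCat mod_precat mod0 _ mod_dsum
  mod_inj1 mod_inj2 mod_prj1 mod_prj2 _ _ _ _ _).
- by apply: linear_ext => x /=; rewrite thinmx0 [RHS]thinmx0.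
- by move=> X Y; apply: linear_ext.
- by move=> X Y; apply: linear_ext.
- by move=> X Y; apply: linear_ext.
- by move=> X Y; apply: linear_ext.
- move=> X Y; apply: linear_ext => -[x y].
  by apply/pair_equal_spec; rewrite /= addr0 add0r.
Defined.

End ModCat.
End Modules.

Section Rep.
Context (n : nat) (C : addcat).

(* The vertex [v_i] of the linear quiver [v_1 -> ... -> v_n] is the ordinal
   [i - 1] of ['I_n]. *)
Record rep := Rep {
  rep_obj :> 'I_n -> C;
  rep_map : forall u v : 'I_n, nat_of_ord v = u.+1 -> mor (rep_obj u) (rep_obj v)
}.

Record rep_hom (X Y : rep) := RepHom {
  rh :> forall v, mor (X v) (Y v);
  rhP : forall (u v : 'I_n) (uv : nat_of_ord v = u.+1),
    rep_map Y uv \c rh u = rh v \c rep_map X uv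
}.

Lemma rep_ext X Y (f g : rep_hom X Y) : (forall v, f v = g v) -> f = g.
Proof.
case: f g => [f fP] [g gP] /= fg.
have {}fg : f = g by exact: functional_extensionality_dep.
by subst g; rewrite (Prop_irrelevance fP gP).
Qed.

HB.instance Definition _ X Y := gen_eqMixin (rep_hom X Y).
HB.instance Definition _ X Y := gen_choiceMixin (rep_hom X Y).

Section RepHomZmod.
Context (X Y : rep).

Definition rh0 : rep_hom X Y.
Proof. by exists (fun=> 0) => u v uv; rewrite compm0 comp0m. Defined.

Definition rhD (f g : rep_hom X Y) : rep_hom X Y.
Proof.
by exists (fun v => f v + g v) => u v uv; rewrite compDr compDl !rhP.
Defined.

Definition rhN (f : rep_hom X Y) : rep_hom X Y.
Proof. by exists (fun v => - f v) => u v uv; rewrite compmN compNm rhP. Defined.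

Lemma rhDA : associative rhD.
Proof. by move=> f g h; apply: rep_ext => v /=; rewrite addrA. Qed.

Lemma rhDC : commutative rhD.
Proof. by move=> f g; apply: rep_ext => v /=; rewrite addrC. Qed.

Lemma rh0D : left_id rh0 rhD.
Proof. by move=> f; apply: rep_ext => v /=; rewrite add0r. Qed.

Lemma rhND : left_inverse rh0 rhN rhD.
Proof. by move=> f; apply: rep_ext => v /=; rewrite addNr. Qed.

HB.instance Definition _ :=
  GRing.isZmodule.Build (rep_hom X Y) rhDA rhDC rh0D rhND.

End RepHomZmod.

Definition rep_id (X : rep) : rep_hom X X.
Proof. by exists (fun v => idmor (X v)) => u v uv; rewrite compm1 comp1m. Defined.

Definition rep_comp (X Y Z : rep) (g : rep_hom Y Z) (f : rep_hom X Y) :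
  rep_hom X Z.
Proof.
exists (fun v => g v \c f v) => u v uv.
by rewrite compA rhP -compA rhP compA.
Defined.

Definition rep_precat : precat.
Proof.
refine (@PreCat rep (fun X Y => rep_hom X Y : zmodType) rep_id rep_comp
  _ _ _ _ _).
- by move=> *; apply: rep_ext => v; apply: compA.
- by move=> *; apply: rep_ext => v; apply: comp1m.
- by move=> *; apply: rep_ext => v; apply: compm1.
- by move=> *; apply: rep_ext => v; apply: compDl.
- by move=> *; apply: rep_ext => v; apply: compDr.
Defined.

Definition rep_zero : rep := @Rep (fun=> zobj) (fun u v uv => 0).

Definition rep_dsum (X Y : rep) : rep :=
  @Rep (fun v => dsum (X v) (Y v))
    (fun u v uv => inj1 _ _ \c rep_map X uv \c prj1 _ _
                 + inj2 _ _ \c rep_map Y uv \c prj2 _ _).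

Section RepDsum.
Context (X Y : rep).

Definition rep_inj1 : rep_hom X (rep_dsum X Y).
Proof.
exists (fun v => inj1 (X v) (Y v)) => u v uv /=.
by rewrite compDl -!compA prj1inj1 prj2inj1 !compm0 addr0 compm1.
Defined.

Definition rep_inj2 : rep_hom Y (rep_dsum X Y).
Proof.
exists (fun v => inj2 (X v) (Y v)) => u v uv /=.
by rewrite compDl -!compA prj1inj2 prj2inj2 !compm0 add0r compm1.
Defined.

Definition rep_prj1 : rep_hom (rep_dsum X Y) X.
Proof.
exists (fun v => prj1 (X v) (Y v)) => u v uv /=.
by rewrite compDr !compA prj1inj1 prj1inj2 !comp0m addr0 comp1m.
Defined.

Definition rep_prj2 : rep_hom (rep_dsum X Y) Y.
Proof.
exists (fun v => prj2 (X v) (Y v)) => u v uv /=.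
by rewrite compDr !compA prj2inj1 prj2inj2 !comp0m add0r comp1m.
Defined.

End RepDsum.

Definition repcat : addcat.
Proof.
refine (@AddCat rep_precat rep_zero _ rep_dsum
  rep_inj1 rep_inj2 rep_prj1 rep_prj2 _ _ _ _ _).
- by apply: rep_ext => v; apply: zobjP.
- by move=> X Y; apply: rep_ext => v; apply: prj1inj1.
- by move=> X Y; apply: rep_ext => v; apply: prj2inj2.
- by move=> X Y; apply: rep_ext => v; apply: prj1inj2.
- by move=> X Y; apply: rep_ext => v; apply: prj2inj1.
- by move=> X Y; apply: rep_ext => v; apply: dsumE.
Defined.

(* The three parts of [0 -> ... -> 0 -> K -> ... -> K -> P -> ... -> P]. *)
Inductive zone := ZoneZero | ZoneKer | ZoneProj.

Section Bracket.
Context (i j : nat) (K P : C) (l : mor K P).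

Definition zone_of (v : 'I_n) : zone :=
  if (v.+1 < i)%N then ZoneZero
  else if (v.+1 <= j)%N then ZoneKer else ZoneProj.

Definition zone_obj (z : zone) : C :=
  match z with ZoneZero => zobj | ZoneKer => K | ZoneProj => P end.

Definition zone_map (z w : zone) : mor (zone_obj z) (zone_obj w) :=
  match z, w with
  | ZoneKer, ZoneKer => idmor K
  | ZoneKer, ZoneProj => l
  | ZoneProj, ZoneProj => idmor P
  | _, _ => 0
  end.

(* [K] at the vertices [i, ..., j], [P] at the vertices [j + 1, ..., n]. *)
Definition bracket_rep : repcat :=
  @Rep (fun v => zone_obj (zone_of v))
    (fun u v _ => zone_map (zone_of u) (zone_of v)).

End Bracket.

(* [i, j, H], for a chosen projective cover of H and its kernel. *)
Definition bracket (i j : nat) (H : C) (S : syzygy H) : repcat :=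
  bracket_rep i j (Omega_incl S).

(* [i, i, P] for P projective, where Omega(P) = 0; this includes [0, 0, P]. *)
Definition bracket_proj (i : nat) (P : C) : repcat :=
  bracket_rep i i (0 : mor zobj P).

End Rep.

Section Algebra.
Context (k : comNzRingType) (L : algType k).

(* Right L-modules are left modules over the converse ring. *)
Definition rmodcat : addcat := modcat L^c.

Definition gprj : rmodcat -> Prop := @gorenstein_projective rmodcat.

Definition g_semisimple :=
  [/\ artin_algebra L,
      contravariantly_finite gprj
    & mod_semisimple (stable gprj)].

(* Membership in the full subcategory S_n(Gprj-L) of rep(A_n, L). *)
Definition gprj_rep (n : nat) : repcat n rmodcat -> Prop :=
  @gorenstein_projective (repcat n rmodcat).

End Algebra.

(* Main.v *)
From HB Require Import structures.
Require Import Defs.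
From mathcomp Require Import all_boot all_algebra boolp zify.

Set Implicit Arguments.
Unset Strict Implicit.
Unset Printing Implicit Defensive.

Import GRing.Theory.
Local Open Scope ring_scope.

(** The argument takes place in an additive category [C] in which every
    epimorphism that has a kernel is the cokernel of that kernel; finitely
    generated modules over a ring form such a category ([mod_normal_epis]).

    Two properties of Lambda carry the proof. Semisimplicity of the functor
    category makes the stable category von Neumann regular: each [f : X -> Y]
    between Gorenstein projectives has an [x : Y -> X] such that [f - f x f]
    factors through a projective ([semisimple_regular]). Indecomposable modules
    over an Artin algebra have local endomorphism rings
    ([indecomposable_local]), and this passes to syzygies ([syz_local]).
    Combined, a morphism between a Gorenstein projective and an indecomposable
    non-projective Gorenstein projective, in either direction, splits or factors
    through a projective ([split_epi_or_through_proj] and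
    [split_mono_or_through_proj]).

    Gorenstein projectivity is used through the sequences [0 -> M -> P -> N -> 0]
    along which every morphism from [M] to a projective extends ([proj_ses]):
    the Gorenstein projectives form the largest class in which every object is
    both a left and a right end of such a sequence with the other end in the
    class ([gproj_coind], [gproj_left], [gproj_right]). For representations of
    the linear quiver, the adjoints of the evaluation at a vertex show that the
    values of a Gorenstein projective [W] are Gorenstein projective
    ([eval_gproj]), and that a morphism from [W_u] to a projective extends to a
    compatible family on all the vertices ([gproj_extend]); in the other
    direction [bracket_ses] shows that the representations [[i, j, H]] are
    Gorenstein projective.

    Each of the three sequences is, at every vertex, a short exact sequence
    coming from a projective cover or a bicartesian square with two parallel
    invertible sides. To prove an almost split property, a morphism [h] from a
    Gorenstein projective [W] to the right end, or from the left end to [W], is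
    examined at one vertex: the first one of the end in question, except that a
    morphism out of [[1, n, G]] is examined at the last vertex. There it factors
    through a projective, and the factorization spreads to the other vertices by
    [gproj_extend]; or it splits, and the splitting spreads. In the third
    sequence two consecutive vertices matter, and a quasi-inverse of the
    structure map of [W] between them decides which case occurs.

    Finally, the left ends have local endomorphism rings ([bracket_local]), so
    that any other almost split sequence with the same right end is isomorphic
    to the given one ([almost_split_unique]). *)

Local Notation compA := Defs.compA.

(** * Morphisms, kernels and biproducts *)

Section Preadditive.
Context (C : precat).

Definition mono (X Y : C) (f : mor X Y) :=
  forall W (g h : mor W X), f \c g = f \c h -> g = h.

Lemma compmB (X Y Z : C) (h : mor Y Z) (f g : mor X Y) :
  h \c (f - g) = h \c f - h \c g.
Proof. by rewrite compDr compmN. Qed.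

Lemma compBm (X Y Z : C) (g h : mor Y Z) (f : mor X Y) :
  (g - h) \c f = g \c f - h \c f.
Proof. by rewrite compDl compNm. Qed.

End Preadditive.

Section Basics.
Context (C : addcat).
Implicit Types X Y Z W P Q K : C.

Lemma to_zobj X (f g : mor X (zobj : C)) : f = g.
Proof. by rewrite -(comp1m f) -(comp1m g) zobjP !comp0m. Qed.

Lemma from_zobj X (f g : mor (zobj : C) X) : f = g.
Proof. by rewrite -(compm1 f) -(compm1 g) zobjP !compm0. Qed.

Lemma monoP X Y (f : mor X Y) :
  (forall W (g : mor W X), f \c g = 0 -> g = 0) -> mono f.
Proof.
by move=> h W g g' e; apply/subr0_eq/h; rewrite compmB e subrr.
Qed.

Lemma mono0 X Y (f : mor X Y) : mono f ->
  forall W (g : mor W X), f \c g = 0 -> g = 0.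
Proof. by move=> h W g e; apply: h; rewrite e compm0. Qed.

Lemma epiP X Y (f : mor X Y) :
  (forall W (g : mor Y W), g \c f = 0 -> g = 0) -> epi f.
Proof.
by move=> h W g g' e; apply/subr0_eq/h; rewrite compBm e subrr.
Qed.

Lemma epi0 X Y (f : mor X Y) : epi f ->
  forall W (g : mor Y W), g \c f = 0 -> g = 0.
Proof. by move=> h W g e; apply: h; rewrite e comp0m. Qed.

Lemma split_mono_mono X Y (f : mor X Y) : split_mono f -> mono f.
Proof.
move=> [r rf]; apply: monoP => W g e.
by rewrite -(comp1m g) -rf -compA e compm0.
Qed.

Lemma split_epi_epi X Y (f : mor X Y) : split_epi f -> epi f.
Proof.
move=> [s fs]; apply: epiP => W g e.
by rewrite -(compm1 g) -fs compA e comp0m.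
Qed.

Section Kernels.
Context (X Y Z : C) (k : mor X Y) (f : mor Y Z).

Lemma kernelI : f \c k = 0 -> mono k ->
  (forall W (h : mor W Y), f \c h = 0 -> exists u, k \c u = h) ->
  is_kernel k f.
Proof.
move=> fk mk hk; split=> // W h /hk[u uh]; exists u; split=> // u' uh'.
by apply: mk; rewrite uh uh'.
Qed.

Lemma cokernelI : f \c k = 0 -> epi f ->
  (forall W (h : mor Y W), h \c k = 0 -> exists u, u \c f = h) ->
  is_cokernel k f.
Proof.
move=> fk ef hf; split=> // W h /hf[u uh]; exists u; split=> // u' uh'.
by apply: ef; rewrite uh uh'.
Qed.

Lemma kernel_comp0 : is_kernel k f -> f \c k = 0. Proof. by case. Qed.
Lemma cokernel_comp0 : is_cokernel k f -> f \c k = 0. Proof. by case. Qed.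

Lemma kernel_mono : is_kernel k f -> mono k.
Proof.
move=> [fk hk]; apply: monoP => W g e.
have [u [_ uu]] := hk W 0 (compm0 _ _).
by rewrite -(uu g e) (uu 0) // compm0.
Qed.

Lemma cokernel_epi : is_cokernel k f -> epi f.
Proof.
move=> [fk hk]; apply: epiP => W g e.
have [u [_ uu]] := hk W 0 (comp0m _ _).
by rewrite -(uu g e) (uu 0) // comp0m.
Qed.

Lemma kernel_fact : is_kernel k f ->
  forall W (h : mor W Y), f \c h = 0 -> exists u, k \c u = h.
Proof. by move=> [_ hk] W h /hk[u [e _]]; exists u. Qed.

Lemma cokernel_fact : is_cokernel k f ->
  forall W (h : mor Y W), h \c k = 0 -> exists u, u \c f = h.
Proof. by move=> [_ hk] W h /hk[u [e _]]; exists u. Qed.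

End Kernels.

Lemma kernel_comp_mono X Y Z Z' (k : mor X Y) (f : mor Y Z) (m : mor Z Z') :
  mono m -> is_kernel k (m \c f) <-> is_kernel k f.
Proof.
move=> mm; split=> hk; apply: kernelI; try exact: (kernel_mono hk).
- by apply: (mono0 mm); rewrite compA (kernel_comp0 hk).
- by move=> W h e; apply: (kernel_fact hk); rewrite -compA e compm0.
- by rewrite -compA (kernel_comp0 hk) compm0.
- move=> W h e; apply: (kernel_fact hk); apply: (mono0 mm).
  by rewrite compA.
Qed.

Lemma is_iso1 X : is_iso (idmor X).
Proof. by exists (idmor X); rewrite compm1. Qed.

Lemma is_iso_comp X Y Z (g : mor Y Z) (f : mor X Y) :
  is_iso g -> is_iso f -> is_iso (g \c f).
Proof.
move=> [g' [g1 g2]] [f' [f1 f2]]; exists (f' \c g'); split.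
  by rewrite compA -(compA f') g1 compm1 f1.
by rewrite compA -(compA g) f2 compm1 g2.
Qed.

Lemma is_iso_mono X Y (f : mor X Y) : is_iso f -> mono f.
Proof. by move=> [g [gf _]]; apply: split_mono_mono; exists g. Qed.

Lemma is_iso_epi X Y (f : mor X Y) : is_iso f -> epi f.
Proof. by move=> [g [_ fg]]; apply: split_epi_epi; exists g. Qed.

Lemma is_iso_inv X Y (f : mor X Y) : is_iso f ->
  exists g, [/\ is_iso g, g \c f = idmor X & f \c g = idmor Y].
Proof. by move=> [g [gf fg]]; exists g; split=> //; exists f. Qed.

Lemma is_isoP X Y (f : mor X Y) : split_mono f -> split_epi f -> is_iso f.
Proof.
move=> [r rf] [s fs]; exists s; split=> //.
by rewrite -[s]comp1m -rf -(compA r) fs compm1 rf.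
Qed.

Lemma split_mono_iso_comp X Y (f : mor X Y) (r : mor Y X) :
  is_iso (r \c f) -> split_mono f.
Proof. by move=> [g [gf _]]; exists (g \c r); rewrite -compA. Qed.

Lemma split_epi_iso_comp X Y (f : mor X Y) (s : mor Y X) :
  is_iso (f \c s) -> split_epi f.
Proof. by move=> [g [_ gf]]; exists (s \c g); rewrite compA. Qed.

(** If [w] inverts [1 - g f], then [1 + f w g] inverts [1 - f g]. *)
Lemma is_iso_1sub X Y (f : mor X Y) (g : mor Y X) :
  is_iso (idmor X - g \c f) -> is_iso (idmor Y - f \c g).
Proof.
move=> [w [w1 w2]]; exists (idmor Y + f \c w \c g).
have wl : w \c g \c f = w - idmor X.
  by rewrite -w1 compmB compm1 subKr compA.
have wr : g \c f \c w = w - idmor X.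
  by rewrite -w2 compBm comp1m subKr.
split.
  rewrite compDl comp1m compmB compm1.
  have -> : f \c w \c g \c (f \c g) = f \c (w \c g \c f) \c g by rewrite !compA.
  by rewrite wl compmB compm1 compBm subKr subrK.
rewrite compBm !comp1m compDr compm1.
have -> : f \c g \c (f \c w \c g) = f \c (g \c f \c w) \c g.
  by rewrite !compA.
by rewrite wr compmB compm1 compBm addrC addrC [f \c g + _]addrC subrK addrK.
Qed.

Lemma projective_retract P Q (s : mor Q P) (r : mor P Q) :
  r \c s = idmor Q -> projective P -> projective Q.
Proof.
move=> rs pP X Y p f ep; have [g pg] := pP _ _ p (f \c r) ep.
by exists (g \c s); rewrite compA pg -compA rs compm1.
Qed.

Lemma is_kernel_iso X X' Y Z (k : mor X Y) (f : mor Y Z) (i : mor X' X) :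
  is_iso i -> is_kernel k f -> is_kernel (k \c i) f.
Proof.
move=> [j [ji ij]] hk; apply: kernelI.
- by rewrite compA (kernel_comp0 hk) comp0m.
- move=> W g h e; have {}e : i \c g = i \c h.
    by apply: (kernel_mono hk); rewrite !compA.
  by rewrite -(comp1m g) -ji -compA e compA ji comp1m.
- move=> W h /(kernel_fact hk)[u <-]; exists (j \c u).
  by rewrite -compA (compA i) ij comp1m.
Qed.

Definition dpair W X Y (f : mor W X) (g : mor W Y) : mor W (dsum X Y) :=
  inj1 X Y \c f + inj2 X Y \c g.

Definition dcopair X Y W (f : mor X W) (g : mor Y W) : mor (dsum X Y) W :=
  f \c prj1 X Y + g \c prj2 X Y.

Section Pairs.
Context (W X Y Z : C).

Lemma prj1_dpair (f : mor W X) (g : mor W Y) : prj1 X Y \c dpair f g = f.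
Proof. by rewrite compDr !compA prj1inj1 prj1inj2 comp1m comp0m addr0. Qed.

Lemma prj2_dpair (f : mor W X) (g : mor W Y) : prj2 X Y \c dpair f g = g.
Proof. by rewrite compDr !compA prj2inj1 prj2inj2 comp1m comp0m add0r. Qed.

Lemma dcopair_inj1 (f : mor X W) (g : mor Y W) : dcopair f g \c inj1 X Y = f.
Proof. by rewrite compDl -!compA prj1inj1 prj2inj1 compm1 compm0 addr0. Qed.

Lemma dcopair_inj2 (f : mor X W) (g : mor Y W) : dcopair f g \c inj2 X Y = g.
Proof. by rewrite compDl -!compA prj1inj2 prj2inj2 compm1 compm0 add0r. Qed.

Lemma dcopair_dpair (f : mor W X) (g : mor W Y) (u : mor X Z) (v : mor Y Z) :
  dcopair u v \c dpair f g = u \c f + v \c g.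
Proof. by rewrite compDl -!compA prj1_dpair prj2_dpair. Qed.

Lemma dpair_comp V (f : mor W X) (g : mor W Y) (h : mor V W) :
  dpair f g \c h = dpair (f \c h) (g \c h).
Proof. by rewrite compDl -!compA. Qed.

Lemma comp_dcopair V (f : mor X W) (g : mor Y W) (h : mor W V) :
  h \c dcopair f g = dcopair (h \c f) (h \c g).
Proof. by rewrite compDr !compA. Qed.

Lemma dpair_prj (h : mor W (dsum X Y)) : dpair (prj1 _ _ \c h) (prj2 _ _ \c h) = h.
Proof. by rewrite /dpair !compA -compDl dsumE comp1m. Qed.

Lemma dcopair_inj (h : mor (dsum X Y) W) :
  dcopair (h \c inj1 _ _) (h \c inj2 _ _) = h.
Proof. by rewrite /dcopair -!compA -compDr dsumE compm1. Qed.

Lemma dpair_ext (g h : mor W (dsum X Y)) : prj1 _ _ \c g = prj1 _ _ \c h ->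
  prj2 _ _ \c g = prj2 _ _ \c h -> g = h.
Proof. by move=> e1 e2; rewrite -(dpair_prj g) e1 e2 dpair_prj. Qed.

Lemma dcopair_ext (g h : mor (dsum X Y) W) : g \c inj1 _ _ = h \c inj1 _ _ ->
  g \c inj2 _ _ = h \c inj2 _ _ -> g = h.
Proof. by move=> e1 e2; rewrite -(dcopair_inj g) e1 e2 dcopair_inj. Qed.

Lemma dpair0 : dpair (0 : mor W X) (0 : mor W Y) = 0.
Proof. by rewrite /dpair !compm0 addr0. Qed.

Lemma dcopair0 : dcopair (0 : mor X W) (0 : mor Y W) = 0.
Proof. by rewrite /dcopair !comp0m addr0. Qed.

End Pairs.

End Basics.

(** * Gorenstein projective objects *)

Section Gorenstein.
Context (C : addcat).
Implicit Types X Y Z W M N P Q K G H : C.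

(** The sequences into which a totally acyclic complex of projectives decomposes;
    the last clause says that [Ext(N, Q) = 0] for projective [Q]. *)
Definition proj_ses M P N (a : mor M P) (b : mor P N) :=
  [/\ projective P, is_kernel a b, is_cokernel a b &
      forall Q (h : mor M Q), projective Q -> exists u : mor P Q, u \c a = h].

(** Splicing such sequences in both directions gives a totally acyclic complex,
    so that a Gorenstein projective can be exhibited without writing one down. *)
Lemma gproj_coind (W : C -> Prop) :
  (forall M, W M -> exists P N (a : mor M P) (b : mor P N),
     proj_ses a b /\ W N) ->
  (forall M, W M -> exists P N (a : mor N P) (b : mor P M),
     proj_ses a b /\ W N) ->
  forall M, W M -> gorenstein_projective M.
Proof.
move=> hr hl M wM.
have hr' (S : {M | W M}) : exists T : {M | W M},
    exists P (a : mor (sval S) P) (b : mor P (sval T)), proj_ses a b.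
  by case: S => S wS; have [P [N [a [b [h wN]]]]] := hr S wS;
    exists (exist _ N wN), P, a, b.
have hl' (S : {M | W M}) : exists T : {M | W M},
    exists P (a : mor (sval T) P) (b : mor P (sval S)), proj_ses a b.
  by case: S => S wS; have [P [N [a [b [h wN]]]]] := hl S wS;
    exists (exist _ N wN), P, a, b.
have [R Rp] := choice hr'; have [T Tp] := choice hl'.
pose s0 : {M | W M} := exist _ M wM.
pose Z (i : int) : C := match i with
  | Posz m => sval (iter m R s0) | Negz m => sval (iter m.+1 T s0) end.
have {Rp Tp} Zp i : exists P (a : mor (Z i) P) (b : mor P (Z (i + 1))), proj_ses a b.
  case: i => [m|[|m]].
  - have -> : (Posz m + 1 = Posz m.+1)%R by rewrite -addn1.
    exact: Rp.
  - exact: Tp.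
  - have -> : (Negz m.+1 + 1 = Negz m)%R by rewrite !NegzE -addn1 PoszD opprD addrNK.
    exact: Tp.
pose P i := projT1 (cid (Zp i)).
pose a i : mor (Z i) (P i) := projT1 (cid (projT2 (cid (Zp i)))).
pose b i : mor (P i) (Z (i + 1)) :=
  projT1 (cid (projT2 (cid (projT2 (cid (Zp i)))))).
have ab i : proj_ses (a i) (b i) :=
  projT2 (cid (projT2 (cid (projT2 (cid (Zp i)))))).
have ma i : mono (a i) by case: (ab i) => _ /kernel_mono.
have eb i : epi (b i) by case: (ab i) => _ _ /cokernel_epi.
exists P, (fun i => a (i + 1) \c b i); split.
- by move=> i; case: (ab i).
- move=> i; exists (Z (i + 1)), (a (i + 1)), (b i); split=> //.
  by apply/(kernel_comp_mono _ _ (ma _)); case: (ab (i + 1)).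
- move=> Q pQ i f; rewrite compA => /(epi0 (eb _)) f0.
  have [_ _ ck _] := ab (i + 1); have [_ _ _ ext] := ab (i + 1 + 1).
  have [f' <-] := cokernel_fact ck f0; have [g <-] := ext _ f' pQ.
  by exists g; rewrite compA.
- exists 0, (a 0); apply/(kernel_comp_mono _ _ (ma _)).
  by case: (ab 0).
Qed.

Lemma gproj_iso X Y : isomorphic X Y -> gorenstein_projective Y ->
  gorenstein_projective X.
Proof.
move=> [f fi] [P [d [h1 h2 h3 [i [k hk]]]]]; exists P, d; split=> //.
by exists i, (k \c f); apply: is_kernel_iso.
Qed.

(** The property of abelian categories on which the whole argument rests. *)
Definition normal_epis :=
  forall X Y Z (k : mor X Y) (f : mor Y Z), is_kernel k f -> epi f ->
  is_cokernel k f.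

Context (normC : normal_epis).

Section Complex.
Context (P : int -> C) (d : forall i, mor (P i) (P (i + 1))).
Context (dP : forall i, projective (P i))
  (dE : forall i, exact_at (d i) (d (i + 1)))
  (dQ : forall Q, projective Q ->
          forall i (f : mor (P (i + 1)) Q), f \c d i = 0 ->
          exists g : mor (P (i + 1 + 1)) Q, g \c d (i + 1) = f).

(** The image factorization of a differential is only given up to isomorphism,
    so the kernel [X] is compared with the one provided by exactness. The
    extension clause uses the acyclicity of [Hom(P, Q)] one step to the left. *)
Lemma complex_ses i X (k : mor X (P (i + 1))) : is_kernel k (d (i + 1)) ->
  exists N (a : mor N (P i)) (b : mor (P i) X), [/\ proj_ses a b, k \c b = d i &
    is_kernel a (d i)].
Proof.
(* Writing [i = j + 1] avoids transports along equalities of indices. *)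
have [j ji] : exists j, i = j + 1 by exists (i - 1); rewrite subrK.
subst i; move=> hk.
have [K1 [k1 [e1 [hk1 ep1 ke1]]]] := dE j.
have [K2 [k2 [e2 [hk2 ep2 ke2]]]] := dE (j + 1).
have [b kb] : exists b, k \c b = d (j + 1).
  by apply: (kernel_fact hk); rewrite -ke2 compA (kernel_comp0 hk2) comp0m.
have [t kt] : exists t, k \c t = k2.
  by apply: (kernel_fact hk); apply: kernel_comp0 hk2.
have [t' kt'] : exists t', k2 \c t' = k.
  by apply: (kernel_fact hk2); apply: kernel_comp0 hk.
have bE : b = t \c e2.
  by apply: (kernel_mono hk); rewrite kb compA kt.
have eb : epi b.
  apply: epiP => W g; rewrite bE compA => /(epi0 ep2) gt.
  have tt : t \c t' = idmor X.
    by apply: (kernel_mono hk); rewrite compA kt kt' compm1.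
  by rewrite -(compm1 g) -tt compA gt comp0m.
have hkb : is_kernel k1 b.
  by apply/(kernel_comp_mono _ _ (kernel_mono hk)); rewrite kb.
exists K1, k1, b; split=> //; split=> //; first exact: normC.
move=> Q h pQ.
have [l jl] : exists l, j = l + 1 by exists (j - 1); rewrite subrK.
subst j.
have [K0 [k0 [e0 [hk0 ep0 ke0]]]] := dE l.
have he0 : h \c e1 \c d l = 0.
  rewrite -compA (_ : e1 \c _ = 0) ?compm0 //.
  apply: (mono0 (kernel_mono hk1)).
  by rewrite compA ke1 -ke0 compA (kernel_comp0 hk0) comp0m.
have [g gh] := @dQ _ pQ _ _ he0.
by exists g; apply: ep1; rewrite -compA ke1.
Qed.

End Complex.

Lemma gproj_left M : gorenstein_projective M ->
  exists P N (a : mor N P) (b : mor P M),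
    proj_ses a b /\ gorenstein_projective N.
Proof.
move=> [P [d [dP dE dQ [i [k hk]]]]].
have [j ji] : exists j, i = j + 1 by exists (i - 1); rewrite subrK.
subst i; have [N [a [b [ab _ ka]]]] := complex_ses dP dE dQ hk.
exists (P j), N, a, b; split=> //; exists P, d; split=> //; by exists j, a.
Qed.

Lemma gproj_right M : gorenstein_projective M ->
  exists P N (a : mor M P) (b : mor P N),
    proj_ses a b /\ gorenstein_projective N.
Proof.
move=> [P [d [dP dE dQ [i [k hk]]]]].
have [X [m [e [hm ee me]]]] := dE i.
have [N [a [b [[pP ak ac ax] mb ka]]]] := complex_ses dP dE dQ hm.
have [f kf] : exists f, a \c f = k by apply: (kernel_fact ka); case: hk.
have [f' kf'] : exists f, k \c f = a by apply: (kernel_fact hk); case: ka.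
have fi : is_iso f.
  exists f'; split.
    by apply: (kernel_mono hk); rewrite compA kf' kf compm1.
  by apply: (kernel_mono ka); rewrite compA kf kf' compm1.
have kb : is_kernel k b by rewrite -kf; apply: is_kernel_iso.
exists (P i), X, k, b; split; last first.
  by exists P, d; split=> //; exists (i + 1), m.
split=> //; first by apply: normC; last exact: (cokernel_epi ac).
move=> Q h pQ; have [u ua] := ax _ (h \c f') pQ.
exists u; rewrite -kf compA ua -compA.
rewrite (_ : f' \c f = idmor M) ?compm1 //.
by apply: (kernel_mono hk); rewrite compA kf' kf compm1.
Qed.

Lemma proj_ses_dsum P M P' N (a : mor M P') (b : mor P' N) : projective P ->
  proj_ses a b ->
  (exists (a' : mor (dsum P M) (dsum P P')) (b' : mor (dsum P P') N),
    proj_ses a' b') /\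
  exists (a' : mor M (dsum P P')) (b' : mor (dsum P P') (dsum P N)),
    proj_ses a' b'.
Proof.
move=> pP [pP' ka kb ext]; have ma := kernel_mono ka; have eb := cokernel_epi kb.
have ba := kernel_comp0 ka.
have pD := projective_dsum pP pP'; split.
  pose a' := dpair (prj1 P M) (a \c prj2 P M).
  pose b' := b \c prj2 P P'.
  have kab : is_kernel a' b'.
    apply: kernelI.
    - by rewrite -compA prj2_dpair compA ba comp0m.
    - apply: monoP => W g e; apply: dpair_ext; rewrite compm0.
        by rewrite -(prj1_dpair (prj1 P M) (a \c prj2 P M)) -compA e compm0.
      apply: (mono0 ma).
      by rewrite compA -(prj2_dpair (prj1 P M) (a \c _)) -compA e compm0.
    move=> W h e.
    have [|t at_] := kernel_fact ka (h := prj2 _ _ \c h); first by rewrite compA.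
    exists (dpair (prj1 _ _ \c h) t).
    by rewrite dpair_comp -!compA prj1_dpair prj2_dpair at_ dpair_prj.
  exists a', b'; split=> //.
    apply: normC => //; apply: epiP => W g; rewrite /b' compA => e; apply: (epi0 eb).
    by rewrite -[LHS]compm1 -(prj2inj2 P P') compA e comp0m.
  move=> Q h pQ; have [u ua] := ext _ (h \c inj2 _ _) pQ.
  exists (dcopair (h \c inj1 _ _) u).
  by rewrite dcopair_dpair compA ua; apply: dcopair_inj.
pose a' := inj2 P P' \c a.
pose b' := dpair (prj1 P P') (b \c prj2 P P').
have kab : is_kernel a' b'.
  apply: kernelI.
  - rewrite /a' /b' dpair_comp compA prj1inj2 comp0m -compA (compA (prj2 _ _)).
    by rewrite prj2inj2 comp1m ba dpair0.
  - apply: monoP => W g e; apply: (mono0 ma).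
    by rewrite -[LHS]comp1m -(prj2inj2 P P') -compA (compA (inj2 _ _)) e compm0.
  move=> W h e.
  have [|t at_] := kernel_fact ka (h := prj2 _ _ \c h).
    by rewrite compA -(prj2_dpair (prj1 P P') (b \c _)) -compA e compm0.
  exists t; rewrite -compA at_; apply: dpair_ext; rewrite compA.
    rewrite prj1inj2 comp0m -(prj1_dpair (prj1 P P') (b \c prj2 P P')) -compA.
    by rewrite e compm0.
  by rewrite prj2inj2 comp1m.
exists a', b'; split=> //; last first.
  move=> Q h pQ; have [u ua] := ext _ h pQ.
  by exists (u \c prj2 _ _); rewrite -!compA (compA (prj2 _ _)) prj2inj2 comp1m.
apply: normC => //; apply: epiP => W g.
rewrite -(dcopair_inj g) dcopair_dpair => e.
have g1 : g \c inj1 P N = 0.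
  rewrite -(dcopair_inj1 (g \c inj1 P N) (g \c inj2 P N \c b)).
  by rewrite /dcopair -[_ \c b \c _]compA e comp0m.
have g2 : g \c inj2 P N = 0.
  apply: (epi0 eb).
  rewrite -(dcopair_inj2 (g \c inj1 P N) (g \c inj2 P N \c b)).
  by rewrite /dcopair -[_ \c b \c _]compA e comp0m.
by rewrite g1 g2 dcopair0.
Qed.

Lemma gproj_dsum P M : projective P -> gorenstein_projective M ->
  gorenstein_projective (dsum P M).
Proof.
move=> pP gM.
apply: (@gproj_coind (fun X => gorenstein_projective X \/
    exists M, X = dsum P M /\ gorenstein_projective M)); last by right; exists M.
- move=> X [/gproj_right[Q [N [a [b [ab gN]]]]]|[N [-> /gproj_right[Q [N' [a [b
  [ab gN]]]]]]]].
    by exists Q, N, a, b; split=> //; left.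
  have [[a' [b' ab']] _] := proj_ses_dsum pP ab.
  by exists (dsum P Q), N', a', b'; split=> //; left.
- move=> X [/gproj_left[Q [N [a [b [ab gN]]]]]|[N [-> /gproj_left[Q [N' [a [b
  [ab gN]]]]]]]].
    by exists Q, N, a, b; split=> //; left.
  have [_ [a' [b' ab']]] := proj_ses_dsum pP ab.
  by exists (dsum P Q), N', a', b'; split=> //; left.
Qed.

End Gorenstein.

(** * Local endomorphism rings, syzygies and almost split sequences *)

Section Local.
Context (C : addcat) (normC : normal_epis C).
Implicit Types X Y Z W M N P Q K G H : C.

(** Schanuel's lemma: if [K' -> P' -> G] comes from a totally acyclic complex,
    then [K + P'] and [K' + P] are isomorphic, and a presentation of [K'] gives
    one of [K] whose kernel is again Gorenstein projective. *)
Lemma gproj_kernel G P K (a : mor K P) (p : mor P G) :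
  gorenstein_projective G -> projective P -> is_kernel a p -> epi p ->
  proj_ses a p /\ gorenstein_projective K.
Proof.
move=> gG pP ka ep.
have [P' [K' [a' [e [[pP' ka' ke ext'] gK']]]]] := gproj_left normC gG.
have [P2 [K2 [a2 [e2 [[pP2 ka2 ke2 ext2] gK2]]]]] := gproj_left normC gK'.
have [r er] := pP _ _ e p (cokernel_epi ke).
have [r' pr'] := pP' _ _ p e ep.
have [b a'b] : exists b, a' \c b = r \c a.
  by apply: (kernel_fact ka'); rewrite compA er (kernel_comp0 ka).
have [b' ab'] : exists b', a \c b' = r' \c a'.
  by apply: (kernel_fact ka); rewrite compA pr' (kernel_comp0 ka').
have [s as_] : exists s, a \c s = idmor P - r' \c r.
  by apply: (kernel_fact ka); rewrite compmB compm1 compA pr' er subrr.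
have [s' as'] : exists s, a' \c s = idmor P' - r \c r'.
  by apply: (kernel_fact ka'); rewrite compmB compm1 compA er pr' subrr.
have bb : idmor K = b' \c b + s \c a.
  apply: (kernel_mono ka); rewrite compm1 compDr !compA ab' as_ -compA a'b.
  by rewrite compBm comp1m !compA addrC subrK.
have ss : s \c r' = b' \c s'.
  apply: (kernel_mono ka); rewrite !compA ab' as_ -compA as' compmB compBm.
  by rewrite comp1m compm1 compA.
have ap : proj_ses a p.
  split=> //; first exact: normC.
  move=> Q h pQ; have [u ua] := ext' _ (h \c b') pQ.
  exists (u \c r + h \c s).
  by rewrite compDl -!compA -a'b (compA u) ua -!compA -compDr -bb compm1.
split=> //.
have [sg e2sg] := pP' _ _ e2 (- s') (cokernel_epi ke2).
(* Next step of the resolution of [K]: the projective [P + P2] maps onto [K], and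
   the kernel [P' + K2] of this map is Gorenstein projective. *)
pose m : mor (dsum P' K2) (dsum P P2) :=
  dpair (r' \c prj1 _ _) (dcopair sg a2).
pose f : mor (dsum P P2) K := dcopair s (b' \c e2).
have fm : f \c m = 0.
  rewrite dcopair_dpair -(compA b') comp_dcopair e2sg (kernel_comp0 ka2).
  rewrite (compA s) ss /dcopair comp0m addr0 compNm compmN -compA.
  by rewrite subrr.
have ef : epi f.
  apply: epiP => W g; rewrite comp_dcopair => e0.
  have gs : g \c s = 0 by rewrite -(dcopair_inj1 (g \c s) (g \c (b' \c e2))) e0 comp0m.
  have gb : g \c b' = 0.
    apply: (epi0 (cokernel_epi ke2)).
    by rewrite -compA -(dcopair_inj2 (g \c s) (g \c (b' \c e2))) e0 comp0m.
  by rewrite -[g]compm1 bb compDr !compA gs gb !comp0m addr0.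
have kmf : is_kernel m f.
  apply: kernelI => //.
    apply: monoP => W g; rewrite dpair_comp => e0.
    have e1 : r' \c prj1 _ _ \c g = 0.
      by rewrite -(prj1_dpair (r' \c prj1 _ _ \c g) (dcopair sg a2 \c g)) e0 compm0.
    have e3 : dcopair sg a2 \c g = 0.
      by rewrite -(prj2_dpair (r' \c prj1 _ _ \c g) (dcopair sg a2 \c g)) e0 compm0.
    have s1 : s' \c (prj1 _ _ \c g) = 0.
      have: e2 \c (dcopair sg a2 \c g) = 0 by rewrite e3 compm0.
      rewrite compA comp_dcopair e2sg (kernel_comp0 ka2) /dcopair comp0m addr0.
      by rewrite -compA compNm => /eqP; rewrite oppr_eq0 => /eqP.
    have g1 : prj1 _ _ \c g = 0.
      have: a' \c (s' \c (prj1 _ _ \c g)) = 0 by rewrite s1 compm0.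
      by rewrite compA as' compBm comp1m -(compA r) (compA r') e1 compm0 subr0.
    apply: dpair_ext; rewrite compm0 //.
    apply: (mono0 (kernel_mono ka2)).
    by move: e3; rewrite /dcopair compDl -!compA g1 compm0 add0r.
  move=> W h; rewrite -(dpair_prj h) dcopair_dpair.
  move: (prj1 _ _ \c h) (prj2 _ _ \c h) => z y e0.
  pose w := r \c z - a' \c (e2 \c y).
  have rw : r' \c w = z.
    have: a \c (s \c z + b' \c e2 \c y) = 0 by rewrite e0 compm0.
    rewrite compDr !compA as_ ab' compBm comp1m => e1.
    apply/esym/subr0_eq; rewrite -[RHS]e1 compmB !compA opprB addrA.
    rewrite addrAC. by [].
  have [|u a2u] := kernel_fact ka2 (h := y - sg \c w).
    apply: (mono0 (kernel_mono ka')).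
    rewrite compmB (compA e2) e2sg compNm opprK compDr (compA a' s') as' compBm.
    by rewrite comp1m -(compA r) rw addrAC subrr add0r subrr.
  exists (dpair w u); rewrite dpair_comp -compA prj1_dpair rw dcopair_dpair.
  by rewrite a2u addrC subrK.
have mf : proj_ses m f.
  split=> //; [exact: projective_dsum|exact: normC|].
  move=> Q h pQ.
  have [g ga] := ext2 _ (h \c inj2 _ _) pQ.
  pose h1 := h \c inj1 _ _ - g \c sg.
  exists (dcopair (h1 \c r) (g - h1 \c a' \c e2)).
  rewrite dcopair_dpair; apply: dcopair_ext.
    rewrite compDl -!compA prj1inj1 dcopair_inj1 compm1.
    rewrite compBm -!compA e2sg !compmN opprK as' compmB compm1.
    by rewrite addrA addrC addrA subrK subrK.
  rewrite compDl -!compA prj1inj2 dcopair_inj2 !compm0 add0r compBm -!compA.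
  by rewrite (kernel_comp0 ka2) !compm0 subr0.
have gD : gorenstein_projective (dsum P' K2) by apply: gproj_dsum.
apply: (@gproj_coind _ (fun X => gorenstein_projective X \/ X = K)); last by right.
- move=> X [gX|->]; last by exists P, G, a, p; split=> //; left.
  have [Q [N [i [j [ij gN]]]]] := gproj_right normC gX.
  by exists Q, N, i, j; split=> //; left.
move=> X [gX|->]; last by exists (dsum P P2), (dsum P' K2), m, f; split=> //; left.
have [Q [N [i [j [ij gN]]]]] := gproj_left normC gX.
by exists Q, N, i, j; split=> //; left.
Qed.

Lemma through_proj_compl X Y Z (g : mor Y Z) (f : mor X Y) :
  through_proj f -> through_proj (g \c f).
Proof.
by move=> [P [u [v [pP <-]]]]; exists P, (g \c u), v; rewrite compA.
Qed.

Lemma through_proj_compr X Y Z (g : mor Y Z) (f : mor X Y) :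
  through_proj g -> through_proj (g \c f).
Proof.
by move=> [P [u [v [pP <-]]]]; exists P, u, (v \c f); rewrite compA.
Qed.

Lemma through_proj_epi X Y P (p : mor P Y) (h : mor X Y) :
  epi p -> through_proj h -> exists t, p \c t = h.
Proof.
move=> ep [Q [u [v [pQ <-]]]]; have [t <-] := pQ _ _ p u ep.
by exists (t \c v); rewrite compA.
Qed.

Lemma through_proj_ses X Y P Z (a : mor X P) (b : mor P Z) (h : mor X Y) :
  proj_ses a b -> through_proj h -> exists t, t \c a = h.
Proof.
move=> [_ _ _ ext] [Q [u [v [pQ <-]]]]; have [t <-] := ext _ v pQ.
by exists (u \c t); rewrite compA.
Qed.

(** The endomorphism ring is local or zero. *)
Definition local_end X := forall f : mor X X, is_iso f \/ is_iso (idmor X - f).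

Lemma local_split_mono X (f : mor X X) : local_end X -> split_mono f -> is_iso f.
Proof.
move=> lX [r rf]; case: (lX (f \c r)) => [fi|/is_iso_1sub fi].
  by apply: is_isoP; [exists r | apply: split_epi_iso_comp fi].
have {}fi : is_iso (0 : mor X X) by move: fi; rewrite rf subrr.
case: fi => g [g0 _]; have X0 : idmor X = 0 by rewrite -g0 compm0.
by exists 0; split; rewrite ?compm0 ?comp0m X0.
Qed.

(** If [f] were invertible, [X] would be a retract of a projective. *)
Lemma local_1sub X (f : mor X X) : local_end X -> ~ projective X ->
  through_proj f -> is_iso (idmor X - f).
Proof.
move=> lX nX [P [u [v [pP uv]]]]; case: (lX f) => // -[g [gf fg]]; case: nX.
apply: (projective_retract (s := v \c g) (r := u)) => //.
by rewrite compA uv.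
Qed.

(** By minimality [h] is an epimorphism, hence has a section [s]; then [p s = p],
    so that [s] is an epimorphism too. *)
Lemma cover_iso P X (p : mor P X) (h : mor P P) : projective_cover p ->
  p \c h = p -> is_iso h.
Proof.
move=> [pP ep mp] ph.
have eh : epi h by apply: mp; rewrite ph.
have [s hs] := pP _ _ h (idmor P) eh.
have es : epi s by apply: mp; rewrite -ph -compA hs compm1.
by exists s; split=> //; apply: es; rewrite -compA hs compm1 comp1m.
Qed.

Section SyzygyLocal.
Context (G : C) (gG : gorenstein_projective G) (nG : ~ projective G).
Context (lG : local_end G) (S : syzygy G).

Lemma syz_ses : proj_ses (Omega_incl S) (pcover_map S) /\
  gorenstein_projective (Omega S).
Proof.
by case: (pcoverP S) => pP ep _; apply: gproj_kernel => //; apply: OmegaP.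
Qed.

(** If [K] were projective, [K -> P] would have a retraction, which the
    minimality of the cover [P] forbids unless [K = 0]; but then [G] is [P]. *)
Lemma syz_nproj : ~ projective (Omega S).
Proof.
move=> pO; apply: nG.
have [[pP ka kp ext] _] := syz_ses.
have [r ra] := ext _ (idmor _) pO.
have ar1 : is_iso (idmor (pcover S) - Omega_incl S \c r).
  apply: (cover_iso (pcoverP S)).
  by rewrite compmB compA (kernel_comp0 ka) comp0m subr0 compm1.
have a0 : Omega_incl S = 0.
  apply: (mono0 (is_iso_mono ar1)).
  by rewrite compBm comp1m -compA ra compm1 subrr.
have [|s sp] := cokernel_fact kp (h := idmor _); first by rewrite a0 compm0.
apply: (projective_retract (s := s) (r := pcover_map S)) => //.
by apply: (cokernel_epi kp); rewrite -compA sp compm1 comp1m.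
Qed.

(** An endomorphism of the syzygy extends to the cover and induces one of [G].
    An invertible induced endomorphism can be lifted back, and the composites so
    obtained are invertible since they induce the identity of [G]. *)
Lemma syz_local : local_end (Omega S).
Proof.
have [[pP ka kp ext] _] := syz_ses.
set a := Omega_incl S in ka kp ext; set p := pcover_map S in ka kp.
have ep := cokernel_epi kp; have ma := kernel_mono ka.
have lift f' : exists F f, p \c F = f' \c p /\ a \c f = F \c a.
  have [F pF] := pP _ _ p (f' \c p) ep.
  have [|f af] := kernel_fact ka (h := F \c a).
    by rewrite compA pF -compA (kernel_comp0 ka) compm0.
  by exists F, f.
have near1 g T : p \c T = p -> a \c g = T \c a -> is_iso g.
  move=> pG ag; have [|t at_] := kernel_fact ka (h := idmor _ - T).
    by rewrite compmB compm1 pG subrr.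
  have Gi : is_iso (idmor _ - a \c t).
    by rewrite at_ subKr; apply: (cover_iso (pcoverP S)).
  have -> : g = idmor _ - t \c a.
    apply: ma; rewrite compmB compm1 compA at_ compBm comp1m ag subKr //.
  exact: is_iso_1sub.
have key f F f' : a \c f = F \c a -> p \c F = f' \c p -> is_iso f' -> is_iso f.
  move=> af pF [g' [gf' fg']]; have [Gg [g [pG ag]]] := lift g'.
  have i1 : is_iso (g \c f).
    apply: (near1 _ (Gg \c F)); first by rewrite compA pG -compA pF compA gf' comp1m.
    by rewrite compA ag -!compA af.
  have i2 : is_iso (f \c g).
    apply: (near1 _ (F \c Gg)); first by rewrite compA pF -compA pG compA fg' comp1m.
    by rewrite compA af -!compA ag.
  by apply: is_isoP; [apply: split_mono_iso_comp i1 | apply: split_epi_iso_comp i2].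
move=> f; have [F Fa] := ext _ (a \c f) pP.
have [|f' f'p] := cokernel_fact kp (h := p \c F).
  by rewrite -compA Fa compA (kernel_comp0 ka) comp0m.
case: (lG f') => fi; [left|right]; first exact: (key _ F f').
apply: (key _ (idmor _ - F) (idmor _ - f')) => //.
  by rewrite compmB compBm compm1 comp1m Fa.
by rewrite compmB compBm compm1 comp1m f'p.
Qed.

End SyzygyLocal.

(** Von Neumann regularity of the stable category, stated with representatives. *)
Definition stably_regular := forall X Y (f : mor X Y),
  gorenstein_projective X -> gorenstein_projective Y ->
  exists x : mor Y X, through_proj (f - f \c x \c f).

(** With [x] a stable quasi-inverse of [h], the endomorphism [h x] (or [x h]) of
    [Y] is stably idempotent; as [End(Y)] is local, it or [1 - h x] is invertible. *)
Section Dichotomy.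
Context (regC : stably_regular) (Y : C) (gY : gorenstein_projective Y)
  (lY : local_end Y) (X : C) (gX : gorenstein_projective X).

Lemma split_epi_or_through_proj (h : mor X Y) : split_epi h \/ through_proj h.
Proof.
have [x hx] := regC h gX gY; case: (lY (h \c x)) => hi.
  by left; apply: split_epi_iso_comp hi.
right; have [g [_ gi _]] := is_iso_inv hi.
rewrite -(comp1m h) -gi -compA; apply: through_proj_compl.
by rewrite compBm comp1m.
Qed.

Lemma split_mono_or_through_proj (h : mor Y X) : split_mono h \/ through_proj h.
Proof.
have [x hx] := regC h gY gX; case: (lY (x \c h)) => hi.
  by left; apply: split_mono_iso_comp hi.
right; have [g [_ _ gi]] := is_iso_inv hi.
rewrite -(compm1 h) -gi compA; apply: through_proj_compr.
by rewrite compmB compm1 compA.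
Qed.

End Dichotomy.

Lemma split_mono_nproj X Y (f : mor X Y) : ~ projective X -> projective Y ->
  ~ split_mono f.
Proof. by move=> nX pY [r rf]; apply: nX; apply: projective_retract rf pY. Qed.

Lemma split_epi_nproj X Y (f : mor Y X) : ~ projective X -> projective Y ->
  ~ split_epi f.
Proof. by move=> nX pY [r rf]; apply: nX; apply: projective_retract rf pY. Qed.

(** The approximation [a] is a kernel of [q], since [G] embeds in a projective.
    The cover [P'] is a summand of [Q]; the complementary idempotent [1 - e]
    factors as [a t], and [t a] is an idempotent of [G] that factors through a
    projective, hence zero; this forces [e = 1]. *)
Lemma Omega_Omega_inv G (cG : cosyzygy G) (S : syzygy (Omega_inv cG)) :
  gorenstein_projective G -> ~ projective G -> local_end G ->
  isomorphic (Omega S) G.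
Proof.
case: cG S => Q a N q [pQ apx _] aq /= [P' p' G' i' cp' ip'] /= gG nG lG.
have [pP' ep' _] := cp'.
have [P0 [N0 [k [b [[pP0 kk kb ext] _]]]]] := gproj_right normC gG.
have qa := cokernel_comp0 aq; have eq_ := cokernel_epi aq.
have [u0 ua] := apx _ k pP0; have [w0 wk] := ext _ a pQ.
have ma : mono a.
  apply: monoP => W g e; apply: (mono0 (kernel_mono kk)).
  by rewrite -ua -compA e compm0.
have ka : is_kernel a q.
  apply: kernelI => // W h qh.
  have [|d dq] := cokernel_fact aq (h := b \c u0).
    by rewrite -compA ua (kernel_comp0 kk).
  have [|y ky] := kernel_fact kk (h := u0 \c h).
    by rewrite compA -dq -compA qh compm0.
  have [|s sq] := cokernel_fact aq (h := idmor _ - w0 \c u0).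
    by rewrite compBm comp1m -compA ua wk subrr.
  exists y; apply/esym/subr0_eq; rewrite -wk -compA ky.
  have: s \c q \c h = 0 by rewrite -compA qh compm0.
  by rewrite sq compBm comp1m compA.
have [u pu] := pQ _ _ p' q ep'; have [v qv] := pP' _ _ q p' eq_.
have [|w [wi wuv uvw]] := is_iso_inv (cover_iso (h := u \c v) cp' _).
  by rewrite compA pu qv.
have pw : p' \c w = p' by rewrite -{1}qv -pu -!compA (compA u) uvw compm1.
pose e := v \c w \c u.
have [|t at_] := kernel_fact ka (h := idmor Q - e).
  by rewrite compmB compm1 !compA qv pw pu subrr.
have ee : e \c e = e by rewrite /e -!compA (compA u v) (compA w (u \c v)) wuv comp1m.
have te : t \c e = 0.
  by apply: (mono0 ma); rewrite compA at_ compBm comp1m ee subrr.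
(* [t a] factors through [Q] and [(t a) (1 - t a) = t e a = 0], so [t a = 0]. *)
have tai : is_iso (idmor G - t \c a).
  by apply: local_1sub => //; exists Q, t, a.
have ta : t \c a = 0.
  apply: (epi0 (is_iso_epi tai)).
  have aa : a \c (t \c a) = a - e \c a by rewrite compA at_ compBm comp1m.
  by rewrite compmB compm1 -compA aa compmB (compA t e) te comp0m subr0 subrr.
have e1 : e = idmor Q.
  have: (idmor Q - e) \c (idmor Q - e) = 0.
    by rewrite -at_ -compA (compA t) ta comp0m compm0.
  by rewrite compBm comp1m compmB compm1 ee subrr subr0 => /subr0_eq.
have [|g ag] := kernel_fact ka (h := v \c w \c i').
  by rewrite !compA qv pw (kernel_comp0 ip').
have [|g' ig'] := kernel_fact ip' (h := u \c a).
  by rewrite compA pu qa.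
exists g, g'; split.
  apply: (kernel_mono ip').
  by rewrite compA ig' -compA ag !compA uvw comp1m compm1.
by apply: ma; rewrite compA ag -compA ig' compA -/e e1 compm1 comp1m.
Qed.

Section Uniqueness.
Context (E : C -> Prop).

(** With [1 - u = f w] one has [1 - h = w f], and [is_iso_1sub] applies. *)
Lemma ses_endo_iso X Y Z (f : mor X Y) (g : mor Y Z) (h : mor X X) (u : mor Y Y) :
  is_kernel f g -> u \c f = f \c h -> g \c u = g -> is_iso h -> is_iso u.
Proof.
move=> fg uf gu hi.
have [|w fw] := kernel_fact fg (h := idmor Y - u).
  by rewrite compmB compm1 gu subrr.
have -> : u = idmor Y - f \c w by rewrite fw subKr.
apply: is_iso_1sub.
have -> // : idmor X - w \c f = h.
apply: (kernel_mono fg).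
by rewrite compmB compm1 compA fw compBm comp1m uf subKr.
Qed.

(** Otherwise [h = t f], and [u - f t] would induce a section of [g]. *)
Lemma almost_split_endo X Y Z (f : mor X Y) (g : mor Y Z) (h : mor X X) (u : mor Y Y) :
  almost_split E f g -> u \c f = f \c h -> g \c u = g -> split_mono h.
Proof.
move=> [[[EX _ _] [kf cg]] [nf lf] [ng _]] uf gu.
apply: contrapT => nh; apply: ng.
have [t tf] := lf _ h EX nh.
have [|s sg] := cokernel_fact cg (h := u - f \c t).
  by rewrite compBm -compA tf uf subrr.
exists s; apply: (cokernel_epi cg).
by rewrite -compA sg compmB compA (kernel_comp0 kf) comp0m subr0 comp1m.
Qed.

(** Compare the two sequences in both directions: the endomorphisms induced on
    the left ends are split monomorphisms by [almost_split_endo], hence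
    isomorphisms by locality. *)
Lemma almost_split_unique X Y Z (f : mor X Y) (g : mor Y Z) :
  local_end X -> almost_split E f g -> almost_split_form E X Y Z.
Proof.
move=> lX as1; split; first by exists f, g.
move=> X' Y' f' g' as2.
have [[[_ EY _] [kf cg]] _ [ng rg]] := as1.
have [[[_ EY' _] [kf' cg']] _ [ng' rg']] := as2.
have [u gu] := rg _ g' EY' ng'; have [v gv] := rg' _ g EY ng.
have [|a fa] := kernel_fact kf (h := u \c f').
  by rewrite compA gu (kernel_comp0 kf').
have [|b fb] := kernel_fact kf' (h := v \c f).
  by rewrite compA gv (kernel_comp0 kf).
have uvf : u \c v \c f = f \c (a \c b) by rewrite compA fa -!compA fb.
have vuf : v \c u \c f' = f' \c (b \c a) by rewrite compA fb -!compA fa.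
have guv : g \c (u \c v) = g by rewrite compA gu gv.
have gvu : g' \c (v \c u) = g' by rewrite compA gv gu.
have abi := local_split_mono lX (almost_split_endo as1 uvf guv).
have [r rba] := almost_split_endo as2 vuf gvu.
have ai : is_iso a.
  apply: is_isoP; last exact: split_epi_iso_comp abi.
  by exists (r \c b); rewrite -compA.
have bi : is_iso b.
  have [a' [a'i a'a aa']] := is_iso_inv ai.
  rewrite -(comp1m b) -a'a -compA; exact: is_iso_comp.
split; first by exists a.
exists u; apply: is_isoP.
  by apply: split_mono_iso_comp (ses_endo_iso kf' vuf gvu (is_iso_comp bi ai)).
exact: split_epi_iso_comp (ses_endo_iso kf uvf guv abi).
Qed.

End Uniqueness.

End Local.

(** * Representations of the linear quiver *)

Section Reps.
Context (n : nat) (C : addcat).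
Local Notation R := (repcat n C).

Lemma rep_homE (X Y : R) (f g : mor X Y) : (forall v, rh f v = rh g v) -> f = g.
Proof. exact: rep_ext. Qed.

Lemma pred_ord_lt (v : 'I_n) m : nat_of_ord v = m.+1 -> (m < n)%N.
Proof. by move=> e; apply: leq_trans (ltn_ord v); rewrite e ltnS leqnSn. Qed.

Section Transport.
Context (X : rep n C).

(** Equal vertices are not convertible, so the identity has to be transported. *)
Definition trans_base (u v : 'I_n) : mor (X u) (X v) :=
  match u =P v with
  | ReflectT e => ecast w (mor (X u) (X w)) e (idmor (X u))
  | ReflectF _ => 0
  end.

Fixpoint trans_rec (u : 'I_n) (m : nat) :
    forall v : 'I_n, nat_of_ord v = m -> mor (X u) (X v) :=
  match m with
  | 0%N => fun v _ => trans_base u v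
  | m'.+1 => fun v e =>
      if u == v then trans_base u v
      else rep_map X (e : nat_of_ord v = (Ordinal (pred_ord_lt e)).+1)
             \c trans_rec u (v := Ordinal (pred_ord_lt e)) (erefl m')
  end.

Definition trans (u v : 'I_n) : mor (X u) (X v) := trans_rec u (erefl (v : nat)).

Lemma trans_refl u : trans u u = idmor (X u).
Proof.
have b : trans_base u u = idmor (X u).
  rewrite /trans_base; case: eqP => // e; by rewrite (eq_irrelevance e (erefl u)).
have E m e : @trans_rec u m u e = idmor _ by case: m e => [|m] e /=; rewrite ?eqxx.
exact: E.
Qed.

Lemma trans_step (u v w : 'I_n) (vw : nat_of_ord w = v.+1) : (u <= v)%N ->
  trans u w = rep_map X vw \c trans u v.
Proof.
move=> uv.
have E m e : trans u w = @trans_rec u m w e by subst m.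
rewrite (E _ vw) /=; case: eqP => [uw|_]; first by rewrite uw vw ltnn in uv.
move: (pred_ord_lt _) => lt; rewrite /trans.
have Ev : Ordinal lt = v by apply: val_inj.
move: lt Ev vw; case: v uv {E} => v lv uv /= lt Ev vw.
have -> : lt = lv by apply: bool_irrelevance.
by [].
Qed.

Lemma ord_up_ind (u : 'I_n) (A : 'I_n -> Prop) : A u ->
  (forall v w : 'I_n, nat_of_ord w = v.+1 -> (u <= v)%N -> A v -> A w) ->
  forall v : 'I_n, (u <= v)%N -> A v.
Proof.
move=> Au As v; move e : (v : nat) => m.
elim: m v e => [|m IH] v e; first by rewrite leqn0 => /eqP u0;
  rewrite (_ : v = u) //; apply: val_inj; rewrite /= u0.
rewrite leq_eqVlt => /orP[/eqP uv|um].
  by rewrite (_ : v = u) //; apply: val_inj; rewrite /= uv.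
pose w := Ordinal (pred_ord_lt e).
by apply: (As w) => //; apply: IH.
Qed.

Lemma trans_pre (t u v : 'I_n) (tu : nat_of_ord u = t.+1) : (u <= v)%N ->
  trans u v \c rep_map X tu = trans t v.
Proof.
move: v; apply: ord_up_ind.
  by rewrite trans_refl comp1m (trans_step tu) // trans_refl compm1.
move=> v w vw uv IH; rewrite (trans_step vw) // -compA IH -trans_step //.
by apply: leq_trans uv; rewrite tu leqnSn.
Qed.

Lemma trans_comp (u v w : 'I_n) : (u <= v)%N -> (v <= w)%N ->
  trans v w \c trans u v = trans u w.
Proof.
move=> uv; move: w; apply: ord_up_ind; first by rewrite trans_refl comp1m.
move=> w x wx vw IH; rewrite (trans_step wx) // -compA IH -trans_step //.
exact: leq_trans vw.
Qed.

End Transport.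

Lemma trans_nat (X Y : R) (f : mor X Y) (u v : 'I_n) : (u <= v)%N ->
  rh f v \c trans X u v = trans Y u v \c rh f u.
Proof.
move: v; apply: ord_up_ind; first by rewrite !trans_refl compm1 comp1m.
move=> v w vw uv IH; rewrite !(trans_step _ vw) // compA -rhP -compA IH.
by rewrite compA.
Qed.

Lemma trans_fam (X : R) Q (b : forall v, mor ((X : rep n C) v) Q) :
  (forall (u v : 'I_n) (uv : nat_of_ord v = u.+1), b v \c rep_map X uv = b u) ->
  forall u v : 'I_n, (u <= v)%N -> b v \c trans X u v = b u.
Proof.
move=> hb u; apply: ord_up_ind; first by rewrite trans_refl compm1.
by move=> v w vw uv IH; rewrite (trans_step _ vw) // compA hb.
Qed.

Section Zones.
Context (i j : nat) (K P : C) (l : mor K P).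
Implicit Types z : zone.

Variant zone_spec (v : nat) : zone -> Prop :=
| ZoneSpecZero of (v.+1 < i)%N : zone_spec v ZoneZero
| ZoneSpecKer of (i <= v.+1)%N & (v.+1 <= j)%N : zone_spec v ZoneKer
| ZoneSpecProj of (i <= v.+1)%N & (j < v.+1)%N : zone_spec v ZoneProj.

Lemma zone_ofP (v : 'I_n) : zone_spec v (zone_of i j v).
Proof.
rewrite /zone_of; case: ltnP => vi; first by constructor.
by case: leqP => vj; constructor.
Qed.

(** For a monomorphism [l], these are the components of an embedding of the
    bracket into the constant representation [P]; through it, a morphism into
    the bracket becomes a compatible family of morphisms to [P]. *)
Definition zemb z : mor (zone_obj K P z) P :=
  match z with ZoneZero => 0 | ZoneKer => l | ZoneProj => idmor P end.
Definition zprK z : mor (zone_obj K P z) K :=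
  match z with ZoneKer => idmor K | _ => 0 end.
(** The components, where defined, of morphisms to the bracket from the
    representations that are constantly [K] from the vertex [i] on and constantly
    [P] from the vertex [j + 1] on; together they are epimorphic. *)
Definition zinK z : mor K (zone_obj K P z) :=
  match z with ZoneZero => 0 | ZoneKer => idmor K | ZoneProj => l end.
Definition zinP z : mor P (zone_obj K P z) :=
  match z with ZoneProj => idmor P | _ => 0 end.

Lemma zemb_mono z : mono l -> mono (zemb z).
Proof.
move=> ml; case: z => //=; first by move=> W g h _; apply: to_zobj.
by move=> W g h; rewrite !comp1m.
Qed.

Lemma zone_stepP (u v : 'I_n) : nat_of_ord v = u.+1 ->
  [/\ zemb (zone_of i j v) \c zone_map l (zone_of i j u) (zone_of i j v)
        = zemb (zone_of i j u),
      (i <= u.+1)%N -> zone_map l (zone_of i j u) (zone_of i j v)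
        \c zinK (zone_of i j u) = zinK (zone_of i j v) &
      (j < u.+1)%N -> (i <= u.+1)%N -> zone_map l (zone_of i j u) (zone_of i j v)
        \c zinP (zone_of i j u) = zinP (zone_of i j v)].
Proof.
move=> uv; case: (zone_ofP u); case: (zone_ofP v) => /=; rewrite ?uv => *;
  rewrite ?comp0m ?compm0 ?comp1m ?compm1; split=> // *; try lia.
Qed.

Local Notation B := (bracket_rep n i j l : R).
Local Notation z_ v := (zone_of i j v).

Lemma zemb_step (u v : 'I_n) (uv : nat_of_ord v = u.+1) :
  zemb (z_ v) \c rep_map (B : rep n C) uv = zemb (z_ u).
Proof. by case: (zone_stepP uv). Qed.

Lemma zinK_step (u v : 'I_n) (uv : nat_of_ord v = u.+1) : (i <= u.+1)%N ->
  rep_map (B : rep n C) uv \c zinK (z_ u) = zinK (z_ v).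
Proof. by case: (zone_stepP uv). Qed.

Lemma zinP_step (u v : 'I_n) (uv : nat_of_ord v = u.+1) : (j < u.+1)%N ->
  (i <= u.+1)%N -> rep_map (B : rep n C) uv \c zinP (z_ u) = zinP (z_ v).
Proof. by case: (zone_stepP uv). Qed.

Lemma zemb_factor (v : 'I_n) : (v.+1 <= j)%N -> zemb (z_ v) = l \c zprK (z_ v).
Proof.
by case: (zone_ofP v) => /= *; rewrite ?compm0 ?compm1 //; lia.
Qed.

Lemma zemb0 (v : 'I_n) : (v.+1 < i)%N -> zemb (z_ v) = 0.
Proof. by case: (zone_ofP v) => //= *; lia. Qed.

Lemma into_bracket (X : R) (b : forall v, mor ((X : rep n C) v) P) : mono l ->
  (forall (u v : 'I_n) (uv : nat_of_ord v = u.+1), b v \c rep_map X uv = b u) ->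
  (forall v : 'I_n, (i <= v.+1)%N -> (v.+1 <= j)%N -> exists a, b v = l \c a) ->
  (forall v : 'I_n, (v.+1 < i)%N -> b v = 0) ->
  exists h : mor X B, forall v, zemb (z_ v) \c rh h v = b v.
Proof.
move=> ml bn bl b0.
have ex v : exists c : mor ((X : rep n C) v) (zone_obj K P (z_ v)),
  zemb (z_ v) \c c = b v.
  case: (zone_ofP v) => /=.
  - by move=> vi; exists 0; rewrite comp0m b0.
  - by move=> iv vj; have [a ->] := bl v iv vj; exists a.
  - by exists (b v); rewrite comp1m.
pose c v := projT1 (cid (ex v)).
have cP v : zemb (z_ v) \c c v = b v := projT2 (cid (ex v)).
have cn (u v : 'I_n) (uv : nat_of_ord v = u.+1) :
    rep_map (B : rep n C) uv \c c u = c v \c rep_map X uv.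
  by apply: (zemb_mono ml); rewrite !compA zemb_step !cP bn.
by exists (@RepHom n C X B c cn).
Qed.

Lemma into_bracket_ext (X : R) (g h : mor X B) : mono l ->
  (forall v, zemb (z_ v) \c rh g v = zemb (z_ v) \c rh h v) -> g = h.
Proof. by move=> ml gh; apply: rep_homE => v; apply: (zemb_mono ml). Qed.

Lemma into_bracket_nat (X : R) (h : mor X B) (u v : 'I_n) (uv : nat_of_ord v = u.+1) :
  zemb (z_ v) \c rh h v \c rep_map X uv = zemb (z_ u) \c rh h u.
Proof. by rewrite -compA -(rhP h uv) compA (zemb_step uv). Qed.

Definition zout (Y : C) (c : mor K Y) (d : mor P Y) z : mor (zone_obj K P z) Y :=
  match z with ZoneZero => 0 | ZoneKer => c | ZoneProj => d end.

Lemma from_bracket (Y : R) (c : forall v, mor K ((Y : rep n C) v))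
    (d : forall v, mor P ((Y : rep n C) v)) :
  (forall (u v : 'I_n) (uv : nat_of_ord v = u.+1), (i <= u.+1)%N ->
     rep_map Y uv \c c u = c v) ->
  (forall (u v : 'I_n) (uv : nat_of_ord v = u.+1), (i <= u.+1)%N -> (j < u.+1)%N ->
     rep_map Y uv \c d u = d v) ->
  (forall v : 'I_n, (i <= v.+1)%N -> (j < v.+1)%N -> d v \c l = c v) ->
  exists h : mor B Y,
    (forall v : 'I_n, (i <= v.+1)%N -> rh h v \c zinK (z_ v) = c v) /\
    (forall v : 'I_n, (i <= v.+1)%N -> (j < v.+1)%N ->
       rh h v \c zinP (z_ v) = d v).
Proof.
move=> cn dn dl; pose h v := zout (c v) (d v) (z_ v).
have hn (u v : 'I_n) (uv : nat_of_ord v = u.+1) :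
    rep_map Y uv \c h u = h v \c rep_map (B : rep n C) uv.
  rewrite /h /=; case: (zone_ofP u); case: (zone_ofP v) => /= h1 h2;
    try (move=> h3 h4); rewrite ?compm0 ?comp0m ?compm1 ?cn ?dn ?dl //;
    move: uv {cn dn} => uv; try lia; rewrite uv in h1 h2; try lia.
exists (@RepHom n C B Y h hn); split=> v; rewrite /= /h; case: (zone_ofP v) => //= *;
  rewrite ?compm1 ?dl //; lia.
Qed.

Lemma from_bracket_ext (Y : R) (g h : mor B Y) :
  (forall v : 'I_n, (i <= v.+1)%N -> (v.+1 <= j)%N ->
     rh g v \c zinK (z_ v) = rh h v \c zinK (z_ v)) ->
  (forall v : 'I_n, (i <= v.+1)%N -> (j < v.+1)%N ->
     rh g v \c zinP (z_ v) = rh h v \c zinP (z_ v)) -> g = h.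
Proof.
move=> e1 e2; apply: rep_homE => v; move: (e1 v) (e2 v); move: (rh g v) (rh h v).
rewrite /=; case: (zone_ofP v) => /= [_ g' h' _ _|iv jv g' h' + _|iv jv g' h' _ +].
- exact: from_zobj.
- by rewrite !compm1; apply.
- by rewrite !compm1; apply.
Qed.

Lemma from_bracketK_nat (Y : R) (h : mor B Y) (u v : 'I_n)
    (uv : nat_of_ord v = u.+1) : (i <= u.+1)%N ->
  rep_map Y uv \c (rh h u \c zinK (z_ u)) = rh h v \c zinK (z_ v).
Proof. by move=> iu; rewrite compA (rhP h uv) -compA (zinK_step uv). Qed.

Lemma from_bracketP_nat (Y : R) (h : mor B Y) (u v : 'I_n)
    (uv : nat_of_ord v = u.+1) : (i <= u.+1)%N -> (j < u.+1)%N ->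
  rep_map Y uv \c (rh h u \c zinP (z_ u)) = rh h v \c zinP (z_ v).
Proof. by move=> iu ju; rewrite compA (rhP h uv) -compA (zinP_step uv). Qed.

Lemma from_bracketKP (Y : R) (h : mor B Y) (v : 'I_n) : (i <= v.+1)%N -> (j < v.+1)%N ->
  rh h v \c zinP (z_ v) \c l = rh h v \c zinK (z_ v).
Proof.
move: (rh h v); rewrite /=; case: (zone_ofP v) => //= *; try lia.
by rewrite compm1.
Qed.

End Zones.

Section Pointwise.
Context (X Y Z : R) (k : mor X Y) (f : mor Y Z).

Lemma rep_mono : (forall v, mono (rh k v)) -> mono k.
Proof.
move=> mk W g h e; apply: rep_homE => v; apply: mk.
by have := congr1 (fun x => rh x v) e.
Qed.

Lemma rep_epi : (forall v, epi (rh k v)) -> epi k.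
Proof.
move=> mk W g h e; apply: rep_homE => v; apply: mk.
by have := congr1 (fun x => rh x v) e.
Qed.

Lemma rep_kernel : (forall v, is_kernel (rh k v) (rh f v)) -> is_kernel k f.
Proof.
move=> hk; have mk v := kernel_mono (hk v); apply: kernelI; last first.
- move=> W h fh.
  have ex v : exists u, rh k v \c u = rh h v.
    by apply: (kernel_fact (hk v)); have := congr1 (fun x => rh x v) fh.
  pose c v := projT1 (cid (ex v)); have cP v : rh k v \c c v = rh h v :=
    projT2 (cid (ex v)).
  have cn (u v : 'I_n) (uv : nat_of_ord v = u.+1) :
      rep_map X uv \c c u = c v \c rep_map W uv.
    by apply: (mk v); rewrite !compA -rhP -compA !cP rhP.
  by exists (@RepHom n C W X c cn); apply: rep_homE => v; apply: cP.
- exact: rep_mono.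
- by apply: rep_homE => v; apply: kernel_comp0 (hk v).
Qed.

Lemma rep_cokernel : (forall v, is_cokernel (rh k v) (rh f v)) -> is_cokernel k f.
Proof.
move=> hf; have ef v := cokernel_epi (hf v); apply: cokernelI; last first.
- move=> W h fh.
  have ex v : exists u, u \c rh f v = rh h v.
    by apply: (cokernel_fact (hf v)); have := congr1 (fun x => rh x v) fh.
  pose c v := projT1 (cid (ex v)); have cP v : c v \c rh f v = rh h v :=
    projT2 (cid (ex v)).
  have cn (u v : 'I_n) (uv : nat_of_ord v = u.+1) :
      rep_map W uv \c c u = c v \c rep_map Z uv.
    by apply: (ef u); rewrite -!compA (rhP f uv) (compA (c v)) !cP (rhP h uv).
  by exists (@RepHom n C Z W c cn); apply: rep_homE => v; apply: cP.
- move=> W g h e; apply: rep_homE => v; apply: ef.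
  by have := congr1 (fun x => rh x v) e.
- by apply: rep_homE => v; apply: cokernel_comp0 (hf v).
Qed.

End Pointwise.

(** Below [j] the projection to [K] is compatible with the structure maps,
    although it is zero after [j]. *)
Lemma zprK_step i j (K P : C) (l : mor K P) (u v : 'I_n) (uv : nat_of_ord v = u.+1) :
  (i <= u.+1)%N -> (v.+1 <= j)%N ->
  zprK K P (zone_of i j v) \c rep_map (bracket_rep n i j l : rep n C) uv
    = zprK K P (zone_of i j u).
Proof.
by move=> /=; case: (zone_ofP i j u); case: (zone_ofP i j v) => //=;
  rewrite ?uv => *; rewrite ?compm1 //; lia.
Qed.

Section FromTrans.
Context (i j : nat) (K P : C) (l : mor K P) (Y : R).
Context (h : mor (bracket_rep n i j l) Y) (u w : 'I_n) (uw : (u <= w)%N).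

Lemma from_bracketK_trans : (i <= u.+1)%N ->
  trans Y u w \c (rh h u \c zinK l (zone_of i j u))
    = rh h w \c zinK l (zone_of i j w).
Proof.
move=> iu; move: w uw; apply: ord_up_ind; first by rewrite trans_refl comp1m.
move=> v x vx uv IH; rewrite (trans_step _ vx) // -compA IH.
by apply: from_bracketK_nat; lia.
Qed.

Lemma from_bracketP_trans : (i <= u.+1)%N -> (j < u.+1)%N ->
  trans Y u w \c (rh h u \c zinP K P (zone_of i j u))
    = rh h w \c zinP K P (zone_of i j w).
Proof.
move=> iu ju; move: w uw; apply: ord_up_ind; first by rewrite trans_refl comp1m.
move=> v x vx uv IH; rewrite (trans_step _ vx) // -compA IH.
by apply: from_bracketP_nat; lia.
Qed.

End FromTrans.

(** [bracket_proj n v T], with [T] at the vertices from [v] on, is the value at [T]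
    of the left adjoint of the evaluation at [v]. *)
Section LeftAdjoint.
Context (T : C) (Y : R) (v : 'I_n).
Local Notation LT := (bracket_proj n v T : R).

Lemma left_adj_ex (h : mor T ((Y : rep n C) v)) :
  exists H : mor LT Y, rh H v \c zinP zobj T (zone_of v v v) = h.
Proof.
have [||//|H [_ HP]] := @from_bracket v v zobj T 0 Y (fun=> 0) (fun w =>
  trans Y v w \c h).
- by move=> *; rewrite compm0.
- by move=> u w uw _ vu; rewrite compA -(trans_step _ uw).
- by move=> w _ _; rewrite compm0.
by exists H; rewrite HP // trans_refl comp1m.
Qed.

Lemma left_adj_ext (g h : mor LT Y) :
  rh g v \c zinP zobj T (zone_of v v v) = rh h v \c zinP zobj T (zone_of v v v) ->
  g = h.
Proof.
move=> e; apply: from_bracket_ext => w vw1 vw2; first exact: from_zobj.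
rewrite -(from_bracketP_trans g (u := v)) //; try lia.
by rewrite -(from_bracketP_trans h (u := v)) //; try lia; rewrite e.
Qed.

End LeftAdjoint.

(** The value at [T] of the right adjoint of the evaluation at [v]. *)
Definition head_rep (v : 'I_n) (T : C) : R := bracket_rep n 0 v.+1 (0 : mor T zobj).

Local Notation prH T v w := (zprK T zobj (zone_of 0 v.+1 w)).

Section RightAdjoint.
Context (T : C) (Y : R) (v : 'I_n).

Lemma into_head (a : forall w, mor ((Y : rep n C) w) T) :
  (forall (u w : 'I_n) (uw : nat_of_ord w = u.+1), (w <= v)%N ->
     a w \c rep_map Y uw = a u) ->
  exists H : mor Y (head_rep v T), forall w : 'I_n, (w <= v)%N ->
    prH T v w \c rh H w = a w.
Proof.
move=> an.
pose c w : mor ((Y : rep n C) w) (zone_obj T zobj (zone_of 0 v.+1 w)) :=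
  zinK (0 : mor T zobj) (zone_of 0 v.+1 w) \c a w.
have cn (u w : 'I_n) (uw : nat_of_ord w = u.+1) :
    rep_map (head_rep v T : rep n C) uw \c c u = c w \c rep_map Y uw.
  rewrite /c /=; case: (zone_ofP 0 v.+1 w) => //= h1 h2; last exact: to_zobj.
  case: (zone_ofP 0 v.+1 u) => //= h3 h4; last by lia.
  by rewrite !comp1m an.
exists (@RepHom n C Y (head_rep v T) c cn) => w wv /=; rewrite /c.
by case: (zone_ofP 0 v.+1 w) => //= *; rewrite ?comp1m //; lia.
Qed.

Lemma into_head_ext (g h : mor Y (head_rep v T)) :
  (forall w : 'I_n, (w <= v)%N -> prH T v w \c rh g w = prH T v w \c rh h w) ->
  g = h.
Proof.
move=> e; apply: rep_homE => w; move: (e w); move: (rh g w) (rh h w) => /=.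
case: (zone_ofP 0 v.+1 w) => //= *; last exact: to_zobj.
by rewrite -[LHS]comp1m -[RHS]comp1m; auto.
Qed.

Lemma right_adj_ex (h : mor ((Y : rep n C) v) T) :
  exists H : mor Y (head_rep v T), forall w : 'I_n, (w <= v)%N ->
    prH T v w \c rh H w = h \c trans Y w v.
Proof.
apply: into_head => u w uw wv.
by rewrite -compA trans_pre.
Qed.

End RightAdjoint.

(** Monomorphisms and kernels are tested on the representations that start at
    [v], epimorphisms on those that end at [v]. *)
Section EvalExact.
Context (X Y Z : R) (k : mor X Y) (f : mor Y Z) (v : 'I_n).

Lemma eval_mono : mono k -> mono (rh k v).
Proof.
move=> mk W g h e.
have [G Gv] := left_adj_ex g; have [H Hv] := left_adj_ex h.
have GH : G = H.
  by apply: mk; apply: left_adj_ext; rewrite /= -!compA Gv Hv.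
by rewrite -Gv -Hv GH.
Qed.

Lemma eval_epi : epi f -> epi (rh f v).
Proof.
move=> ef; apply: epiP => W g e.
have [H Hv] := right_adj_ex g.
have H0 : H = 0.
  apply: (epi0 ef); apply: into_head_ext => w wv.
  by rewrite /= compA Hv // -compA -(trans_nat f) // compA e comp0m compm0.
by move: (Hv v (leqnn _)); rewrite H0 trans_refl compm1 compm0.
Qed.

Lemma eval_kernel : is_kernel k f -> is_kernel (rh k v) (rh f v).
Proof.
move=> hk; apply: kernelI.
- by have := congr1 (fun x => rh x v) (kernel_comp0 hk).
- exact: eval_mono (kernel_mono hk).
move=> W h e; have [H Hv] := left_adj_ex h.
have [|U kU] := kernel_fact hk (h := H).
  by apply: left_adj_ext; rewrite /= -compA Hv e comp0m.
exists (rh U v \c zinP zobj W (zone_of v v v)); rewrite compA.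
by have /= -> := congr1 (fun x => rh x v) kU.
Qed.

End EvalExact.

(** The right adjoint [head_rep] of the evaluation preserves epimorphisms. *)
Lemma eval_projective (P : R) (v : 'I_n) : projective P -> projective ((P : rep n C) v).
Proof.
move=> pP X Y p g ep.
have [|q qP] := @into_head Y (head_rep v X) v (fun w => p \c prH X v w).
  move=> u w uw wv; rewrite -compA; congr (_ \c _); exact: (zprK_step _ uw).
have eq_ : epi q.
  apply: rep_epi => w; move: (qP w); move: (rh q w) => /=.
  case: (zone_ofP 0 v.+1 w) => //= [_ wv|_ _] qw e; last first.
    by move=> W a b _; apply: from_zobj.
  by move: (e wv); rewrite comp1m compm1 => ->.
have [G Gv] := right_adj_ex g.
have [t qt] := pP _ _ q G eq_.
exists (prH X v v \c rh t v); rewrite compA -qP // -compA.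
have /= -> := congr1 (fun x => rh x v) qt.
by rewrite Gv // trans_refl compm1.
Qed.

(** When [l] is a split monomorphism with complement [P0], the bracket is the sum
    of the representations generated by [K] at the vertex [i] and by [P0] at the
    vertex [j + 1]. *)
Lemma bracket_projective i j (K P P0 : C) (l : mor K P) (m : mor P0 P)
    (q : mor P P0) (r : mor P K) :
  (i.-1 < n)%N -> (i <= j.+1)%N -> projective K -> projective P0 ->
  r \c l = idmor K -> q \c l = 0 -> l \c r + m \c q = idmor P ->
  projective (bracket_rep n i j l : R).
Proof.
move=> i_n ij pK pP0 rl ql lr X Y p f ep.
have epv v : epi (rh p v) := eval_epi ep.
pose v0 := Ordinal i_n.
have iv0 : (i <= v0.+1)%N by rewrite /=; lia.
have v0i (v : 'I_n) : (i <= v.+1)%N -> (v0 <= v)%N by rewrite /=; lia.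
have [c0 pc0] := pK _ _ (rh p v0) (rh f v0 \c zinK l _) (epv v0).
have [d0 [d0n pd0]] : exists d0 : forall v, mor P0 ((X : rep n C) v),
    (forall (u v : 'I_n) (uv : nat_of_ord v = u.+1), (j < u.+1)%N ->
       rep_map X uv \c d0 u = d0 v) /\
    forall v : 'I_n, (j < v.+1)%N -> rh p v \c d0 v = rh f v \c zinP K P
      (zone_of i j v) \c m.
  case: (ltnP j n) => jn; last first.
    by exists (fun=> 0); split=> [u v uv ju|v jv]; [have := ltn_ord u|have :=
      ltn_ord v]; lia.
  pose v1 := Ordinal jn.
  have [d pd] := pP0 _ _ (rh p v1) (rh f v1 \c zinP K P _ \c m) (epv v1).
  exists (fun v => trans X v1 v \c d); split=> [u v uv ju|v jv].
    by rewrite compA -trans_step.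
  rewrite compA trans_nat // -compA pd compA from_bracketP_trans //=; lia.
have [||v iv jv|h [hK hP]] := @from_bracket i j K P l X (fun v => trans X v0 v \c c0)
    (fun v => trans X v0 v \c c0 \c r + d0 v \c q).
- by move=> u v uv iu; rewrite compA -trans_step //; apply: v0i.
- move=> u v uv iu ju; rewrite compDr !compA d0n // -trans_step //; exact: v0i.
- by rewrite compDl -!compA rl ql compm1 compm0 addr0.
have pc (v : 'I_n) : (i <= v.+1)%N ->
    rh p v \c (trans X v0 v \c c0) = rh f v \c zinK l (zone_of i j v).
  move=> iv; rewrite compA trans_nat ?v0i // -compA pc0 from_bracketK_trans //.
  exact: v0i.
exists h; apply: from_bracket_ext => v iv jv /=; rewrite -compA.
  by rewrite hK // pc.
rewrite hP // compDr (compA _ _ r) pc // compA pd0 // -from_bracketKP //.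
by rewrite -!compA -!compDr lr compm1.
Qed.

Lemma bracket_proj_projective i (P : C) : (i.-1 < n)%N -> projective P ->
  projective (bracket_proj n i P : R).
Proof.
move=> i_n pP; apply: (@bracket_projective i i zobj P P 0 (idmor P) (idmor P) 0) => //.
- by move=> X Y p f _; exists 0; apply: from_zobj.
- exact: from_zobj.
- by rewrite compm0.
- by rewrite comp0m add0r comp1m.
Qed.

Context (normC : normal_epis C).

Lemma rep_normal_epis : normal_epis R.
Proof.
move=> X Y Z k f hk ef; apply: rep_cokernel => v.
by apply: normC; [apply: eval_kernel | apply: eval_epi].
Qed.

Lemma mono_from_zobj (P : C) (f : mor zobj P) : mono f.
Proof. by move=> W g h _; apply: to_zobj. Qed.

Lemma eval_cokernel (X Y Z : R) (k : mor X Y) (f : mor Y Z) v :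
  is_kernel k f -> is_cokernel k f -> is_cokernel (rh k v) (rh f v).
Proof.
by move=> hk hf; apply: normC; [apply: eval_kernel|apply: eval_epi;
  apply: cokernel_epi hf].
Qed.

Section Extend.
Context (Q : C) (pQ : projective Q) (u : 'I_n).

Definition natural_to (X : R) (b : forall v, mor ((X : rep n C) v) Q) :=
  forall (v w : 'I_n) (vw : nat_of_ord w = v.+1), b w \c rep_map X vw = b v.

(** The representation [head_rep u Q] is a quotient of the constant one. *)
Lemma projective_extend (X : R) (t : mor ((X : rep n C) u) Q) : projective X ->
  exists b, natural_to (X := X) b /\ b u = t.
Proof.
move=> pX; have [G Gv] := right_adj_ex t.
have [|q qP] := @into_head Q (bracket_proj n 0 Q) u
    (fun w => zemb (0 : mor zobj Q) (zone_of 0 0 w)).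
  by move=> v w vw _; apply: zemb_step.
have eq_ : epi q.
  apply: rep_epi => w; move: (qP w); move: (rh q w) => /=.
  case: (zone_ofP 0 u.+1 w) => //= [_ wu|_ _] qw e; last first.
    by move=> W a b _; apply: from_zobj.
  move: qw e; case: (zone_ofP 0 0 w) => //= _ _ qw /(_ wu).
  by rewrite comp1m => -> W a b; rewrite !compm1.
have [t' qt] := pX _ _ q G eq_.
exists (fun w => zemb (0 : mor zobj Q) (zone_of 0 0 w) \c rh t' w); split.
  by move=> v w vw; apply: into_bracket_nat.
rewrite -qP // -compA.
have /= -> := congr1 (fun x => rh x u) qt.
by rewrite Gv // trans_refl compm1.
Qed.

(** Extend first on the projective [P] covering [X]. On the kernel [N] the family
    vanishes up to [u], hence is a morphism to a projective representation
    supported after [u]; extending that morphism to [P] gives the correction. *)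
Lemma gproj_extend (X : R) (t : mor ((X : rep n C) u) Q) : gorenstein_projective X ->
  exists b, natural_to (X := X) b /\ b u = t.
Proof.
move=> /(gproj_left rep_normal_epis)[P [N [a [p [[pP ka kp ext] _]]]]].
have [be [ben beu]] := projective_extend (t \c rh p u) pP.
have [||||H HP] := @into_bracket u.+1 u.+1 zobj Q 0 N (fun w => be w \c rh a w).
- exact: mono_from_zobj.
- by move=> v w vw; rewrite -compA -(rhP a vw) compA ben.
- move=> v vu1 vu2; exists 0; rewrite comp0m (_ : v = u);
  last by apply: val_inj => /=; lia.
  rewrite beu -compA.
  have /= -> := congr1 (fun x => rh x u) (kernel_comp0 ka).
  by rewrite compm0.
- move=> v vu; rewrite -(trans_fam ben (u := v) (v := u)); last by lia.
  rewrite beu -!compA -(trans_nat a); last by lia.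
  rewrite (compA (rh p u)).
  have /= -> := congr1 (fun x => rh x u) (kernel_comp0 ka).
  by rewrite comp0m compm0.
have pT : projective (bracket_proj n u.+1 Q : R).
  exact: (@bracket_proj_projective u.+1 Q (ltn_ord u) pQ).
have [H' H'a] := ext _ H pT.
(* [ga] vanishes on [N], so it descends to [X]; at [u] it still equals [t]. *)
pose ga w := be w - zemb (0 : mor zobj Q) (zone_of u.+1 u.+1 w) \c rh H' w.
have ex w : exists de, de \c rh p w = ga w.
  apply: (cokernel_fact (eval_cokernel w ka kp)).
  rewrite compBm -compA; have /= -> := congr1 (fun x => rh x w) H'a.
  by rewrite HP subrr.
pose de w := projT1 (cid (ex w)); have deP w : de w \c rh p w = ga w :=
  projT2 (cid (ex w)).
have ep w : epi (rh p w) := eval_epi (cokernel_epi kp).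
exists de; split.
  move=> v w vw; apply: (ep v).
  rewrite -compA (rhP p vw) compA !deP compBm ben; congr (_ - _).
  exact: (into_bracket_nat H' vw).
apply: (ep u); rewrite deP /ga beu zemb_factor // comp0m comp0m subr0 //.
Qed.

End Extend.

(** A morphism from a value of [M] to a projective is a morphism from [M] to a
    constant projective representation, by [gproj_extend]. *)
Lemma eval_gproj (X : R) (v : 'I_n) : gorenstein_projective X ->
  gorenstein_projective ((X : rep n C) v).
Proof.
have key (M N P : R) (a : mor M P) (b : mor P N) : gorenstein_projective M ->
    proj_ses a b -> proj_ses (rh a v) (rh b v).
  move=> gM [pP ka kb ext]; split.
  - exact: eval_projective.
  - exact: eval_kernel.
  - exact: eval_cokernel.
  move=> Q h pQ; have [be [ben <-]] := gproj_extend pQ h gM.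
  have [||||H HP] := @into_bracket 0 0 zobj Q 0 M be => //.
    exact: mono_from_zobj.
  have [|H' H'a] := ext (bracket_proj n 0 Q) H.
    by apply: bracket_proj_projective => //=; have := ltn_ord v; lia.
  exists (zemb (0 : mor zobj Q) (zone_of 0 0 v) \c rh H' v); rewrite -compA.
  have /= -> := congr1 (fun x => rh x v) H'a.
  by rewrite HP.
move=> gX; apply: (@gproj_coind _ (fun M => exists Y : R,
  gorenstein_projective Y /\ M = (Y : rep n C) v));
  last by exists X.
- move=> _ [Y [gY ->]].
  have [P [N [a [b [ab gN]]]]] := gproj_right rep_normal_epis gY.
  exists ((P : rep n C) v), ((N : rep n C) v), (rh a v), (rh b v).
  by split; [apply: key|exists N].
- move=> _ [Y [gY ->]].
  have [P [N [a [b [ab gN]]]]] := gproj_left rep_normal_epis gY.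
  exists ((P : rep n C) v), ((N : rep n C) v), (rh a v), (rh b v).
  by split; [apply: key|exists N].
Qed.
End Reps.

(** * The representations [[i, j, H]] *)

Section Brackets.
Context (n : nat) (C : addcat).
Local Notation R := (repcat n C).

Section Maps.
Context (i j : nat) (K P K' P' : C) (l : mor K P) (l' : mor K' P').
Context (a : mor K K') (b : mor P P') (ab : b \c l = l' \c a).

Definition zmap z : mor (zone_obj K P z) (zone_obj K' P' z) :=
  match z with ZoneZero => 0 | ZoneKer => a | ZoneProj => b end.

Lemma zmap_nat z w : zone_map l' z w \c zmap z = zmap w \c zone_map l z w.
Proof. by case: z; case: w => /=; rewrite ?comp0m ?compm0 ?comp1m ?compm1. Qed.

Definition bracket_map : mor (bracket_rep n i j l : R) (bracket_rep n i j l') :=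
  @RepHom n C (bracket_rep n i j l) (bracket_rep n i j l')
    (fun v => zmap (zone_of i j v)) (fun u v _ => zmap_nat _ _).

Lemma zmap_zinK z : zmap z \c zinK l z = zinK l' z \c a.
Proof. by case: z => /=; rewrite ?compm0 ?comp0m ?compm1 ?comp1m. Qed.

Lemma zmap_zinP z : zmap z \c zinP K P z = zinP K' P' z \c b.
Proof. by case: z => /=; rewrite ?compm0 ?comp0m ?compm1 ?comp1m. Qed.

End Maps.

Section ZoneLemmas.
Context (i j : nat) (K P : C) (l : mor K P) (v : 'I_n).

Lemma zemb_zinK : (i <= v.+1)%N ->
  zemb l (zone_of i j v) \c zinK l (zone_of i j v) = l.
Proof. by case: (zone_ofP i j v) => //= *; rewrite ?compm1 ?comp1m //; lia. Qed.

Lemma zemb_zinP : (i <= v.+1)%N -> (j < v.+1)%N ->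
  zemb l (zone_of i j v) \c zinP K P (zone_of i j v) = idmor P.
Proof. by case: (zone_ofP i j v) => //= *; rewrite ?compm1 //; lia. Qed.

Lemma zprK_zinK : (i <= v.+1)%N -> (v.+1 <= j)%N ->
  zprK K P (zone_of i j v) \c zinK l (zone_of i j v) = idmor K.
Proof. by case: (zone_ofP i j v) => //= *; rewrite ?compm1 //; lia. Qed.

Lemma zinK_zprK : (i <= v.+1)%N -> (v.+1 <= j)%N ->
  zinK l (zone_of i j v) \c zprK K P (zone_of i j v) = idmor _.
Proof. by case: (zone_ofP i j v) => //= *; rewrite ?compm1 //; lia. Qed.

End ZoneLemmas.

Lemma kernel_zobj : is_kernel (0 : mor (zobj : C) zobj) (0 : mor zobj (zobj : C)).
Proof.
apply: kernelI => [|W g h _|W h _]; [exact: to_zobj|exact: to_zobj|].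
by exists 0; apply: to_zobj.
Qed.

Lemma cokernel_zobj : is_cokernel (0 : mor (zobj : C) zobj) (0 : mor zobj (zobj : C)).
Proof.
apply: cokernelI => [|W g h _|W h _]; [exact: to_zobj|exact: from_zobj|].
by exists 0; apply: from_zobj.
Qed.

Context (normC : normal_epis C).

Section BracketSes.
Context (i j : nat) (i_n : (i.-1 < n)%N) (ij : (i <= j.+1)%N).
Context (K P H P0 H0 : C) (a : mor K P) (b : mor P H) (a0 : mor H P0) (b0 : mor P0 H0).
Context (ab : proj_ses a b) (ab0 : proj_ses a0 b0).

(** In the middle of the sequence below stands a projective representation. After
    the vertex [j] the first map is the graph of [w] and the second its equation. *)
Let w : mor P P0 := a0 \c b.

Lemma graph_kernel :
  is_kernel (dpair (idmor P) w) (dcopair w (- idmor P0)) /\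
  is_cokernel (dpair (idmor P) w) (dcopair w (- idmor P0)).
Proof.
have z : dcopair w (- idmor P0) \c dpair (idmor P) w = 0.
  by rewrite dcopair_dpair compm1 compNm comp1m subrr.
split; [apply: kernelI|apply: cokernelI] => //.
- by apply: split_mono_mono; exists (prj1 _ _); rewrite prj1_dpair.
- move=> W h; rewrite -(dpair_prj h) dcopair_dpair compNm comp1m => /subr0_eq e.
  by exists (prj1 _ _ \c h); rewrite dpair_comp comp1m e.
- apply: split_epi_epi; exists (- inj2 _ _).
  by rewrite compmN dcopair_inj2 opprK.
- move=> W h; rewrite -{1}(dcopair_inj h) dcopair_dpair compm1 => /eqP.
  rewrite addr_eq0 => /eqP e; exists (- (h \c inj2 _ _)).
  rewrite comp_dcopair compmN compm1 opprK compNm -e.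
  exact: dcopair_inj.
Qed.

Lemma bracket_ses : exists (f : mor (bracket_rep n i j a : R) (bracket_rep n i
  j (inj1 P P0)))
    (g : mor (bracket_rep n i j (inj1 P P0) : R) (bracket_rep n i j a0)), proj_ses f g.
Proof.
have [pP ka kb ext] := ab; have [pP0 _ _ ext0] := ab0.
have [kw cw] := graph_kernel.
have fc : dpair (idmor P) w \c a = inj1 P P0 \c a.
  rewrite dpair_comp comp1m -compA (kernel_comp0 ka) compm0.
  by rewrite /dpair compm0 addr0.
have gc : dcopair w (- idmor P0) \c inj1 P P0 = a0 \c b by rewrite dcopair_inj1.
exists (bracket_map i j fc), (bracket_map i j gc); split.
- apply: (@bracket_projective _ _ _ _ _ _ P0 _ (inj2 _ _) (prj2 _ _) (prj1 _ _)) => //.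
  + exact: prj1inj1.
  + exact: prj2inj1.
  + exact: dsumE.
- apply: rep_kernel => v /=; case: (zone_of i j v) => //=; exact: kernel_zobj.
- apply: rep_cokernel => v /=; case: (zone_of i j v) => //=; exact: cokernel_zobj.
move=> Q h pQ.
pose v0 := Ordinal i_n.
have v0i (v : 'I_n) : (i <= v.+1)%N -> (v0 <= v)%N by rewrite /=; lia.
have [g ga] := ext _ (rh h v0 \c zinK a _) (eval_projective (v := v0) pQ).
have [e [en ee]] : exists e : forall v, mor P0 ((Q : rep n C) v),
    (forall (u v : 'I_n) (uv : nat_of_ord v = u.+1), (j < u.+1)%N ->
       rep_map Q uv \c e u = e v) /\
    forall v : 'I_n, (i <= v.+1)%N -> (j < v.+1)%N ->
      e v \c a0 \c b = rh h v \c zinP K P (zone_of i j v) - trans Q v0 v \c g.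
  case: (ltnP j n) => jn; last first.
    by exists (fun=> 0); split=> [u v uv ju|v _ jv]; [have := ltn_ord u|have :=
      ltn_ord v]; lia.
  pose v1 := Ordinal jn.
  have [|e eb] := cokernel_fact kb (h := rh h v1 \c zinP K P _ - trans Q v0 v1 \c g).
    rewrite compBm -(compA (trans _ _ _)) ga from_bracketKP
      ?from_bracketK_trans /= ?subrr //; lia.
  have [e' e'a] := ext0 _ e (eval_projective (v := v1) pQ).
  exists (fun v => trans Q v1 v \c e'); split=> [u v uv ju|v iv jv].
    by rewrite compA -trans_step.
  rewrite -!compA (compA e') e'a eb compmB (compA _ _ g) trans_comp
    ?from_bracketP_trans //=; lia.
have [||v iv jv|h' [hK hP]] := @from_bracket n C i j _ _ (inj1 P P0) Q (fun v
  => trans Q v0 v \c g)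
    (fun v => dcopair (trans Q v0 v \c g) (e v)).
- by move=> u v uv iu; rewrite compA -trans_step //; apply: v0i.
- move=> u v uv iu ju; rewrite comp_dcopair en // compA -trans_step //; exact: v0i.
- by rewrite dcopair_inj1.
exists h'; apply: from_bracket_ext => v iv jv /=; rewrite -compA.
  rewrite (zmap_zinK fc) compA hK // -compA ga from_bracketK_trans //=; [exact: v0i|lia].
rewrite zmap_zinP compA hP // dcopair_dpair compm1 compA ee // addrC subrK //.
Qed.

End BracketSes.

(** The sequences of [bracket_ses] replace a bracket on [K -> P] by one on the
    next, or the previous, syzygy inclusion in a totally acyclic complex. *)
Lemma bracket_gproj i j (K P H : C) (a : mor K P) (b : mor P H) :
  (i.-1 < n)%N -> (i <= j.+1)%N -> proj_ses a b ->
  gorenstein_projective K -> gorenstein_projective H ->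
  gorenstein_projective (bracket_rep n i j a : R).
Proof.
move=> i_n ij ab gK gH.
apply: (@gproj_coind _ (fun X : R => exists K P H (a : mor K P) (b : mor P H),
   [/\ proj_ses a b, gorenstein_projective K, gorenstein_projective H &
    X = bracket_rep n i j a])); last by exists K, P, H, a, b.
- move=> _ [K1 [P1 [H1' [a1 [b1 [s1 gK1 gH1 ->]]]]]].
  have [P0 [H0 [a0 [b0 [s0 gH0]]]]] := gproj_right normC gH1.
  have [f [g fg]] := bracket_ses i_n ij s1 s0.
  exists (bracket_rep n i j (inj1 P1 P0)), (bracket_rep n i j a0), f, g.
  by split=> //; exists H1', P0, H0, a0, b0.
- move=> _ [K1 [P1 [H1' [a1 [b1 [s1 gK1 gH1 ->]]]]]].
  have [P0 [H0 [a0 [b0 [s0 gH0]]]]] := gproj_left normC gK1.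
  have [f [g fg]] := bracket_ses i_n ij s0 s1.
  exists (bracket_rep n i j (inj1 P0 P1)), (bracket_rep n i j a0), f, g.
  by split=> //; exists H0, P0, K1, a0, b0.
Qed.

Section Endo.
Context (i j : nat) (i1 : (1 <= i)%N) (ij : (i <= j)%N) (jn : (j <= n)%N).
Context (K P G : C) (a : mor K P) (p : mor P G) (ap : proj_ses a p).
Context (lG : local_end G) (nG : ~ projective G).
Local Notation B := (bracket_rep n i j a : R).

(** Extending the inverse of [s] to [P] reduces this to [t a = a]. Then
    [1 - t = y p], and [1 - p y] is invertible because [p y] is an endomorphism of
    the non-projective [G] factoring through [P]. *)
Lemma arrow_iso (s : mor K K) (t : mor P P) : t \c a = a \c s -> is_iso s -> is_iso t.
Proof.
move=> ta [s' [s's ss']].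
have [pP ka kp ext] := ap.
have [t' t'a] := ext _ (a \c s') pP.
have key (x : mor P P) : x \c a = a -> is_iso x.
  move=> xa; have [|y yp] := cokernel_fact kp (h := idmor P - x).
    by rewrite compBm comp1m xa subrr.
  have -> : x = idmor P - y \c p by rewrite yp subKr.
  by apply: is_iso_1sub; apply: local_1sub => //; exists P, p, y.
apply: is_isoP.
  apply: (@split_mono_iso_comp _ _ _ _ t'); apply: key.
  by rewrite -compA ta compA t'a -compA s's compm1.
apply: (@split_epi_iso_comp _ _ _ _ t'); apply: key.
by rewrite -compA t'a compA ta -compA ss' compm1.
Qed.

Lemma bracket_map_iso (s : mor K K) (t : mor P P) (c : t \c a = a \c s) :
  is_iso s -> is_iso (bracket_map i j c).
Proof.
move=> si; have [t' [t't tt']] := arrow_iso c si; case: si => s' [s's ss'].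
have c' : t' \c a = a \c s'.
  rewrite -[LHS]compm1 -ss' compA -(compA t') -c compA t't comp1m //.
exists (bracket_map i j c'); split; apply: rep_homE => v /=;
  by case: (zone_of i j v) => //=; apply: to_zobj.
Qed.

(** The structure maps are identities except from [K] to [P], so an endomorphism
    is given by one component in each zone; when the zone of [P] is empty, [t]
    is any extension of the component on [K]. *)
Lemma bracket_endo (v0 : 'I_n) (h : mor B B) : v0.+1 = i ->
  exists (t : mor P P)
    (c : t \c a = a \c (zprK K P (zone_of i j v0) \c rh h v0 \c zinK a (zone_of i j v0))),
    h = bracket_map i j c.
Proof.
move=> v0i; set s := _ \c _ \c zinK a _.
have [pP ka kp ext] := ap.
have hK (v : 'I_n) : (i <= v.+1)%N ->
    rh h v \c zinK a (zone_of i j v) = zinK a (zone_of i j v) \c s.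
  move=> iv; rewrite -(from_bracketK_trans h (u := v0)); try lia.
  rewrite -[rh h v0 \c _]comp1m -(@zinK_zprK i j _ _ a); try lia.
  rewrite -!compA (compA (zprK _ _ _)) -/s.
  have := from_bracketK_trans (idmor B) (u := v0) (w := v).
  rewrite /= !comp1m compA => -> //; lia.
have [t [c tP]] : exists t, t \c a = a \c s /\ forall v : 'I_n,
  (i <= v.+1)%N -> (j < v.+1)%N ->
    rh h v \c zinP K P (zone_of i j v) = zinP K P (zone_of i j v) \c t.
  case: (ltnP j n) => jn'; last first.
    have [t ta] := ext _ (a \c s) pP; exists t; split=> // v iv jv.
    by have := ltn_ord v; lia.
  pose v1 := Ordinal jn'.
  have z1 : zone_of i j v1 = ZoneProj by case: (zone_ofP i j v1) => //=; lia.
  pose t := zemb a (zone_of i j v1) \c rh h v1 \c zinP K P (zone_of i j v1).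
  exists t; split.
    rewrite /t -!compA (compA (rh h v1)) from_bracketKP ?hK /=; try lia.
    by rewrite compA zemb_zinK //=; lia.
  move=> v iv jv; rewrite -(from_bracketP_trans h (u := v1)) //=; try lia.
  have e1 : zinP K P (zone_of i j v1) \c zemb a (zone_of i j v1) = idmor _.
    by case: (zone_ofP i j v1) => //= *; rewrite ?compm1 //; lia.
  rewrite -[rh h v1 \c _]comp1m -e1 -(compA (zinP _ _ _)).
  rewrite (compA (zemb _ _)) -/t compA.
  have := from_bracketP_trans (idmor B) (u := v1) (w := v).
  by rewrite /= !comp1m => -> //; lia.
exists t, c; apply: from_bracket_ext => v iv jv /=.
  by rewrite (zmap_zinK c) hK.
by rewrite zmap_zinP tP.
Qed.

Lemma bracket_endo_iso (v0 : 'I_n) (h : mor B B) : v0.+1 = i ->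
  is_iso (zprK K P (zone_of i j v0) \c rh h v0 \c zinK a (zone_of i j v0)) ->
  is_iso h.
Proof.
by move=> v0i si; have [t [c ->]] := bracket_endo h v0i; apply: bracket_map_iso.
Qed.

Lemma bracket_local : local_end K -> local_end B.
Proof.
move=> lK h.
have i_n : (i.-1 < n)%N by lia.
pose v0 := Ordinal i_n; have v0i : v0.+1 = i by rewrite /=; lia.
case: (lK (zprK K P (zone_of i j v0) \c rh h v0 \c zinK a (zone_of i j v0))) => si.
  by left; apply: bracket_endo_iso si.
right; apply: (bracket_endo_iso v0i).
rewrite /= compmB compm1 compBm zprK_zinK //; lia.
Qed.

End Endo.

End Brackets.

(** * The three almost split sequences *)

(** At each vertex, the second and third sequences come from a square that has two
    parallel invertible sides or a zero corner. *)
Section Squares.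
Context (C : addcat) (A B D E : C).
Context (f1 : mor A B) (f2 : mor A D) (g1 : mor B E) (g2 : mor D E).
Context (sq : g1 \c f1 = g2 \c f2).

Definition bicartesian :=
  is_kernel (dpair f1 (- f2)) (dcopair g1 g2) /\
  is_cokernel (dpair f1 (- f2)) (dcopair g1 g2).

Let comp0 : dcopair g1 g2 \c dpair f1 (- f2) = 0.
Proof. by rewrite dcopair_dpair compmN sq subrr. Qed.

Let epiI : epi g1 \/ epi g2 -> epi (dcopair g1 g2).
Proof.
move=> ge; apply: epiP => W e; rewrite comp_dcopair => e0.
have e1 : e \c g1 = 0 by rewrite -(dcopair_inj1 (e \c g1) (e \c g2)) e0 comp0m.
have e2 : e \c g2 = 0 by rewrite -(dcopair_inj2 (e \c g1) (e \c g2)) e0 comp0m.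
by case: ge => ge; apply: (epi0 ge).
Qed.

Let monoI : mono f1 \/ mono f2 -> mono (dpair f1 (- f2)).
Proof.
move=> fm; apply: monoP => W e; rewrite dpair_comp => e0.
have e1 : f1 \c e = 0 by rewrite -(prj1_dpair (f1 \c e) (- f2 \c e)) e0 compm0.
have e2 : f2 \c e = 0.
  apply/eqP; rewrite -oppr_eq0 -compNm.
  by rewrite -(prj2_dpair (f1 \c e) (- f2 \c e)) e0 compm0.
by case: fm => fm; apply: (mono0 fm).
Qed.

Lemma bicartesian_iso12 : is_iso f1 -> is_iso g2 -> bicartesian.
Proof.
move=> fi gi; have [f' [f'i f'f ff']] := is_iso_inv fi.
have [g' [g'i g'g gg']] := is_iso_inv gi.
split; [apply: kernelI|apply: cokernelI] => //.
- by apply: monoI; left; apply: is_iso_mono.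
- move=> W h; rewrite -(dpair_prj h) dcopair_dpair => /eqP; rewrite addr_eq0 => /eqP e.
  exists (f' \c (prj1 _ _ \c h)); rewrite dpair_comp compA ff' comp1m; congr dpair.
  apply: (is_iso_mono gi); rewrite compNm compmN compA -sq -compA (compA f1) ff' comp1m.
  by rewrite e opprK.
- by apply: epiI; right; apply: is_iso_epi.
- move=> W h; rewrite -{1}(dcopair_inj h) dcopair_dpair compmN => /subr0_eq e.
  exists (h \c inj2 _ _ \c g'); rewrite comp_dcopair -(compA _ g' g2) g'g compm1.
  rewrite -[RHS]dcopair_inj; congr dcopair.
  by apply: (is_iso_epi fi); rewrite -!compA sq (compA g') g'g comp1m !compA e.
Qed.

Lemma bicartesian_iso21 : is_iso f2 -> is_iso g1 -> bicartesian.
Proof.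
move=> fi gi; have [f' [f'i f'f ff']] := is_iso_inv fi.
have [g' [g'i g'g gg']] := is_iso_inv gi.
split; [apply: kernelI|apply: cokernelI] => //.
- by apply: monoI; right; apply: is_iso_mono.
- move=> W h; rewrite -(dpair_prj h) dcopair_dpair => /eqP; rewrite addr_eq0 => /eqP e.
  exists (- (f' \c (prj2 _ _ \c h))).
  rewrite dpair_comp !compmN compNm opprK (compA f2) ff' comp1m; congr dpair.
  apply: (is_iso_mono gi); rewrite compmN compA sq -compA (compA f2) ff' comp1m.
  by rewrite e.
- by apply: epiI; left; apply: is_iso_epi.
- move=> W h; rewrite -{1}(dcopair_inj h) dcopair_dpair compmN => /subr0_eq e.
  exists (h \c inj1 _ _ \c g'); rewrite comp_dcopair -(compA _ g' g1) g'g compm1.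
  rewrite -[RHS]dcopair_inj; congr dcopair.
  by apply: (is_iso_epi fi); rewrite -!compA -sq (compA g') g'g comp1m !compA e.
Qed.

Lemma bicartesian_zero : is_zero D -> is_kernel f1 g1 -> is_cokernel f1 g1 ->
  bicartesian.
Proof.
move=> D0 fk gk.
have toD W (u v : mor W D) : u = v by rewrite -(comp1m u) -(comp1m v) D0 !comp0m.
have fromD W (u v : mor D W) : u = v by rewrite -(compm1 u) -(compm1 v) D0 !compm0.
split; [apply: kernelI|apply: cokernelI] => //.
- by apply: monoI; left; apply: kernel_mono fk.
- move=> W h; rewrite -(dpair_prj h) dcopair_dpair.
  rewrite (toD _ (prj2 _ _ \c h) 0) compm0 addr0 => e.
  have [u fu] := kernel_fact fk e; exists u; rewrite dpair_comp fu; congr dpair.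
  exact: toD.
- by apply: epiI; left; apply: cokernel_epi gk.
- move=> W h; rewrite -{1}(dcopair_inj h) dcopair_dpair.
  rewrite (toD _ (- f2) 0) compm0 addr0 => e.
  have [u ug] := cokernel_fact gk e; exists u; rewrite comp_dcopair ug.
  by rewrite -[RHS]dcopair_inj; congr dcopair; apply: fromD.
Qed.

End Squares.

Section AlmostSplit.
Context (n : nat) (C : addcat) (normC : normal_epis C) (regC : stably_regular C).
Local Notation R := (repcat n C).
Local Notation GP := (@gorenstein_projective R).

Lemma zemb_into (i j : nat) (K P : C) (l : mor K P) (v : 'I_n) (X : C)
    (h : mor X (zone_obj K P (zone_of i j v))) : (v.+1 <= j)%N ->
  l \c (zprK K P (zone_of i j v) \c h) = zemb l (zone_of i j v) \c h.
Proof. by move=> vj; rewrite zemb_factor // compA. Qed.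

Section Top.
Context (n2 : (2 <= n)%N) (K P G : C) (a : mor K P) (p : mor P G) (ap : proj_ses a p).
Context (gK : gorenstein_projective K) (lK : local_end K) (nK : ~ projective K).
Context (gG : gorenstein_projective G) (lG : local_end G) (nG : ~ projective G).
Context (G' P' : C) (a' : mor G' P') (ma' : mono a') (GG' : isomorphic G' G).
Local Notation X := (bracket_rep n 1 n a : R).
Local Notation Y := (bracket_rep n 1 n.-1 a : R).
Local Notation Z := (bracket_rep n n n a' : R).

(** As the zone of [P'] is empty, [Z] depends only on [G'] up to isomorphism. *)
Lemma top_gproj : GP Z.
Proof.
have [P0 [N [b [c [bc gN]]]]] := gproj_right normC gG.
have [s [s' [s's ss']]] := GG'.
apply: (@gproj_iso _ _ (bracket_rep n n n b : R)); last first.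
  by apply: (bracket_gproj normC _ _ bc) => //; lia.
have [||//|h [hK _]] := @from_bracket n C n n _ _ a' (bracket_rep n n n b : R)
    (fun v => zinK b (zone_of n n v) \c s) (fun=> 0).
- by move=> u v uv un; rewrite compA zinK_step.
- by move=> u v uv un _; rewrite compm0.
- by move=> v _ nv; have := ltn_ord v; lia.
have [||//|h' [hK' _]] := @from_bracket n C n n _ _ b (bracket_rep n n n a' : R)
    (fun v => zinK a' (zone_of n n v) \c s') (fun=> 0).
- by move=> u v uv un; rewrite compA zinK_step.
- by move=> u v uv un _; rewrite compm0.
- by move=> v _ nv; have := ltn_ord v; lia.
exists h, h'; split; apply: from_bracket_ext => v vn vn' /=;
  try by have := ltn_ord v; lia.
- by rewrite comp1m -compA hK // compA hK' // -compA s's compm1.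
- by rewrite comp1m -compA hK' // compA hK // -compA ss' compm1.
Qed.

(** For [h : W -> Z] the only nonzero component [hn] is at the last vertex. A
    section of it is a section of [h], because [Z] starts there; a lift [t] along
    [p], composed with the structure maps of [W], is a lift of [h]. Dually, [X]
    being constant, [h : X -> W] is governed by the composite [K -> W_1 -> W_n]. *)
Theorem almost_split_top : exists (f : mor X Y) (g : mor Y Z), almost_split GP f g.
Proof.
have [pP ka kp ext] := ap; have ma := kernel_mono ka; have pa := kernel_comp0 ka.
have [s [s' [s's ss']]] := GG'.
have n_n (v : 'I_n) := ltn_ord v.
have nlt : (n.-1 < n)%N by lia.
pose vn := Ordinal nlt.
have vnn : vn.+1 = n by rewrite /=; lia.
have [||v v1 v2|v v0|f fE] := @into_bracket n C 1 n.-1 _ _ a X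
  (fun v => zemb a (zone_of 1 n v)) => //.
- by move=> u v uv; apply: zemb_step.
- by exists (zprK K P (zone_of 1 n v)); rewrite zemb_factor.
have [||v v1 v2|v v0|g gE] := @into_bracket n C n n _ _ a' Y
  (fun v => a' \c s' \c p \c zemb a (zone_of 1 n.-1 v)) => //.
- by move=> u v uv; have := congr1 (cmp (a' \c s' \c p)) (zemb_step 1 n.-1 a
  uv); rewrite compA.
- by exists (s' \c p \c zemb a (zone_of 1 n.-1 v)); rewrite !compA.
- by rewrite zemb_factor; last lia; rewrite !compA -(compA _ p) pa compm0 comp0m.
have gX : GP X by apply: (bracket_gproj normC _ _ ap) => //; lia.
have gY : GP Y by apply: (bracket_gproj normC _ _ ap) => //; lia.
have gZ := top_gproj.
exists f, g.
have fg v : is_kernel (rh f v) (rh g v) /\ is_cokernel (rh f v) (rh g v).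
  move: (fE v) (gE v); move: (rh f v) (rh g v) => /=.
  case: (zone_ofP 1 n v) => //= _ vn1; last by have := n_n v; lia.
  case: (zone_ofP 1 n.-1 v) => //= _ vn2; case: (zone_ofP n n v) => //= vn3; try lia.
    move=> f' g' fe _.
    have -> : f' = idmor K by apply: ma; rewrite fe compm1.
    have -> : g' = 0 by apply: to_zobj.
    split; [apply: kernelI|apply: cokernelI]; rewrite ?comp0m //.
    - by move=> W u w; rewrite !comp1m.
    - by move=> W h _; exists h; rewrite comp1m.
    - by move=> W u w _; apply: from_zobj.
    - by move=> W h; rewrite compm1 => ->; exists 0; rewrite comp0m.
  move=> _ f' g'; rewrite comp1m compm1 => -> ge.
  have -> : g' = s' \c p by apply: ma'; rewrite ge !compA.
  have si : is_iso s' by exists s.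
  split.
    apply: kernelI; [by rewrite -compA pa compm0|exact: ma|move=> W h].
    by rewrite -compA => /(mono0 (is_iso_mono si)) /(kernel_fact ka).
  apply: normC.
    apply: kernelI; [by rewrite -compA pa compm0|exact: ma|move=> W h].
    by rewrite -compA => /(mono0 (is_iso_mono si)) /(kernel_fact ka).
  apply: epiP => W h; rewrite compA => /(epi0 (cokernel_epi kp)).
  exact: (epi0 (is_iso_epi si)).
have fK (v : 'I_n) : rh f v \c zinK a (zone_of 1 n v) = zinK a (zone_of 1 n.-1 v).
  by apply: (zemb_mono ma); rewrite compA fE !zemb_zinK.
split.
- split=> //; split; [apply: rep_kernel|apply: rep_cokernel] => v; by case: (fg v).
- split.
    move=> [r rf].
    apply: (@split_mono_nproj _ _ _ a nK pP).
    exists (zprK K P (zone_of 1 n vn) \c rh r vn \c zinP K P (zone_of 1 n.-1 vn)).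
    have e : zinP K P (zone_of 1 n.-1 vn) \c a = zinK a (zone_of 1 n.-1 vn).
      by case: (zone_ofP 1 n.-1 vn) => //= *; rewrite ?comp1m //; lia.
    rewrite -!compA e -fK.
    have /= := congr1 (fun x => rh x vn) rf; rewrite (compA (rh r vn)) => ->.
    by rewrite comp1m zprK_zinK //; lia.
  move=> W h gW nh.
  pose hn := rh h vn \c zinK a (zone_of 1 n vn).
  have gWn := eval_gproj normC vn gW.
  case: (split_mono_or_through_proj regC gK lK gWn hn) => [
    [r rh1]|/(through_proj_ses ap)[t ta]].
    case: nh.
    have [||v v1 v2|//|H HE] := @into_bracket n C 1 n _ _ a W
      (fun v => a \c r \c trans W v vn) => //.
    - move=> u v uv; rewrite -compA trans_pre //=; have := n_n v; lia.
    - by exists (r \c trans W v vn); rewrite compA.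
    exists H; apply: from_bracket_ext => v v1 v2; last by have := n_n v; lia.
    apply: (zemb_mono ma); rewrite /= comp1m !compA HE.
    rewrite -!compA from_bracketK_trans //=; last by have := n_n v; lia.
    by rewrite -/hn rh1 compm1 zemb_zinK.
  have [||v v1 v2|u [uK uP]] := @from_bracket n C 1 n.-1 _ _ a W
    (fun v => rh h v \c zinK a (zone_of 1 n v)) (fun v => trans W vn v \c t).
  - by move=> u v uv u1; apply: from_bracketK_nat.
  - by move=> u v uv _ nu; have := n_n v; lia.
  - have -> : v = vn by apply: val_inj => /=; have := n_n v; lia.
    by rewrite trans_refl comp1m ta.
  exists u; apply: from_bracket_ext => v v1 v2; last by have := n_n v; lia.
  by rewrite /= -compA fK uK.
split.
  move=> [r gr].
  apply: (@split_epi_nproj _ G P p nG pP).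
  have [psi E] : exists psi, s' \c p \c psi = idmor _.
    exists (zemb a (zone_of 1 n.-1 vn) \c (rh r vn \c zinK a' (zone_of n n vn))).
    apply: ma'; rewrite !compA -gE.
    have /= := congr1 (fun x => rh x vn) gr; rewrite -(compA _ (rh g vn)) => ->.
    by rewrite !compm1 zemb_zinK //; lia.
  exists (psi \c s').
  by rewrite -[p]comp1m -ss' -!compA (compA s') (compA (s' \c p)) E comp1m.
move=> W h gW nh.
have [hn hnE] : exists hn : mor ((W : rep n C) vn) G',
    a' \c hn = zemb a' (zone_of n n vn) \c rh h vn.
  exists (zprK G' P' (zone_of n n vn) \c rh h vn).
  by apply: zemb_into => /=; lia.
have gWn := eval_gproj normC vn gW.
have bn (v w : 'I_n) (vw : nat_of_ord w = v.+1) :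
    zemb a' (zone_of n n w) \c rh h w \c rep_map W vw = zemb a' (zone_of n n v) \c rh h v.
  exact: into_bracket_nat.
have bt (v : 'I_n) : zemb a' (zone_of n n vn) \c rh h vn \c trans W v vn
    = zemb a' (zone_of n n v) \c rh h v.
  apply: (trans_fam (X := W) (b := fun v => zemb a' (zone_of n n v) \c rh h v)) => //=.
  by have := n_n v; lia.
case: (split_epi_or_through_proj regC gG lG gWn (s \c hn)) => [
  [r hr]|/(through_proj_epi (cokernel_epi kp))[t pt]].
  case: nh.
  have [||v v1 v2|H [HK _]] := @from_bracket n C n n _ _ a' W
      (fun v => trans W vn v \c (r \c s)) (fun=> 0).
  - by move=> u v uv un; have := n_n v; lia.
  - by move=> u v uv _ un; have := n_n v; lia.
  - by have := n_n v; lia.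
  exists H; apply: from_bracket_ext => v v1 v2; last by have := n_n v; lia.
  have -> : v = vn by apply: val_inj => /=; have := n_n v; lia.
  rewrite /= comp1m -compA HK /=; last by lia.
  apply: (zemb_mono ma').
  rewrite trans_refl comp1m compA -hnE zemb_zinK; last by rewrite /=; lia.
  have hr' : hn \c r = s' by rewrite -[LHS]comp1m -s's -!compA (compA s) hr compm1.
  by rewrite -compA (compA hn) hr' s's compm1.
have hnE' : a' \c hn = a' \c s' \c p \c t.
  by rewrite -!compA pt (compA s') s's comp1m.
have [||v v1 v2|//|u uE] := @into_bracket n C 1 n.-1 _ _ a W
  (fun v => t \c trans W v vn) => //.
- by move=> v w vw; rewrite -compA trans_pre //=; have := n_n w; lia.
- have [|x ax] := kernel_fact ka (h := t \c trans W v vn); last by exists x.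
  rewrite compA pt -compA.
  have -> : hn \c trans W v vn = 0.
    by apply: (mono0 ma'); rewrite compA hnE bt zemb0 ?comp0m //; lia.
  by rewrite compm0.
exists u; apply: (into_bracket_ext ma') => v.
by rewrite /= compA gE -compA uE compA -hnE' hnE bt.
Qed.
End Top.

Section Bottom.
Context (n2 : (2 <= n)%N) (K2 Q K P G : C).
Context (i2 : mor K2 Q) (q : mor Q K) (iq : proj_ses i2 q).
Context (a : mor K P) (p : mor P G) (ap : proj_ses a p).
Context (gK2 : gorenstein_projective K2) (lK2 : local_end K2) (nK2 : ~ projective K2).
Context (gK : gorenstein_projective K) (lK : local_end K) (nK : ~ projective K).
Context (gG : gorenstein_projective G).
Local Notation X := (bracket_rep n 1 1 i2 : R).
Local Notation L := (bracket_proj n 0 Q : R).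
Local Notation B := (bracket_rep n 2 n a : R).
Local Notation Z := (bracket_rep n 1 n a : R).

(** Here the first vertex decides. A lift [W_1 -> Q] of [h] along [q] is extended
    to the whole of [W]; the remainder of [h] vanishes at the first vertex and so
    defines a morphism to [B]. Dually, a retraction of the first component of
    [h : X -> W] is extended to a morphism [W -> X], whose composite with [h] is
    invertible by [bracket_endo_iso]. *)
Theorem almost_split_bottom :
  exists (f : mor X (dsum L B)) (g : mor (dsum L B) Z), almost_split GP f g.
Proof.
have [pQ kq cq extq] := iq; have mi := kernel_mono kq; have qi := kernel_comp0 kq.
have [pP ka kp ext] := ap; have ma := kernel_mono ka; have pa := kernel_comp0 ka.
have n_n (v : 'I_n) := ltn_ord v.
have lt0 : (0 < n)%N by lia.
have lt1 : (1 < n)%N by lia.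
have [v0 v0E] : exists v0 : 'I_n, v0 = 0%N :> nat by exists (Ordinal lt0).
have [v1 v1E] : exists v1 : 'I_n, v1 = 1%N :> nat by exists (Ordinal lt1).
have v0le (v : 'I_n) : (v0 <= v)%N by rewrite v0E.
have v0_1 : (v0.+1 <= 1)%N by rewrite v0E.
have v0_n : (v0.+1 <= n)%N by rewrite v0E.
have v1_1 : (1 < v1.+1)%N by rewrite v1E.
have v00 (v : 'I_n) : (v.+1 < 2)%N -> v = v0 by move=> h; apply: val_inj => /=; lia.
have [||v h1 h2|v h1|f1 f1E] := @into_bracket n C 0 0 _ _ (0 : mor zobj Q) X
  (fun v => zemb i2 (zone_of 1 1 v)) => //.
- exact: mono_from_zobj.
- by move=> u v uv; apply: zemb_step.
have [||v h1 h2|v h1|f2 f2E] := @into_bracket n C 2 n _ _ a X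
  (fun v => a \c q \c zemb i2 (zone_of 1 1 v)) => //.
- by move=> u v uv; have := congr1 (cmp (a \c q)) (zemb_step 1 1 i2 uv); rewrite compA.
- by exists (q \c zemb i2 (zone_of 1 1 v)); rewrite !compA.
- by rewrite zemb_factor // compA -(compA a) qi compm0 comp0m.
have [||v h1 h2|v h1|g1 g1E] := @into_bracket n C 1 n _ _ a L
  (fun v => a \c q \c zemb (0 : mor zobj Q) (zone_of 0 0 v)) => //.
- by move=> u v uv; have := congr1 (cmp (a \c q)) (zemb_step 0 0 (0 : mor zobj
  Q) uv); rewrite compA.
- by exists (q \c zemb (0 : mor zobj Q) (zone_of 0 0 v)); rewrite !compA.
have [||v h1 h2|v h1|g2 g2E] := @into_bracket n C 1 n _ _ a B
  (fun v => zemb a (zone_of 2 n v)) => //.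
- by move=> u v uv; apply: zemb_step.
- by exists (zprK K P (zone_of 2 n v)); rewrite zemb_factor.
have sq : g1 \c f1 = g2 \c f2.
  apply: (into_bracket_ext ma) => v.
  by rewrite /= !compA g1E g2E f2E -(compA (a \c q)) f1E.
have gX : GP X by apply: (bracket_gproj normC _ _ iq) => //; lia.
have gZ : GP Z by apply: (bracket_gproj normC _ _ ap) => //; lia.
have gB : GP B by apply: (bracket_gproj normC _ _ ap) => //; lia.
have pL : projective L by apply: bracket_proj_projective.
have gY : GP (dsum L B) by apply: gproj_dsum => //; apply: rep_normal_epis.
exists (dpair f1 (- f2)), (dcopair g1 g2).
have bic v : bicartesian (rh f1 v) (rh f2 v) (rh g1 v) (rh g2 v).
  have sqv : rh g1 v \c rh f1 v = rh g2 v \c rh f2 v by have :=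
    congr1 (fun x => rh x v) sq.
  move: (f1E v) (g1E v) (g2E v) sqv.
  move: (rh f1 v) (rh f2 v) (rh g1 v) (rh g2 v) => /=.
  case: (zone_ofP 0 0 v) => //= _ _; case: (zone_ofP 1 n v) => //= _ h1;
    last by have := n_n v; lia.
  case: (zone_ofP 1 1 v) => //= _ h2; case: (zone_ofP 2 n v) =>
    //= [h3|h3 h4|h3 h4]; try lia.
  - move=> f1' f2' g1' g2'; rewrite comp1m compm1 => -> ge _ s.
    have g1q : g1' = q by apply: ma.
    by apply: bicartesian_zero => //; [exact: zobjP|rewrite g1q..].
  - move=> f1' f2' g1' g2'; rewrite comp1m compm1 => -> ge ge2 s.
    apply: bicartesian_iso12 => //; first exact: is_iso1.
    have -> : g2' = idmor K by apply: ma; rewrite compm1.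
    exact: is_iso1.
have f2v0 : rh f2 v0 = 0.
  by apply: (zemb_mono ma (z := zone_of 2 n v0)); rewrite compm0 zemb0 ?comp0m.
have aE (v : 'I_n) (T : C) (x y : mor T (zone_obj K P (zone_of 1 n v))) :
    zprK K P (zone_of 1 n v) \c x = zprK K P (zone_of 1 n v) \c y -> x = y.
  by move=> e; apply: (zemb_mono ma (z := zone_of 1 n v));
    rewrite zemb_factor // -!compA e.
have g2v0 : rh g2 v0 = 0.
  by apply: (zemb_mono ma (z := zone_of 1 n v0)); rewrite compm0 g2E zemb0.
have pLv v : projective ((L : rep n C) v) by apply: (eval_projective (v := v)).
have f1K (v : 'I_n) : rh f1 v \c zinK i2 (zone_of 1 1 v) = zinP zobj Q (zone_of
  0 0 v) \c i2.
  apply: (zemb_mono (@mono_from_zobj _ _ 0) (z := zone_of 0 0 v)).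
  by rewrite !compA f1E zemb_zinK // zemb_zinP // comp1m.
have f1P (v : 'I_n) : (1 < v.+1)%N ->
    rh f1 v \c zinP K2 Q (zone_of 1 1 v) = zinP zobj Q (zone_of 0 0 v).
  move=> h; apply: (zemb_mono (@mono_from_zobj _ _ 0) (z := zone_of 0 0 v)).
  by rewrite !compA f1E !zemb_zinP.
have f2P (v : 'I_n) : (1 < v.+1)%N ->
    rh f2 v \c zinP K2 Q (zone_of 1 1 v) = zinK a (zone_of 2 n v) \c q.
  move=> h; apply: (zemb_mono ma (z := zone_of 2 n v)).
  by rewrite !compA f2E -!compA !zemb_zinP // compm1 compA zemb_zinK.
split.
- split=> //; split; [apply: rep_kernel|apply: rep_cokernel] => v; by case: (bic v).
- split.
    move=> [r rf].
    apply: (@split_mono_nproj _ _ _ (rh f1 v0 \c zinK i2 (zone_of 1 1 v0)) nK2 (pLv v0)).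
    exists (zprK K2 Q (zone_of 1 1 v0) \c rh (r \c inj1 L B) v0).
    have := congr1 (fun x => rh x v0) rf.
    rewrite -[r in LHS]dcopair_inj dcopair_dpair /= f2v0 oppr0 compm0 addr0 => e.
    by rewrite -compA (compA _ (rh f1 v0)) e comp1m zprK_zinK.
  move=> W h gW nh.
  have [h0 h0E] : exists h0 : mor K2 ((W : rep n C) v0),
    h0 = rh h v0 \c zinK i2 (zone_of 1 1 v0) by eexists.
  case: (split_mono_or_through_proj regC gK2 lK2 (eval_gproj normC v0 gW) h0)
    => [[r rh1]|/(through_proj_ses iq)[t ti]].
    case: nh.
    have [ta [tan ta0]] := gproj_extend normC pQ (i2 \c r) gW.
    have [//|//|v h1 h2|//|H HE] := @into_bracket n C 1 1 _ _ i2 W ta.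
      by have -> : v = v0; [apply: v00; lia|exists r].
    apply: (@split_mono_iso_comp _ _ _ _ H).
    apply: (bracket_endo_iso _ _ _ iq lK nK (v0 := v0)) => //; first by rewrite v0E.
    rewrite [X in is_iso X](_ : _ = r \c h0); first by rewrite rh1; apply: is_iso1.
    rewrite h0E; apply: mi; rewrite -compA zemb_into // /= -compA (compA _ (rh H v0)).
    by rewrite HE ta0 -compA.
  (* What [t] leaves of [h] at the second vertex vanishes on [K2]. *)
  have [|b bq] := cokernel_fact cq
      (h := rh h v1 \c zinP K2 Q (zone_of 1 1 v1) - trans W v0 v1 \c t).
    rewrite compBm -(compA (trans _ _ _)) ti h0E from_bracketK_trans // from_bracketKP //.
    by rewrite subrr.
  have [||v h1 h2|u1 [_ u1P]] := @from_bracket n C 0 0 _ _ (0 : mor zobj Q) W (fun=> 0)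
    (fun v => trans W v0 v \c t).
  - by move=> *; rewrite compm0.
  - by move=> u v uv _ _; rewrite compA -trans_step.
  - exact: from_zobj.
  have [||v h1 h2|u2 [u2K _]] := @from_bracket n C 2 n _ _ a W (fun v =>
    - (trans W v1 v \c b)) (fun=> 0).
  - by move=> u v uv u2; rewrite compmN compA -trans_step //=; lia.
  - by move=> *; rewrite compm0.
  - by have := n_n v; lia.
  exists (dcopair u1 u2); rewrite dcopair_dpair.
  apply: from_bracket_ext => v h1 h2.
    have -> : v = v0 by apply: v00; lia.
    rewrite /= f2v0 oppr0 compm0 addr0 -compA f1K compA u1P // trans_refl comp1m ti.
    by rewrite h0E.
  rewrite /= compmN compDl compNm -!compA f1P // f2P // (compA (rh u2 v)) u2K //.
  rewrite u1P // compNm opprK -compA bq compmB (compA _ (trans W v0 v1))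
    trans_comp //; last by lia.
  by rewrite addrC subrK from_bracketP_trans //=; lia.
split.
  move=> [r gr].
  apply: (@split_epi_nproj _ _ _ (zprK K P (zone_of 1 n v0) \c rh g1 v0) nK (pLv v0)).
  exists (rh (prj1 L B \c r) v0 \c zinK a (zone_of 1 n v0)).
  have := congr1 (fun x => rh x v0) gr.
  rewrite -[r in LHS]dpair_prj dcopair_dpair /= g2v0 comp0m addr0 => e.
  by rewrite -compA (compA (rh g1 v0)) e comp1m zprK_zinK.
move=> W h gW nh.
have [be beE] : exists be, be = (fun v => zemb a (zone_of 1 n v) \c rh h v) by eexists.
have ben : natural_to (X := W) be by rewrite beE => v w vw; apply: into_bracket_nat.
have [al alE] : exists al : forall v, mor ((W : rep n C) v) K, forall v, a \c al v = be v.
  by exists (fun v => zprK K P (zone_of 1 n v) \c rh h v) => v; rewrite zemb_into // beE.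
case: (split_epi_or_through_proj regC gK lK (eval_gproj normC v0 gW) (al v0))
  => [[r ar]|/(through_proj_epi (cokernel_epi cq))[t qt]].
  case: nh.
  have [||v h1 h2|H [HK _]] := @from_bracket n C 1 n _ _ a W (fun v =>
    trans W v0 v \c r) (fun=> 0).
  - by move=> u v uv _; rewrite compA -trans_step.
  - by move=> *; rewrite compm0.
  - by have := n_n v; lia.
  exists H; apply: from_bracket_ext => v h1 h2; last by have := n_n v; lia.
  apply: (zemb_mono ma (z := zone_of 1 n v)).
  rewrite /= comp1m -compA HK // zemb_zinK // compA.
  have -> : zemb a (zone_of 1 n v) \c rh h v = be v by rewrite beE.
  by rewrite compA (trans_fam ben) // -alE -compA ar compm1.
have [ta [tan ta0]] := gproj_extend normC pQ t gW.
have [//||v h1 h2|//|u1 u1E] := @into_bracket n C 0 0 _ _ (0 : mor zobj Q) W ta => //.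
  exact: mono_from_zobj.
have [//||v h1 h2|v h1|u2 u2E] := @into_bracket n C 2 n _ _ a W (fun v =>
  be v - a \c q \c ta v).
- by move=> v w vw; rewrite compBm ben -compA tan.
- by exists (al v - q \c ta v); rewrite compmB alE compA.
- by rewrite (v00 v h1) ta0 -alE -compA qt subrr.
exists (dpair u1 u2); rewrite dcopair_dpair; apply: (into_bracket_ext ma) => v.
rewrite /= compDr !compA g1E g2E u2E -(compA (a \c q)) u1E addrC subrK.
by rewrite beE.
Qed.
End Bottom.

Section Middle.
Context (i : nat) (i1 : (1 <= i)%N) (i_n : (i < n)%N).
Context (K P G : C) (a : mor K P) (p : mor P G) (ap : proj_ses a p).
Context (gK : gorenstein_projective K) (lK : local_end K) (nK : ~ projective K).
Context (gG : gorenstein_projective G) (lG : local_end G) (nG : ~ projective G).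
Local Notation X := (bracket_rep n i.+1 i.+1 a : R).
Local Notation L := (bracket_proj n i P : R).
Local Notation B := (bracket_rep n i i.+1 a : R).
Local Notation Z := (bracket_rep n i i a : R).

(** Let [phi : W_u -> W_w] be the structure map between the vertices [i] and
    [i + 1], with [phi - phi x phi] factoring through a projective.
    For [h : W -> Z] with first component [al : W_u -> K], if [al - al x phi] has a
    section then [h] has one, because [1 - x phi] makes the section vanish stably
    at the vertex [i + 1]; if it factors through a projective, then [al] factors
    through [phi], as is required for a lift to [B].
    For [h : X -> W] the same is done with [h0 - phi x h0], where
    [h0 : K -> W_w]. *)
Theorem almost_split_middle :
  exists (f : mor X (dsum L B)) (g : mor (dsum L B) Z), almost_split GP f g.
Proof.
have [pP ka kp ext] := ap; have ma := kernel_mono ka; have pa := kernel_comp0 ka.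
have n_n (v : 'I_n) := ltn_ord v.
have ltu : (i.-1 < n)%N by lia.
have [u uE] : exists u : 'I_n, u.+1 = i :> nat by exists (Ordinal ltu); rewrite /=; lia.
have [w wE] : exists w : 'I_n, w = i :> nat by exists (Ordinal i_n).
have uw : nat_of_ord w = u.+1 by lia.
have uv (v : 'I_n) : v.+1 = i -> v = u by move=> h; apply: val_inj => /=; lia.
have wv (v : 'I_n) : v.+1 = i.+1 -> v = w by move=> h; apply: val_inj => /=; lia.
have [||v h1 h2|v h1|f1 f1E] := @into_bracket n C i i _ _ (0 : mor zobj P) X
  (fun v => zemb a (zone_of i.+1 i.+1 v)).
- exact: mono_from_zobj.
- by move=> x y xy; apply: zemb_step.
- by exists 0; rewrite zemb0 ?compm0.
- by rewrite zemb0 //; lia.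
have [//||v h1 h2|v h1|f2 f2E] := @into_bracket n C i i.+1 _ _ a X
  (fun v => zemb a (zone_of i.+1 i.+1 v)).
- by move=> x y xy; apply: zemb_step.
- by exists (zprK K P (zone_of i.+1 i.+1 v)); rewrite zemb_factor.
- by rewrite zemb0 //; lia.
have [//||v h1 h2|v h1|g1 g1E] := @into_bracket n C i i _ _ a L
  (fun v => zemb (0 : mor zobj P) (zone_of i i v)).
- by move=> x y xy; apply: zemb_step.
- by exists 0; rewrite zemb_factor // comp0m compm0.
- by rewrite zemb0.
have [//||v h1 h2|v h1|g2 g2E] := @into_bracket n C i i _ _ a B
  (fun v => zemb a (zone_of i i.+1 v)).
- by move=> x y xy; apply: zemb_step.
- by exists (zprK K P (zone_of i i.+1 v)); rewrite zemb_factor //; lia.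
- by rewrite zemb0.
have sq : g1 \c f1 = g2 \c f2.
  apply: (into_bracket_ext ma) => v.
  by rewrite /= !compA g1E g2E f2E f1E.
have gX : GP X by apply: (bracket_gproj normC _ _ ap).
have gZ : GP Z by apply: (bracket_gproj normC _ _ ap).
have gB : GP B by apply: (bracket_gproj normC _ _ ap) => //; lia.
have pL : projective L by apply: bracket_proj_projective.
have gY : GP (dsum L B) by apply: gproj_dsum => //; apply: rep_normal_epis.
have pLv v : projective ((L : rep n C) v) by apply: (eval_projective (v := v)).
exists (dpair f1 (- f2)), (dcopair g1 g2).
have bic v : bicartesian (rh f1 v) (rh f2 v) (rh g1 v) (rh g2 v).
  have sqv : rh g1 v \c rh f1 v = rh g2 v \c rh f2 v by have :=
    congr1 (fun x => rh x v) sq.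
  move: (f1E v) (f2E v) (g1E v) (g2E v) sqv.
  move: (rh f1 v) (rh f2 v) (rh g1 v) (rh g2 v) => /=.
  have zi : is_iso (0 : mor (zobj : C) zobj) by exists 0; rewrite comp0m zobjP.
  case: (zone_ofP i i v) => [h1|h1 h2|h1 h2]; case: (zone_ofP i.+1 i.+1 v) => [
    h3|h3 h4|h3 h4];
    case: (zone_ofP i i.+1 v) => [h5|h5 h6|h5 h6] /=; try lia;
    move=> f1' f2' g1' g2' e1 e2 e3 e4 s.
  - by apply: bicartesian_iso12 => //; [rewrite (to_zobj f1' 0)|rewrite (to_zobj g2' 0)].
  - apply: bicartesian_iso12 => //; first by rewrite (to_zobj f1' 0).
    have -> : g2' = idmor K by apply: ma; rewrite e4 compm1.
    exact: is_iso1.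
  - apply: bicartesian_iso21 => //.
      have -> : f2' = idmor K by apply: ma; rewrite e2 compm1.
      exact: is_iso1.
    by rewrite -[g1']comp1m e3; apply: is_iso1.
  - apply: bicartesian_iso12 => //.
      by rewrite -[f1']comp1m e1; apply: is_iso1.
    by rewrite -[g2']comp1m e4; apply: is_iso1.
have f1K : rh f1 w \c zinK a (zone_of i.+1 i.+1 w) = zinP zobj P (zone_of i i w) \c a.
  apply: (zemb_mono (@mono_from_zobj _ _ 0) (z := zone_of i i w)).
  by rewrite !compA f1E zemb_zinK ?zemb_zinP ?comp1m //; lia.
have f1P (v : 'I_n) : (i.+1 < v.+1)%N ->
    rh f1 v \c zinP K P (zone_of i.+1 i.+1 v) = zinP zobj P (zone_of i i v).
  move=> h; apply: (zemb_mono (@mono_from_zobj _ _ 0) (z := zone_of i i v)).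
  by rewrite !compA f1E !zemb_zinP //; lia.
have f2K : rh f2 w \c zinK a (zone_of i.+1 i.+1 w) = zinK a (zone_of i i.+1 w).
  apply: (zemb_mono ma (z := zone_of i i.+1 w)).
  by rewrite !compA f2E !zemb_zinK //; lia.
have f2P (v : 'I_n) : (i.+1 < v.+1)%N ->
    rh f2 v \c zinP K P (zone_of i.+1 i.+1 v) = zinP K P (zone_of i i.+1 v).
  move=> h; apply: (zemb_mono ma (z := zone_of i i.+1 v)).
  by rewrite !compA f2E !zemb_zinP //; lia.
have Xu0 T (x y : mor T (zone_obj K P (zone_of i.+1 i.+1 u))) : x = y.
  by apply: (zemb_mono ma (z := zone_of i.+1 i.+1 u)); rewrite !zemb0 ?comp0m //; lia.
split.
- split=> //; split; [apply: rep_kernel|apply: rep_cokernel] => v; by case: (bic v).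
- split.
    move=> [r rf].
    apply: (@split_mono_nproj _ _ _ (rh f1 w \c zinK a (zone_of i.+1 i.+1 w)) nK (pLv w)).
    exists (zprK K P (zone_of i.+1 i.+1 w) \c rh (r \c inj1 L B) w).
    have := congr1 (fun x => rh x w) rf.
    rewrite -[r in LHS]dcopair_inj dcopair_dpair /= => e.
    have r20 : rh r w \c rep_inj2 L B w \c (- rh f2 w \c zinK a (zone_of i.+1
      i.+1 w)) = 0.
      rewrite compNm f2K compmN.
      have := from_bracketK_nat (r \c inj2 L B) uw; rewrite /= => <-; last by lia.
      by rewrite (Xu0 _ (_ \c zinK a (zone_of i i.+1 u)) 0) compm0 oppr0.
    have := congr1 (fun x => x \c zinK a (zone_of i.+1 i.+1 w)) e.
    rewrite compDl -!compA.
    move: r20; rewrite -!compA => -> ; rewrite addr0 comp1m => ->.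
    by rewrite zprK_zinK //; lia.
  move=> W h gW nh.
  have [h0 h0E] : exists h0 : mor K ((W : rep n C) w),
    h0 = rh h w \c zinK a (zone_of i.+1 i.+1 w) by eexists.
  set phi := rep_map W uw.
  have [x xP] := regC phi (eval_gproj normC u gW) (eval_gproj normC w gW).
  case: (split_mono_or_through_proj regC gK lK (eval_gproj normC w gW) (h0 -
    phi \c x \c h0)) => [[r rh1]|/(through_proj_ses ap)[t ta]].
    case: nh.
    have [Q [m [y [pQ my]]]] : through_proj (r \c (idmor _ - phi \c x) \c phi).
      rewrite -compA; apply: through_proj_compl; rewrite compBm comp1m //.
    have [ta [tan tau]] := gproj_extend normC pQ y gW.
    (* [r (1 - phi x)] vanishes on [W_u] only stably; [r'] does so exactly. *)
    pose r' := r \c (idmor _ - phi \c x) - m \c ta w.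
    have r'phi : r' \c phi = 0 by rewrite compBm -(compA m) tan tau my subrr.
    have r'h : is_iso (r' \c h0).
      rewrite compBm -(compA r) compBm comp1m rh1.
      by apply: local_1sub => //; exists Q, m, (ta w \c h0); rewrite compA.
    have [om [omn omw]] := gproj_extend normC pP (a \c r') gW.
    have [//|//|v h1 h2|v h1|H HE] := @into_bracket n C i.+1 i.+1 _ _ a W om.
      by have -> : v = w; [apply: wv; lia|exists r'].
      rewrite -(trans_fam omn (u := v) (v := u)); last by lia.
      by rewrite -(omn _ _ uw) omw -(compA a) r'phi compm0 comp0m.
    apply: (@split_mono_iso_comp _ _ _ _ H).
    apply: (bracket_endo_iso _ _ _ ap lG nG (v0 := w)) => //; first by rewrite wE.
    rewrite [X in is_iso X](_ : _ = r' \c h0) //.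
    rewrite h0E; apply: ma; rewrite -compA zemb_into ?wE // /= -compA (compA _ (rh H w)).
    by rewrite HE omw -compA.
  have [||v h1 h2|u1 [_ u1P]] := @from_bracket n C i i _ _ (0 : mor zobj P) W (fun=> 0)
    (fun v => trans W w v \c t).
  - by move=> *; rewrite compm0.
  - by move=> y v yv _ h'; rewrite compA -trans_step //; lia.
  - exact: from_zobj.
  have hdE (v : 'I_n) : (w <= v)%N -> trans W w v \c (h0 - phi \c x \c h0)
      = rh h v \c zinK a (zone_of i.+1 i.+1 v) - trans W u v \c (x \c h0).
    move=> wv'; rewrite compmB h0E from_bracketK_trans //; last by lia.
    by rewrite -(compA phi) (compA (trans W w v)) trans_pre.
  have [|||u2 [u2K u2P]] := @from_bracket n C i i.+1 _ _ a W (fun v =>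
    trans W u v \c (x \c h0))
    (fun v => rh h v \c zinP K P (zone_of i.+1 i.+1 v) - trans W w v \c t).
  - by move=> y v yv h'; rewrite compA -trans_step //; lia.
  - move=> y v yv h1 h2; rewrite compmB (compA _ (trans _ _ _)) -trans_step //;
    last by lia.
    by rewrite from_bracketP_nat //; lia.
  - move=> v h1 h2; rewrite compBm from_bracketKP //; last by lia.
    by rewrite -(compA (trans _ _ _)) ta hdE ?subKr //; lia.
  exists (dcopair u1 (- u2)); rewrite dcopair_dpair compNm compmN opprK.
  apply: from_bracket_ext => v h1 h2.
    have -> : v = w by apply: wv; lia.
    rewrite /= compDl -!compA f1K f2K (compA (rh u1 w)) u1P; try lia.
    rewrite u2K ?trans_refl ?comp1m ?ta -?h0E; try lia.
    by rewrite (trans_step _ uw) // trans_refl compm1 compA subrK.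
  rewrite /= compDl -!compA f1P // f2P // u1P ?u2P //; try lia.
  by rewrite addrC subrK.
split.
  move=> [r gr].
  have [s1 [s2 er]] : exists (s1 : mor Z L) (s2 : mor Z B), g1 \c s1 + g2 \c s2 = idmor Z.
    by exists (prj1 L B \c r), (prj2 L B \c r); rewrite -dcopair_dpair dpair_prj.
  have e : zprK K P (zone_of i i.+1 u) \c (rh s2 u \c zinK a (zone_of i i u)) = idmor K.
    apply: ma; rewrite zemb_into; last by lia.
    rewrite compA -g2E compm1.
    have := congr1 (fun x : mor Z Z => zemb a (zone_of i i u) \c rh x u \c zinK
      a (zone_of i i u)) er.
    rewrite /= compm1 zemb_zinK; last by lia.
    by rewrite compDr !compA g1E zemb_factor ?comp0m ?add0r //; lia.
  apply: (@split_mono_nproj _ _ _ a nK pP).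
  exists (zprK K P (zone_of i i.+1 w) \c rh s2 w \c zinP K P (zone_of i i w)).
  rewrite -!compA (compA (rh s2 w)) from_bracketKP; try lia.
  rewrite -(from_bracketK_nat s2 uw); last by lia.
  apply: etrans (compA _ _ _) _; apply: etrans e; congr (_ \c _).
  by apply: (@zprK_step n C i i.+1 K P a u w uw); lia.
move=> W h gW nh.
have [be beE] : exists be, be = (fun v => zemb a (zone_of i i v) \c rh h v) by eexists.
have ben : natural_to (X := W) be by rewrite beE => v y vy; apply: into_bracket_nat.
have be0 (v : 'I_n) : (v.+1 < i)%N -> be v = 0.
  by move=> hv; rewrite beE zemb0 // comp0m.
have [al alE] : exists al : mor ((W : rep n C) u) K, a \c al = be u.
  by exists (zprK K P (zone_of i i u) \c rh h u); rewrite zemb_into ?beE //; lia.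
set phi := rep_map W uw.
have [x xP] := regC phi (eval_gproj normC u gW) (eval_gproj normC w gW).
case: (split_epi_or_through_proj regC gK lK (eval_gproj normC u gW) (al - al \c
  x \c phi)) => [[s als]|[Q [m [y [pQ my]]]]].
  case: nh.
  (* [phi s'] factors through a projective, and [al s'] is still the identity. *)
  pose s' := s - x \c phi \c s.
  have als' : al \c s' = idmor K by rewrite compmB !compA -compBm.
  have [t ta] : exists t, t \c a = phi \c s'.
    apply: (through_proj_ses ap).
    have -> : phi \c s' = (phi - phi \c x \c phi) \c s by rewrite compmB compBm !compA.
    exact: through_proj_compr.
  have [|||H [HK HP]] := @from_bracket n C i i _ _ a W (fun v => trans W u v \c s')
    (fun v => trans W w v \c t).
  - by move=> v z vz h'; rewrite compA -trans_step //; lia.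
  - by move=> v z vz _ h'; rewrite compA -trans_step //; lia.
  - move=> v h1 h2; rewrite -compA ta compA trans_pre //; lia.
  apply: (@split_epi_iso_comp _ _ _ _ H).
  apply: (bracket_endo_iso _ _ _ ap lG nG (v0 := u)) => //; first by lia.
  rewrite [X in is_iso X](_ : _ = al \c s'); first by rewrite als'; apply: is_iso1.
  apply: ma; rewrite -compA zemb_into /=; last by lia.
  rewrite -compA HK; last by lia.
  by rewrite trans_refl comp1m !compA alE beE.
have [ta [tan tau]] := gproj_extend normC pQ y gW.
(* The defect [al - al x phi = m y] is extended along [phi]. *)
pose s := al \c x + m \c ta w.
have sphi : s \c phi = al by rewrite compDl -(compA m) tan tau my addrC subrK.
have [om [omn omw]] := gproj_extend normC pP (a \c s) gW.
have omu : om u = be u by rewrite -(omn _ _ uw) omw -compA sphi.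
have omv (v : 'I_n) : (v.+1 <= i)%N -> om v = be v.
  by move=> vi; rewrite -(trans_fam omn (u := v) (v := u)) ?omu ?(trans_fam ben) //; lia.
have [//|//|v h1 h2|v h1|u2 u2E] := @into_bracket n C i i.+1 _ _ a W om.
- case: (ltnP v i) => vi; first by have -> : v = u; [apply: uv; lia|exists al;
  rewrite omu].
  by have -> : v = w; [apply: wv; lia|exists s].
- by rewrite omv ?be0 //; lia.
have [||v h1 h2|v h1|u1 u1E] := @into_bracket n C i i _ _ (0 : mor zobj P) W
  (fun v => be v - om v).
- exact: mono_from_zobj.
- by move=> v z vz; rewrite compBm ben omn.
- by exists 0; rewrite compm0 omv ?subrr.
- by rewrite omv ?subrr //; lia.
exists (dpair u1 u2); rewrite dcopair_dpair; apply: (into_bracket_ext ma) => v.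
by rewrite /= compDr !compA g1E g2E u2E u1E subrK beE.
Qed.
End Middle.

End AlmostSplit.

(** * Regularity of the stable category *)

Section Cokernel.
Local Open Scope quotient_scope.
Context (D : precat) (X Y : D) (f : mor X Y).

(** The cokernel of [Hom(-, f)] is constructed objectwise, as a quotient group. *)
Definition im_pred (Z : D) : {pred mor Z Y} :=
  fun y => `[< exists x : mor Z X, f \c x = y >].

Lemma im_pred_closed Z : zmod_closed (@im_pred Z).
Proof.
split; first by apply/asboolP; exists 0; rewrite compm0.
move=> y z /asboolP[u <-] /asboolP[v <-]; apply/asboolP; exists (u - v).
exact: compmB.
Qed.

HB.instance Definition _ (Z : D) :=
  GRing.isZmodClosed.Build (mor Z Y) (@im_pred Z) (@im_pred_closed Z).

Definition coker (Z : D) : zmodType := Quotient.quot (@im_pred Z).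

Definition coker_pi (Z : D) (y : mor Z Y) : coker Z := \pi_(coker Z) y.

Lemma coker_pi_eq Z (y z : mor Z Y) :
  coker_pi y = coker_pi z <-> exists x, f \c x = y - z.
Proof.
split=> [/eqP|e]; rewrite /coker_pi.
  by rewrite -Quotient.idealrBE => /asboolP.
by apply/eqP; rewrite -Quotient.idealrBE; apply/asboolP.
Qed.

Lemma coker_pi_additive Z : zmod_morphism (@coker_pi Z).
Proof. by move=> y z; rewrite /coker_pi raddfB. Qed.

HB.instance Definition _ Z :=
  GRing.isZmodMorphism.Build (mor Z Y) (coker Z) (@coker_pi Z) (@coker_pi_additive Z).

Lemma coker_reprK Z (y : coker Z) : coker_pi (repr y) = y.
Proof. by rewrite /coker_pi reprK. Qed.

Definition coker_map (W Z : D) (g : mor W Z) (y : coker Z) : coker W :=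
  coker_pi (repr y \c g).

Lemma coker_mapE W Z (g : mor W Z) (y : mor Z Y) :
  coker_map g (coker_pi y) = coker_pi (y \c g).
Proof.
apply/coker_pi_eq; have [x e] := (coker_pi_eq _ _).1 (coker_reprK (coker_pi y)).
by exists (x \c g); rewrite compA e compBm.
Qed.

Lemma coker_map_additive W Z (g : mor W Z) : zmod_morphism (coker_map g).
Proof.
move=> y z; rewrite -(coker_reprK y) -(coker_reprK z) -raddfB !coker_mapE.
by rewrite compBm raddfB.
Qed.

HB.instance Definition _ W Z (g : mor W Z) :=
  GRing.isZmodMorphism.Build (coker Z) (coker W) (coker_map g)
    (@coker_map_additive W Z g).

Definition coker_functor : cfunctor D.
Proof.
refine (@CFunctor D coker (fun W Z g => (coker_map g : {additive coker Z ->
  coker W})) _ _ _).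
- by move=> Z a; rewrite -(coker_reprK a) /= coker_mapE compm1.
- by move=> W Z T g h a; rewrite -(coker_reprK a) /= !coker_mapE compA.
- by move=> W Z g h a; rewrite -(coker_reprK a) /= !coker_mapE compDr raddfD.
Defined.

Definition coker_nat : nattrans (yoneda Y) coker_functor.
Proof.
refine (@NatTrans D (yoneda Y) coker_functor
  (fun Z => (@coker_pi Z : {additive mor Z Y -> coker Z})) _).
by move=> W Z g a; rewrite /= coker_mapE.
Defined.

Definition postcomp (Z : D) (h : mor Z X) : mor Z Y := f \c h.

Lemma postcomp_additive Z : zmod_morphism (@postcomp Z).
Proof. by move=> u v; apply: compmB. Qed.

HB.instance Definition _ Z :=
  GRing.isZmodMorphism.Build (mor Z X) (mor Z Y) (@postcomp Z) (@postcomp_additive Z).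

Definition yoneda_map : nattrans (yoneda X) (yoneda Y).
Proof.
refine (@NatTrans D (yoneda X) (yoneda Y)
  (fun Z => (@postcomp Z : {additive mor Z X -> mor Z Y})) _).
by move=> W Z g a; apply: compA.
Defined.

Lemma coker_fp : finitely_presented coker_functor.
Proof.
exists X, Y, yoneda_map, coker_nat => Z; split=> [y|y]; last first.
  by exists (repr y); apply: coker_reprK.
rewrite /= -(raddf0 (@coker_pi Z)) coker_pi_eq subr0.
by split=> -[x e]; exists x.
Qed.

End Cokernel.

Section Regular.
Context (D : precat).

Definition nat_id (F : cfunctor D) : nattrans F F :=
  @NatTrans D F F (fun Z => (idfun : {additive F Z -> F Z})) (fun _ _ _ _ => erefl).

Lemma yoneda_fp (Y : D) : finitely_presented (yoneda Y).
Proof.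
exists Y, Y, (yoneda_map (0 : mor Y Y)), (nat_id _) => Z; split=> y /=.
  split=> [->|[x <-]]; last exact: comp0m.
  by exists 0; apply: comp0m.
by exists y.
Qed.

(** A finitely presented functor [coker Hom(-, f)] that is projective splits off
    [Hom(-, Y)]; the resulting idempotent [e] of [Y] satisfies [e f = 0] and
    [1 - e = f x]. *)
Lemma semisimple_regular (X Y : D) (f : mor X Y) : mod_semisimple D ->
  exists x : mor Y X, f \c x \c f = f.
Proof.
move=> ss; have pF := ss _ (coker_fp f).
have [|s sK] := pF _ _ (coker_nat f) (nat_id _) (yoneda_fp Y) (coker_fp f).
  move=> H a b _ ab Z y.
  by have := ab Z (repr y); rewrite /= coker_reprK.
pose e : mor Y Y := s Y (coker_pi f (idmor Y)).
have /= /(coker_pi_eq _ _ _)[x fx] := sK Y (coker_pi f (idmor Y)).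
have ef : e \c f = 0.
  have /= := ncompP s f (coker_pi f (idmor Y)).
  rewrite coker_mapE comp1m /precomp -/e => <-.
  have -> : coker_pi f f = 0.
    rewrite -(raddf0 (@coker_pi _ _ _ f X)); apply/coker_pi_eq.
    by exists (idmor X); rewrite compm1 subr0.
  exact: raddf0.
exists (- x); rewrite compmN compNm fx compBm comp1m -/e ef sub0r opprK //.
Qed.

End Regular.

Lemma semisimple_stably_regular (C : addcat) :
  mod_semisimple (stable (@gorenstein_projective C)) -> stably_regular C.
Proof.
move=> ss X Y f gX gY.
pose X' : stable (@gorenstein_projective C) := SubObj gX.
pose Y' : stable (@gorenstein_projective C) := SubObj gY.
have [x] := @semisimple_regular _ X' Y' (scls f : mor X' Y') ss.
have -> : (scls f : mor X' Y') \c x \c (scls f : mor X' Y') = scls (f \c repr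
  (x : shom Y X) \c f).
  by rewrite -[RHS]scompE -(scompE f (repr _)) sclsK.
move=> /esym/eqP; rewrite -Quotient.idealrBE => /asboolP e.
by exists (repr (x : shom Y X)).
Qed.

(** * Finitely generated modules *)

Section QuotientModule.
Local Open Scope quotient_scope.
Context (R : pzRingType) (M N : lmodType R) (f : {linear M -> N}).

(** The quotient module [N / f(M)]; it provides the cokernels of [modcat R]. *)
Definition im_lin : {pred N} := fun y => `[< exists x, f x = y >].

Lemma im_lin_closed : zmod_closed im_lin.
Proof.
split; first by apply/asboolP; exists 0; rewrite linear0.
move=> y z /asboolP[u <-] /asboolP[v <-]; apply/asboolP; exists (u - v).
exact: linearB.
Qed.

HB.instance Definition _ := GRing.isZmodClosed.Build N im_lin im_lin_closed.

Definition qmod : Type := Quotient.quot im_lin.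
HB.instance Definition _ := GRing.Zmodule.on qmod.

Definition qpi (y : N) : qmod := \pi_(Quotient.quot im_lin) y.

Lemma qpi_eq y z : qpi y = qpi z <-> exists x, f x = y - z.
Proof.
split=> [/eqP|e]; rewrite /qpi.
  by rewrite -Quotient.idealrBE => /asboolP.
by apply/eqP; rewrite -Quotient.idealrBE; apply/asboolP.
Qed.

Lemma qpi_surj (y : qmod) : exists x, qpi x = y.
Proof. by exists (repr (y : Quotient.quot im_lin)); rewrite /qpi reprK. Qed.

Lemma qpiD y z : qpi (y + z) = qpi y + qpi z.
Proof. by rewrite /qpi raddfD. Qed.

Definition qscale (a : R) (y : qmod) : qmod :=
  qpi (a *: repr (y : Quotient.quot im_lin)).

Lemma qscaleE a y : qscale a (qpi y) = qpi (a *: y).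
Proof.
apply/qpi_eq; have /qpi_eq[x fx] : qpi (repr (qpi y : Quotient.quot im_lin)) = qpi y.
  by rewrite /qpi reprK.
by exists (a *: x); rewrite linearZ /= fx scalerBr.
Qed.

Lemma qscaleA a b y : qscale a (qscale b y) = qscale (a * b) y.
Proof. by have [x <-] := qpi_surj y; rewrite !qscaleE scalerA. Qed.

Lemma qscale1 : left_id 1 qscale.
Proof. by move=> y; have [x <-] := qpi_surj y; rewrite qscaleE scale1r. Qed.

Lemma qscaleDr : right_distributive qscale +%R.
Proof.
move=> a y z; have [x <-] := qpi_surj y; have [x' <-] := qpi_surj z.
by rewrite -qpiD !qscaleE scalerDr qpiD.
Qed.

Lemma qscaleDl y : {morph qscale^~ y : a b / a + b}.
Proof.
by move=> a b; have [x <-] := qpi_surj y; rewrite !qscaleE scalerDl qpiD.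
Qed.

HB.instance Definition _ :=
  GRing.Zmodule_isLmodule.Build R qmod qscaleA qscale1 qscaleDr qscaleDl.

Lemma qpi_linear : linear qpi.
Proof. by move=> a y z; rewrite qpiD -qscaleE. Qed.

HB.instance Definition _ := GRing.isLinear.Build R N qmod *:%R qpi qpi_linear.

Lemma qmod_fingen : fingen N -> fingen qmod.
Proof.
move=> [s hs]; exists (map qpi s) => y; have [x <-] := qpi_surj y.
have [c ->] := hs x; have e : size (map qpi s) = size s by rewrite size_map.
exists (fun i => c (cast_ord e i)); rewrite linear_sum.
rewrite (reindex (cast_ord e)) /=; last first.
  by exists (cast_ord (esym e)) => i _; rewrite ?cast_ordK ?cast_ordKV.
apply: eq_bigr => i _; rewrite linearZ /= (nth_map 0) //.
by rewrite -[X in (_ < X)%N]e.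
Qed.

End QuotientModule.

Section ModCat.
Local Open Scope quotient_scope.
Context (R : pzRingType).
Local Notation A := (modcat R).
Implicit Types X Y Z : A.

Lemma mod_cokernel X Y (f : mor X Y) :
  exists Z (c : mor Y Z), is_cokernel f c /\
    forall y, c y = 0 -> exists x, f x = y.
Proof.
pose Z : A := FgMod (qmod_fingen f (fgmodP Y)).
pose c : mor Y Z := (@qpi _ _ _ f : {linear (Y : fgmod R) -> qmod f}).
have c0 y : c y = 0 -> exists x, f x = y.
  rewrite -(linear0 c) => /qpi_eq[x]; rewrite subr0 => e; by exists x.
exists Z, c; split=> //; apply: cokernelI.
- apply: linear_ext => x /=; rewrite -(linear0 c); apply/qpi_eq.
  by exists x; rewrite subr0.
- move=> W g h e; apply: linear_ext => y; have [x <-] := qpi_surj y.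
  by have := congr1 (fun k : {linear (Y : fgmod R) -> (W : fgmod R)} => k x) e.
- move=> W h hf.
  have hf0 x : h (f x) = 0.
    by have := congr1 (fun k : {linear (X : fgmod R) -> (W : fgmod R)} => k x) hf.
  pose u (z : Z) : W := h (repr (z : Quotient.quot (im_lin f))).
  have uE y : u (c y) = h y.
    apply/eqP; rewrite -subr_eq0 /u -linearB; apply/eqP.
    have /qpi_eq[x <-] : qpi f (repr (c y : Quotient.quot (im_lin f))) = qpi f y.
      by rewrite /qpi reprK.
    exact: hf0.
  have ul : linear u.
    move=> a y z; have [y' <-] := qpi_surj y; have [z' <-] := qpi_surj z.
    by rewrite -linearP !uE linearP.
  pose ulin := GRing.isLinear.Build _ _ _ _ u ul.
  pose u' : {linear (Z : fgmod R) -> (W : fgmod R)} := HB.pack u ulin.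
  by exists u'; apply: linear_ext => y; apply: uE.
Qed.

Lemma mod_epi_surj X Y (f : mor X Y) : epi f -> forall y : Y, exists x, f x = y.
Proof.
move=> ef y; have [Z [c [cf c0]]] := mod_cokernel f.
apply: c0; have -> : c = 0 by apply: (epi0 ef); apply: cokernel_comp0 cf.
by [].
Qed.

Lemma fingen_regular : fingen R^o.
Proof.
exists [:: 1] => x; exists (fun=> x); rewrite big_ord1 /=.
by rewrite -[LHS](@mulr1 R).
Qed.

Definition free1 : A := FgMod fingen_regular.

Lemma free1_map Y (y : Y) : exists h : mor free1 Y, h (1 : R^o) = y.
Proof.
pose u (a : R^o) : Y := (a : R) *: y.
have ul : linear u by move=> a b c; rewrite /u scalerDl scalerA.
pose ulin := GRing.isLinear.Build _ _ _ _ u ul.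
pose u' : {linear R^o -> (Y : fgmod R)} := HB.pack u ulin.
by exists u'; apply: scale1r.
Qed.

(** An element of [Y] is a morphism from the free module of rank one. *)
Lemma mod_kernel_mem X Y Z (k : mor X Y) (f : mor Y Z) : is_kernel k f ->
  forall y : Y, f y = 0 -> exists x, k x = y.
Proof.
move=> hk y fy; have [h hy] := free1_map y.
have [|u ku] := kernel_fact hk (h := h).
  apply: linear_ext => a /=.
  have -> : a = (a : R) *: (1 : R^o) by rewrite -[LHS](@mulr1 R).
  by rewrite linearZ /= hy linearZ /= fy scaler0.
exists (u (1 : R^o)).
by have := congr1 (fun g : {linear R^o -> (Y : fgmod R)} => g 1) ku; rewrite hy.
Qed.

Lemma mod_normal_epis : normal_epis A.
Proof.
move=> X Y Z k f hk ef; have fs := mod_epi_surj ef; have km := mod_kernel_mem hk.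
apply: cokernelI => //; first exact: kernel_comp0 hk.
move=> W h hk0; have [s sP] := choice fs.
have h0 y : f y = 0 -> h y = 0.
  move=> /km[x <-].
  by have := congr1 (fun g : {linear (X : fgmod R) -> (W : fgmod R)} => g x) hk0.
have hE y y' : f y = f y' -> h y = h y'.
  by move=> e; apply/subr0_eq; rewrite -linearB h0 // linearB e subrr.
pose u (z : Z) : W := h (s z).
have ul : linear u.
  by move=> a y z; rewrite /u -linearP; apply: hE; rewrite linearP !sP.
pose ulin := GRing.isLinear.Build _ _ _ _ u ul.
pose u' : {linear (Z : fgmod R) -> (W : fgmod R)} := HB.pack u ulin.
by exists u'; apply: linear_ext => y; apply: hE; apply: sP.
Qed.

(** The cokernels of [1 - e] and [e] are complementary summands of [X]. *)
Lemma mod_idempotent X (e : mor X X) : indecomposable X -> e \c e = e ->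
  e = 0 \/ e = idmor X.
Proof.
move=> [_ ind] ee.
have [Z [c [hc _]]] := mod_cokernel (idmor X - e).
have [Z' [c' [hc' _]]] := mod_cokernel e.
have ce : c \c e = c.
  apply/esym/subr0_eq; rewrite -[X in X - _]compm1 -compmB.
  exact: cokernel_comp0 hc.
have c'e := cokernel_comp0 hc'.
have [|s sc] := cokernel_fact hc (h := e); first by rewrite compmB compm1 ee subrr.
have [|s' sc'] := cokernel_fact hc' (h := idmor X - e).
  by rewrite compBm comp1m ee subrr.
have cs : c \c s = idmor Z.
  by apply: (cokernel_epi hc); rewrite -compA sc ce comp1m.
have cs' : c' \c s' = idmor Z'.
  by apply: (cokernel_epi hc'); rewrite -compA sc' compmB compm1 c'e subr0 comp1m.
have cs0 : c \c s' = 0.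
  apply: (epi0 (cokernel_epi hc')); rewrite -compA sc'.
  exact: cokernel_comp0 hc.
have cs0' : c' \c s = 0.
  by apply: (epi0 (cokernel_epi hc)); rewrite -compA sc.
have [|Z0|Z0] := ind Z Z'.
- exists (dpair c c'), (dcopair s s'); split.
    by rewrite dcopair_dpair sc sc' addrC subrK.
  apply: dcopair_ext; rewrite comp1m -compA dpair_comp ?dcopair_inj1 ?dcopair_inj2.
    by rewrite cs cs0' /dpair compm0 addr0 compm1.
  by rewrite cs0 cs' /dpair compm0 add0r compm1.
- by left; rewrite -sc -(comp1m c) Z0 comp0m compm0.
- right; apply/esym/subr0_eq.
  by rewrite -sc' -(comp1m c') Z0 comp0m compm0.
Qed.

End ModCat.

Section Dcc.
Context (k : comNzRingType) (art : artinian k) (T : eqType).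

Definition subspace (J : (T -> k) -> Prop) :=
  J (fun=> 0) /\ forall c u v, J u -> J v -> J (fun t => c * u t + v t).

(** By induction on the support [s]: a chain is controlled by the ideals of values
    at the head [t] and by the subspaces of the functions vanishing at [t]. *)
Lemma dcc_fun (s : seq T) (J : nat -> (T -> k) -> Prop) :
  (forall m, subspace (J m)) ->
  (forall m u, J m.+1 u -> J m u) ->
  (forall m u, J m u -> forall t, t \notin s -> u t = 0) ->
  exists N, forall m, (N <= m)%N -> forall u, J N u -> J m u.
Proof.
elim: s J => [|t s IH] J Js Jd Jsupp.
  exists 0%N => m _ u Ju; have -> : u = fun=> 0 by apply: funext => t;
    apply: Jsupp Ju _ _.
  by case: (Js m).
have Jle (m m' : nat) u : (m <= m')%N -> J m' u -> J m u.
  move=> /subnK <-; elim: (m' - m)%N => // d IHd.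
  by rewrite addSn => /Jd.
(* The values at [t] form a descending chain of ideals of [k]. *)
pose I (m : nat) : {pred k^o} := fun c : k^o => `[< exists2 u, J m u & u t = c >].
have [m1 m1P] : exists N, forall m, (N <= m)%N -> I m =i I N.
  apply: art => [m|m c].
    split; first by apply/asboolP; exists (fun=> 0) => //; case: (Js m).
    move=> c _ _ /asboolP[u Ju <-] /asboolP[v Jv <-]; apply/asboolP.
    exists (fun x => c * u x + v x) => //.
    by case: (Js m) => _; apply.
  by move=> /asboolP[u Ju uc]; apply/asboolP; exists u => //; apply: Jd.
have [|||m2 m2P] := IH (fun m u => J m u /\ u t = 0).
- move=> m; case: (Js m) => J0 JD; split=> // c u v [Ju u0] [Jv v0].
  by split; [apply: JD|rewrite u0 v0 mulr0 addr0].
- by move=> m u [/Jd].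
- move=> m u [/Jsupp h u0] x xs.
  by have [->|xt] := eqVneq x t; last by apply: h; rewrite inE negb_or xt.
exists (maxn m1 m2) => m; rewrite geq_max => /andP[lm1 lm2] u Ju.
have : u t \in I m.
  rewrite (m1P m lm1); apply/asboolP; exists u => //.
  by apply: Jle Ju; apply: leq_maxl.
move=> /asboolP[u' Ju' u't].
pose w x := (-1) * u' x + u x.
have Jw : J m2 w.
  case: (Js m2) => _; apply; first exact: Jle Ju'.
  by apply: Jle Ju; apply: leq_maxr.
have [Jmw _] : J m w /\ w t = 0.
  by apply: m2P => //; split=> //; rewrite /w u't mulN1r addNr.
have -> : u = fun x => 1 * w x + u' x.
  by apply: funext => x; rewrite /w mul1r mulN1r addrAC addNr add0r.
by case: (Js m) => _; apply.
Qed.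

End Dcc.

Section Powers.
Context (C : addcat) (X : C) (f : mor X X).

Fixpoint mpow (m : nat) : mor X X := if m is m'.+1 then f \c mpow m' else idmor X.

Lemma mpowD a b : mpow (a + b) = mpow a \c mpow b.
Proof. by elim: a => [|a IH] /=; [rewrite comp1m|rewrite IH compA]. Qed.

Lemma mpowSr a : mpow a.+1 = mpow a \c f.
Proof. by rewrite -addn1 mpowD /= compm1. Qed.

Lemma geometric m : exists g,
  g \c (idmor X - f) = idmor X - mpow m /\ (idmor X - f) \c g = idmor X - mpow m.
Proof.
elim: m => [|m [g [gl gr]]].
  by exists 0; rewrite comp0m compm0 subrr.
exists (g + mpow m); split.
  by rewrite compDl gl compmB compm1 -mpowSr addrA subrK.
by rewrite compDr gr compBm comp1m addrA subrK.
Qed.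

(** For [a = f ^ (m + 1)], the equations [a = a a x] and [a = y a a] make
    [a x = y a] an idempotent. *)
Lemma pi_regular_local m (x y : mor X X) :
  (forall e : mor X X, e \c e = e -> e = 0 \/ e = idmor X) ->
  mpow m.+1 = mpow m.+1 \c mpow m.+1 \c x ->
  mpow m.+1 = y \c (mpow m.+1 \c mpow m.+1) ->
  is_iso f \/ is_iso (idmor X - f).
Proof.
have [a aE] : exists a, a = mpow m.+1 by eexists.
move=> idem; rewrite -aE => ax ay.
have axy : a \c x = y \c a by rewrite {1}ay -!compA (compA a a) -ax.
have ee : (a \c x) \c (a \c x) = a \c x.
  by rewrite {1}axy -compA (compA a a) -ax axy.
case: (idem _ ee) => e.
  right; have a0 : a = 0 by rewrite ax -compA e compm0.
  have [g [gl gr]] := geometric m.+1.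
  by exists g; rewrite gl gr -aE a0 subr0.
left; apply: is_isoP.
  by exists (y \c mpow m); rewrite -compA -mpowSr -aE -axy e.
by exists (mpow m \c x); rewrite compA -e aE.
Qed.

End Powers.

Section Fitting.
Context (k : comNzRingType) (L : algType k) (hL : artin_algebra L).
Local Notation A := (rmodcat L).
Implicit Types X : A.

Lemma central_linear X (c : k) : linear (fun x : (X : fgmod L^c) => (c%:A : L^c) *: x).
Proof.
move=> a x y; rewrite scalerDr !scalerA; congr (_ *: _ + _).
have h : (a : L) * (c%:A : L) = (c%:A : L) * (a : L) by rewrite mulr_algr mulr_algl.
exact: h.
Qed.

(** Elements of [k] act by endomorphisms because they are central in [L]. *)
Lemma kscale X (c : k) : exists K : mor X X, forall x, K x = (c%:A : L^c) *: x.
Proof.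
pose u (x : X) : X := (c%:A : L^c) *: x.
pose ulin := GRing.isLinear.Build _ _ _ _ u (@central_linear X c).
pose u' : {linear (X : fgmod L^c) -> (X : fgmod L^c)} := HB.pack u ulin.
by exists u'.
Qed.
(** [End(X)] is an Artinian [k]-module: an endomorphism is determined by the
    coordinates in [k] of its values on generators. *)
Lemma end_dcc X (I : nat -> mor X X -> Prop) :
  (forall m, I m 0) ->
  (forall m (c : k) (K f g : mor X X), (forall x, K x = (c%:A : L^c) *: x) ->
     I m f -> I m g -> I m (K \c f + g)) ->
  (forall m f, I m.+1 f -> I m f) ->
  exists N, forall m, (N <= m)%N -> forall f, I N f -> I m f.
Proof.
move=> I0 ID Id; case: hL => art [t tP]; case: (fgmodP X) => s sP.
(* [u (i, (i', j))] is the coordinate of the image of the generator [s_i] at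
   [t_j s_i']. *)
pose T := ('I_(size s) * ('I_(size s) * 'I_(size t)))%type.
pose val_ (u : T -> k) i := \sum_i' \sum_j (u (i, (i', j)) *: t`_j : L^c) *: s`_i'.
pose rho u (f : mor X X) := forall i : 'I_(size s), f s`_i = val_ u i.
have rho_inj u f g : rho u f -> rho u g -> f = g.
  move=> hf hg; apply: linear_ext => x; have [c ->] := sP x.
  by rewrite !linear_sum; apply: eq_bigr => i _; rewrite !linearZ /= hf hg.
have rho_ex f : exists u, rho u f.
  have [c cP] := choice (fun i : 'I_(size s) => sP (f s`_i)).
  have [d dP] := choice (fun x : L => tP x).
  exists (fun x => d (c x.1 x.2.1) x.2.2) => i; rewrite cP; apply: eq_bigr => i' _.
  by rewrite -scaler_suml {1}(dP (c i i')).
have rho_lin c u v (K f g : mor X X) : (forall x, K x = (c%:A : L^c) *: x) ->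
    rho u f -> rho v g -> rho (fun x => c * u x + v x) (K \c f + g).
  move=> KP hf hg i.
  transitivity (K (f s`_i) + g s`_i); first by [].
  rewrite KP.
  rewrite hf hg /val_ scaler_sumr -big_split /=; apply: eq_bigr => i' _.
  rewrite scaler_sumr -big_split /=; apply: eq_bigr => j _.
  rewrite scalerA -scalerDl; congr (_ *: _).
  have h : (u (i, (i', j)) *: t`_j : L) * (c%:A : L) + v (i, (i', j)) *: t`_j
      = (c * u (i, (i', j)) + v (i, (i', j))) *: t`_j.
    by rewrite mulr_algr scalerA scalerDl.
  exact: h.
have rho0 : rho (fun=> 0) 0.
  move=> i; rewrite /val_ big1 // => i' _; rewrite big1 // => j _.
  by rewrite scale0r; apply: scale0r.
pose J m (u : T -> k) := exists2 f, I m f & rho u f.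
have [|||N NP] := @dcc_fun k art T (enum {: T}) J.
- move=> m; split; first by exists 0.
  move=> c u v [f If uf] [g Ig vg]; have [K KP] := kscale X c.
  by exists (K \c f + g); [apply: ID If Ig|apply: rho_lin].
- by move=> m u [f If uf]; exists f => //; apply: Id.
- by move=> m u _ x; rewrite mem_enum.
exists N => m Nm f If; have [u uf] := rho_ex f.
have [|g Ig ug] := NP m Nm u; first by exists f.
by rewrite (rho_inj _ _ _ uf ug).
Qed.

(** Fitting's lemma: the chains [f^m End(X)] and [End(X) f^m] become stationary. *)
Lemma indecomposable_local X : indecomposable X -> local_end X.
Proof.
move=> indX f.
have [|||N1 P1] := @end_dcc X (fun m g => exists x, g = mpow f m \c x).
- by move=> m; exists 0; rewrite compm0.
- move=> m c K _ _ KP [x ->] [y ->]; exists (K \c x + y).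
  rewrite compDr !compA; congr (_ \c _ + _).
  by apply: linear_ext => z; rewrite /= !KP linearZ.
- by move=> m _ [x ->]; exists (f \c x); rewrite mpowSr compA.
have [|||N2 P2] := @end_dcc X (fun m g => exists x, g = x \c mpow f m).
- by move=> m; exists 0; rewrite comp0m.
- move=> m c K _ _ KP [x ->] [y ->]; exists (K \c x + y).
  by rewrite compDl compA.
- by move=> m _ [x ->]; exists (x \c f); rewrite -compA.
pose M := (maxn N1 N2).+1.
have M1 : (N1 <= M)%N by rewrite leqW // leq_maxl.
have M2 : (N2 <= M)%N by rewrite leqW // leq_maxr.
have [|x ax] := P1 (M + M)%N (leq_trans M1 (leq_addr _ _)) (mpow f M).
  by exists (mpow f (M - N1)%N); rewrite -mpowD subnKC.
have [|y ay] := P2 (M + M)%N (leq_trans M2 (leq_addr _ _)) (mpow f M).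
  by exists (mpow f (M - N2)%N); rewrite -mpowD subnK.
rewrite mpowD in ax; rewrite mpowD in ay.
exact: (@pi_regular_local _ X f (maxn N1 N2) x y (fun e =>
  @mod_idempotent _ X e indX) ax ay).
Qed.

End Fitting.

(** * The theorem for G-semisimple algebras *)

Theorem lemma5p13 (k : comNzRingType) (L : algType k) (hL : g_semisimple L)
    (n : nat) (hn : (2 <= n)%N) (G : rmodcat L)
    (G_gprj : gprj G) (G_indec : indecomposable G) (G_nproj : ~ projective G)
    (sG : syzygy G) (sOG : syzygy (Omega sG))
    (cG : cosyzygy G) (sOiG : syzygy (Omega_inv cG)) :
  let P1 : rmodcat L := pcover sOG in
  [/\ almost_split_form (@gprj_rep k L n)
        (bracket n 1 n sG)
        (bracket n 1 n.-1 sG)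
        (bracket n n n sOiG),
      almost_split_form (@gprj_rep k L n)
        (bracket n 1 1 sOG)
        (dsum (bracket_proj n 0 P1) (bracket n 2 n sG))
        (bracket n 1 n sG)
    & forall i : nat, (1 <= i < n)%N ->
      almost_split_form (@gprj_rep k L n)
        (bracket n i.+1 i.+1 sOG)
        (dsum (bracket_proj n i P1) (bracket n i i.+1 sOG))
        (bracket n i i sOG)].
Proof.
move=> P1; have [art _ ss] := hL.
have normC : normal_epis (rmodcat L) := @mod_normal_epis _.
have regC : stably_regular (rmodcat L) := semisimple_stably_regular ss.
have lG : local_end G := indecomposable_local art G_indec.
have [sesG gO] := syz_ses normC G_gprj sG.
have nO : ~ projective (Omega sG) := syz_nproj normC G_gprj G_nproj (S := sG).
have lO : local_end (Omega sG) := syz_local normC G_gprj lG (S := sG).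
have [sesO gO2] := syz_ses normC gO sOG.
have nO2 : ~ projective (Omega sOG) := syz_nproj normC gO nO (S := sOG).
have lO2 : local_end (Omega sOG) := syz_local normC gO lO (S := sOG).
have iG := Omega_Omega_inv normC sOiG G_gprj G_nproj lG.
split.
- have [f [g fg]] := almost_split_top normC regC hn sesG gO lO nO G_gprj lG G_nproj
    (kernel_mono (OmegaP sOiG)) iG.
  by apply: almost_split_unique fg; apply: (bracket_local _ _ _ sesG lG
    G_nproj) => //; lia.
- have [f [g fg]] := almost_split_bottom normC regC hn sesO sesG gO2 lO2 nO2 gO
  lO nO G_gprj.
  by apply: almost_split_unique fg; apply: (bracket_local _ _ _ sesO lO nO) => //; lia.
move=> i /andP[i1 i_n].
have [f [g fg]] := almost_split_middle normC regC i1 i_n sesO gO2 lO2 nO2 gO lO nO.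
by apply: almost_split_unique fg; apply: (bracket_local _ _ _ sesO lO nO) => //; lia.
Qed.
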